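(* For $\beta\in(-1,1)$ consider the fictitious play dynamics $$\frac{dp^A}{dt}\in BR_A(p^B)-p^A,\qquad \frac{dp^B}{dt}\in BR_B(p^A)-p^B$$ for the $3\times 3$ game with matrices $$A=\begin{pmatrix}1&0&\beta\\ \beta&1&0\\ 0&\beta&1\end{pmatrix},\qquad B=\begin{pmatrix}-\beta&1&0\\0&-\beta&1\\1&0&-\beta\end{pmatrix},$$ and let $\sigma=(\sqrt5-1)/2$. (i) For $\beta\in[0,\sigma)$ there exists a periodic orbit (the clockwise, or Shapley, orbit) along which the pair (strategy of player A, strategy of player B) cyclically repeats, in this order, $(1,2),(2,2),(2,3),(3,3),(3,1),(1,1)$. It is a continuous deformation of the periodic orbit with the same pattern existing for $\beta\le 0$, and as $\beta\uparrow\sigma$ it shrinks in diameter to zero and tends to the point $(E^A,E^B)$. This orbit is stable for all $\beta\in[0,\sigma)$. (ii) For $\beta\in(\sigma,1)$ there exists a periodic orbit (the anticlockwise, or anti-Shapley, orbit) along which the pair (strategy of player A, strategy of player B) cyclically repeats, in this order, $(1,3),(1,2),(3,2),(3,1),(2,1),(2,3)$. As $\beta\downarrow\sigma$ this orbit shrinks in diameter to zero and tends to the point $(E^A,E^B)$. Such a periodic orbit does not exist when $\beta<\sigma$. (iii) Shapley's (clockwise) periodic orbit is attracting for all $\beta\in[0,\sigma)$. The anti-Shapley (anticlockwise) periodic orbit, which exists for $\beta\in(\sigma,1)$, is attracting when $\beta\in(\tau,1)$ and of saddle-type when $\beta\in(\sigma,\tau)$. Here $\tau$ is the root of a specific expression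 (given in the context) and is approximately $0.915$.
   Context: $\Sigma_A,\Sigma_B\subset\mathbb{R}^3$ denote the simplex of probability vectors; $p^A\in\Sigma_A$ is a row vector and $p^B\in\Sigma_B$ a column vector. $P^A_i\in\Sigma_A$, $P^B_j\in\Sigma_B$ are the pure strategies (unit vectors). Put $v^A=Ap^B$, $v^B=p^AB$. $BR_A(p^B)\subset\Sigma_A$ is the set of convex combinations of those $P^A_i$ for which $v^A_i$ is a maximal coordinate of $v^A$; $BR_B(p^A)\subset\Sigma_B$ is defined similarly from $v^B$. The ''strategy'' of player A (resp. B) at a given time is the index of the largest component of $v^A$ (resp. $v^B$). The interior equilibrium is $(E^A,E^B)$ with $E^A=(E^B)^T=(1/3,1/3,1/3)$. Definition of $\tau$: for $\beta\in(\sigma,1)$ let $\mu$ be the root in $(0,1/3)$ of $$(3\beta+3\beta^2+3\beta^3)Z^3-(5\beta^3+7\beta^2+4\beta+2)Z^2+(1+\beta+5\beta^2+2\beta^3)Z-\beta^2 ,$$ and let $$n_1=\beta-\mu\beta,\qquad n_2=\frac{2\beta^2+1-3\mu\beta^3-5\mu\beta^2-2\mu\beta-2\mu+3\mu^2\beta^2+3\mu^2\beta+3\mu^2\beta^3}{1+\beta+\beta^2}.$$ Let $M(\beta)$ be the matrix $$\frac{n_2}{n_1\beta}\begin{pmatrix}\beta(3+2\beta)-2n_1(2+\beta)&\beta(1-n_1+\beta)-2n_1&3\beta^2-3n_1\beta\\ \beta-2n_2(2+\beta)&-n_2(2+\beta)&-3n_2\beta\\ 2-\frac{2(\beta-n_1)(2+\beta)}{\beta}&1-\frac{(\beta-n_1)(2+\beta)}{\beta}&3n_1-2\beta\end{pmatrix}$$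 (the linearised transition map along one third of the anticlockwise orbit). Then $\tau$ is the value of $\beta\in(\sigma,1)$ at which an eigenvalue of $M(\beta)$ equals $-1$. *)

(* Defs.v *)
From HB Require Import structures.
From mathcomp Require Import all_boot all_order all_algebra.
From mathcomp Require Import complex.
From mathcomp Require Import all_classical all_reals all_analysis.
Set Implicit Arguments.
Unset Strict Implicit.
Unset Printing Implicit Defensive.
Import Order.TTheory GRing.Theory Num.Theory.
Import numFieldNormedType.Exports.
Local Open Scope classical_set_scope.
Local Open Scope ring_scope.

Definition mx_of_rows (R : realType) (rows : seq (seq R)) : 'M[R]_3 :=
  \matrix_(i < 3, j < 3) nth 0 (nth [::] rows i) j.

Definition state (R : realType) : Type := ('rV[R]_3 * 'cV[R]_3)%type.

Definition prob_simplex (R : realType) (m n : nat) : set 'M[R]_(m, n) :=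
  [set p | (forall i j, 0 <= p i j) /\ \sum_i \sum_j p i j = 1].

Definition state_space (R : realType) : set (state R) :=
  @prob_simplex R 1 3 `*` @prob_simplex R 3 1.

Definition pureA (R : realType) (i : 'I_3) : 'rV[R]_3 := delta_mx 0 i.
Definition pureB (R : realType) (j : 'I_3) : 'cV[R]_3 := delta_mx j 0.

Definition payoffA (R : realType) (A : 'M[R]_3) (pB : 'cV[R]_3) : 'I_3 -> R :=
  fun i => (A *m pB) i 0.
Definition payoffB (R : realType) (B : 'M[R]_3) (pA : 'rV[R]_3) : 'I_3 -> R :=
  fun j => (pA *m B) 0 j.

Definition weights_on_max (R : realType) (v : 'I_3 -> R) : set ('I_3 -> R) :=
  [set w | [/\ forall i, 0 <= w i, \sum_i w i = 1 &
            forall i, w i != 0 -> forall k, v k <= v i]].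

Definition BR_A (R : realType) (A : 'M[R]_3) (pB : 'cV[R]_3) : set 'rV[R]_3 :=
  [set \sum_i w i *: pureA R i | w in weights_on_max (payoffA A pB)].
Definition BR_B (R : realType) (B : 'M[R]_3) (pA : 'rV[R]_3) : set 'cV[R]_3 :=
  [set \sum_j w j *: pureB R j | w in weights_on_max (payoffB B pA)].

Definition absolutely_continuous (R : realType) (V : normedModType R)
    (a b : R) (f : R -> V) : Prop :=
  forall e : R, 0 < e -> exists2 d : R, 0 < d &
  forall (n : nat) (I : 'I_n -> R * R),
    (forall i, [/\ a <= (I i).1, (I i).1 <= (I i).2 & (I i).2 <= b]) ->
    trivIset [set: 'I_n] (fun i => `](I i).1, (I i).2[%classic) ->
    \sum_i ((I i).2 - (I i).1) < d ->
    \sum_i `|f (I i).2 - f (I i).1| < e.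

(* As usual for differential inclusions, solutions are absolutely continuous
   and satisfy the inclusion at almost every time. *)
Definition fp_solution_upto (R : realType) (A B : 'M[R]_3) (b : R)
    (p : R -> state R) : Prop :=
  [/\ forall t, 0 <= t <= b -> state_space (p t),
      absolutely_continuous 0 b p &
      {ae @lebesgue_measure R, forall t : R, 0 < t < b ->
        exists (qA : 'rV[R]_3) (qB : 'cV[R]_3),
          [/\ BR_A A (p t).2 qA, BR_B B (p t).1 qB &
              is_derive t 1 p (qA - (p t).1, qB - (p t).2)]}].

Definition fp_solution (R : realType) (A B : 'M[R]_3) (p : R -> state R) :
    Prop :=
  forall b, 0 < b -> fp_solution_upto A B b p.

Definition periodic_solution (R : realType) (A B : 'M[R]_3) (T : R)
    (g : R -> state R) : Prop :=
  [/\ 0 < T, fp_solution A B g & forall t, g (t + T) = g t].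

(* The pair of strategies is s; players' strategies are numbered from 1. *)
Definition strategy_pair (R : realType) (A B : 'M[R]_3) (x : state R)
    (s : nat * nat) : Prop :=
  (exists2 i : 'I_3, i.+1 = s.1 &
     forall k, k != i -> payoffA A x.2 k < payoffA A x.2 i) /\
  (exists2 j : 'I_3, j.+1 = s.2 &
     forall k, k != j -> payoffB B x.1 k < payoffB B x.1 j).

(* At the switching times t n themselves, one player is indifferent. *)
Definition repeats (R : realType) (A B : 'M[R]_3) (g : R -> state R)
    (pat : seq (nat * nat)) : Prop :=
  exists t : nat -> R,
    [/\ 0 <= t 0%N, forall n, t n < t n.+1, t n @[n --> \oo] --> +oo &
        forall n s, t n < s < t n.+1 ->
          strategy_pair A B (g s) (nth (0, 0)%N pat (n %% size pat))].

Definition clockwise : seq (nat * nat) :=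
  [:: (1, 2); (2, 2); (2, 3); (3, 3); (3, 1); (1, 1)]%N.
Definition anticlockwise : seq (nat * nat) :=
  [:: (1, 3); (1, 2); (3, 2); (3, 1); (2, 1); (2, 3)]%N.

Definition thickening (R : realType) (S : set (state R)) (e : R) :
    set (state R) :=
  [set x | exists2 y, S y & `|x - y| < e].

(* Orbital Lyapunov stability, with respect to all solutions. *)
Definition stable (R : realType) (A B : 'M[R]_3) (S : set (state R)) : Prop :=
  forall e : R, 0 < e -> exists2 d : R, 0 < d &
  forall p, fp_solution A B p -> thickening S d (p 0) ->
  forall t, 0 <= t -> thickening S e (p t).

Definition attracting (R : realType) (A B : 'M[R]_3) (S : set (state R)) :
    Prop :=
  stable A B S /\
  exists2 d : R, 0 < d &
  forall p, fp_solution A B p -> thickening S d (p 0) ->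
  forall e : R, 0 < e -> \forall t \near +oo, thickening S e (p t).

Definition section_lin (R : realType) (D : 'M[R]_(3, 3 + 3)) (s : 'rV[R]_3) :
    state R :=
  (s *m lsubmx D, (s *m rsubmx D)^T).

(* s |-> x + section_lin D s parametrizes a hyperplane through x in the
   4-dimensional affine span of the state space, transverse to u. *)
Definition transverse_section (R : realType) (D : 'M[R]_(3, 3 + 3))
    (u : state R) : Prop :=
  [/\ row_free D,
      lsubmx D *m const_mx 1 = 0 :> 'cV[R]_3,
      rsubmx D *m const_mx 1 = 0 :> 'cV[R]_3 &
      forall s, section_lin D s <> u].

(* P is, near its fixed point 0, the first return map to the section
   phi @` V; every solution from phi s is required to return at phi (P s). *)
Definition return_map (R : realType) (A B : 'M[R]_3)
    (phi : 'rV[R]_3 -> state R) (P : 'rV[R]_3 -> 'rV[R]_3) : Prop :=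
  P 0 = 0 /\
  exists (V : set 'rV[R]_3) (K : R),
  [/\ nbhs (0 : 'rV[R]_3) V, 0 < K &
  \forall s \near (0 : 'rV[R]_3),
    [/\ V (P s),
        exists2 p, fp_solution_upto A B K p & p 0 = phi s &
        forall p, fp_solution_upto A B K p -> p 0 = phi s ->
        exists t, [/\ 0 < t <= K, p t = phi (P s) &
                      forall r, 0 < r < t -> ~ (phi @` V) (p r)]]].

Definition complex_eigenvalue (R : realType) (n : nat) (L : 'M[R]_n)
    (l : R[i]) : bool :=
  eigenvalue (map_mx (real_complex R) L) l.

(* The periodic orbit g is hyperbolic, and its linearized Poincare return map
   has eigenvalues both inside and outside the unit circle. *)
Definition saddle_type (R : realType) (A B : 'M[R]_3) (g : R -> state R) :
    Prop :=
  exists (t0 : R) (D : 'M[R]_(3, 3 + 3)) (P : 'rV[R]_3 -> 'rV[R]_3),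
  let L := jacobian P (0 : 'rV[R]_3) in
  [/\ derivable g t0 1 /\ transverse_section D (derive1 g t0),
      return_map A B (fun s => g t0 + section_lin D s) P,
      differentiable P (0 : 'rV[R]_3),
      (forall l, complex_eigenvalue L l -> `|l| != 1) &
      (exists2 l, complex_eigenvalue L l & `|l| < 1) /\
      (exists2 l, complex_eigenvalue L l & 1 < `|l|)].

Definition diameter (R : realType) (S : set (state R)) : R :=
  sup [set `|xy.1 - xy.2| | xy in S `*` S].

Definition shrinks_to (R : realType) (F : set_system R) (S : R -> set (state R))
    (x : state R) : Prop :=
  diameter (S b) @[b --> F] --> (0 : R) /\
  (forall e : R, 0 < e -> \forall b \near F, S b `<=` ball x e).

Definition gameA (R : realType) (b : R) : 'M[R]_3 :=
  mx_of_rows [:: [:: 1; 0; b];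
                 [:: b; 1; 0];
                 [:: 0; b; 1]].
Definition gameB (R : realType) (b : R) : 'M[R]_3 :=
  mx_of_rows [:: [:: - b; 1; 0];
                 [:: 0; - b; 1];
                 [:: 1; 0; - b]].

Definition equilibrium (R : realType) : state R :=
  (const_mx 3^-1, const_mx 3^-1).

Definition sigma (R : realType) : R := (Num.sqrt 5 - 1) / 2.

Definition mu_poly (R : realType) (b z : R) : R :=
  (3 * b + 3 * b ^+ 2 + 3 * b ^+ 3) * z ^+ 3
  - (5 * b ^+ 3 + 7 * b ^+ 2 + 4 * b + 2) * z ^+ 2
  + (1 + b + 5 * b ^+ 2 + 2 * b ^+ 3) * z - b ^+ 2.

Definition is_mu (R : realType) (b mu : R) : Prop :=
  0 < mu < 3^-1 /\ mu_poly b mu = 0.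

Definition n1 (R : realType) (b mu : R) : R := b - mu * b.
Definition n2 (R : realType) (b mu : R) : R :=
  (2 * b ^+ 2 + 1 - 3 * mu * b ^+ 3 - 5 * mu * b ^+ 2 - 2 * mu * b - 2 * mu
   + 3 * mu ^+ 2 * b ^+ 2 + 3 * mu ^+ 2 * b + 3 * mu ^+ 2 * b ^+ 3)
  / (1 + b + b ^+ 2).

Definition transition_mx (R : realType) (b mu : R) : 'M[R]_3 :=
  let m1 := n1 b mu in
  let m2 := n2 b mu in
  (m2 / (m1 * b)) *: mx_of_rows
    [:: [:: b * (3 + 2 * b) - 2 * m1 * (2 + b);
            b * (1 - m1 + b) - 2 * m1;
            3 * b ^+ 2 - 3 * m1 * b];
        [:: b - 2 * m2 * (2 + b); - m2 * (2 + b); - (3 * m2 * b)];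
        [:: 2 - 2 * (b - m1) * (2 + b) / b;
            1 - (b - m1) * (2 + b) / b;
            3 * m1 - 2 * b]].

Definition is_tau (R : realType) (t : R) : Prop :=
  sigma R < t < 1 /\
  exists2 mu, is_mu t mu & eigenvalue (transition_mx t mu) (-1).

(* Main.v *)
(* Between two switches a solution runs straight towards a vertex, so that
   e^t p(t) is piecewise affine in e^t.  Along both cyclic patterns A and B switch
   alternately, and the coordinates of e^t p(t) at the successive switches of B
   are obtained from each other by a fixed linear map [step], with characteristic
   polynomial [chi (trc rho kap) (sec rho kap)].  The increments of e^t are those
   of the linear form [weight], whose sign is that of kap - rho.  For rho < kap
   the polynomial has a root l > 1; its eigenvector gives the periodic orbit, one
   third of whose period is ln l.  The equality rho = kap holds exactly at
   b = sigma, where l = 1 and the orbit collapses to the equilibrium, and for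
   kap < rho the weight is negative, so that e^t would remain bounded along the
   pattern.

   In the projectivised dynamics the orbit attracts if l dominates the other two
   roots z2 and z3, which amounts to 0 < 1 + trc l^2.  If instead 1 + trc l^2 < 0,
   then z2 < -l < z3 < 0, and the return map is a saddle, as its eigenvalues are
   l^-3, (z2 / l)^3 and (z3 / l)^3.  The transition happens when -l is a root,
   that is when sec * trc = 1, which is [tau_poly b = 0].  The matrix of the
   statement is the same linearised map in other coordinates, with n1 / n2 = l. *)

Require Import Defs.
From HB Require Import structures.
From mathcomp Require Import all_boot all_order all_algebra.
From mathcomp Require Import complex.
From mathcomp Require Import all_classical all_reals all_analysis.
From mathcomp Require Import zify ring lra.
Set Implicit Arguments.
Unset Strict Implicit.
Unset Printing Implicit Defensive.
Import Order.TTheory GRing.Theory Num.Theory.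
Import numFieldNormedType.Exports.
Local Open Scope classical_set_scope.
Local Open Scope ring_scope.

(** * Absolute continuity *)

(** The obstacle is that stability and the return map concern all solutions of a discontinuous
    inclusion that holds only almost everywhere. Uniqueness near the orbits holds because the
    players never tie simultaneously: a player with a strict best reply has a determined motion, and
    this motion alone fixes the payoffs of the opponent, whom it drives off the tie.

    Both orbits are instances of one scheme, whose parameters are coefficients of payoff
    differences: [rho = b], [kap = 1 / (1 + b)] clockwise and [rho = 1 / b], [kap = 1 + b]
    anticlockwise.

    The criterion [0 < 1 + trc l^2] arises as follows. The polynomial factors as (z - l)(z^2 + (l -
    trc) z + 1/l), and the quadratic factor takes the value (1 + trc l^2) / l at -l. If l and -l are
    both roots, the even and the odd part vanish separately, so trc = -1/l^2 and sec = -l^2, whence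
    sec trc = 1.

    Since [step] is linear, the only nonlinearity is the division by the mass, which is affine in
    the section coordinates. The return map is therefore a scalar function times a linear map, and
    its derivative at the fixed point can be read off. *)

Section DerivativeOfCurves.
Context {R : realType}.

Lemma is_derive1P (V : normedModType R) (f : R -> V) (t : R) (df : V) :
  is_derive t 1 f df <->
  h^-1 *: (f (h + t) - f t) @[h --> 0^'] --> df.
Proof.
have shiftE : (fun h : R => h^-1 *: ((f \o shift t) (h *: (1 : R)) - f t)) =
              (fun h : R => h^-1 *: (f (h + t) - f t)).
  by apply/funext => h /=; rewrite /shift /= [h *: 1]mulr1.
split=> [[f_der <-]|f_cvg].
  by move: f_der; rewrite /derive /derivable shiftE.
by split; [rewrite /derivable shiftE; apply/cvg_ex; exists df
          |rewrite /derive shiftE; apply: cvg_lim].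
Qed.

Lemma is_derive1_image (V W : normedModType R) (h : V -> W) (f : R -> V)
    (t : R) (df : V) :
  linear h -> continuous h -> is_derive t 1 f df ->
  is_derive t 1 (h \o f) (h df).
Proof.
move=> h_lin h_cont /is_derive1P f_der; apply/is_derive1P.
have hB x y : h (x - y) = h x - h y.
  by rewrite addrC -scaleN1r h_lin scaleN1r addrC.
have hZ a x : h (a *: x) = a *: h x.
  have h0 : h 0 = 0 by have := hB 0 0; rewrite !subrr.
  by have := h_lin a x 0; rewrite h0 !addr0.
have -> : (fun k : R => k^-1 *: ((h \o f) (k + t) - (h \o f) t)) =
          h \o (fun k : R => k^-1 *: (f (k + t) - f t)).
  by apply/funext => k /=; rewrite hZ hB.
exact: continuous_cvg (h_cont df) f_der.
Qed.

Lemma is_derive1_local (V : normedModType R) (f : R -> V) (t e : R) (df : V) :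
  is_derive t 1 f df -> 0 < e ->
  exists2 d, 0 < d & forall x, `|x - t| < d ->
    `|f x - f t - (x - t) *: df| <= e * `|x - t|.
Proof.
move=> /is_derive1P /cvgrPdist_le f_der e0.
have /nbhs_ballP[d /= d0 dE] := f_der _ e0.
exists d => // x xd.
have [->|xt] := eqVneq x t.
  by rewrite !subrr scale0r subrr !normr0 mulr0.
have xt0 : x - t != 0 by rewrite subr_eq0.
have := dE (x - t); rewrite /ball /= sub0r normrN subrK => /(_ xd xt0) {}dE.
have -> : f x - f t - (x - t) *: df =
          - ((x - t) *: (df - (x - t)^-1 *: (f x - f t))).
  by rewrite scalerBr scalerA divff // scale1r opprB.
by rewrite normrN normrZ mulrC ler_wpM2r.
Qed.

End DerivativeOfCurves.

Section AbsoluteContinuity.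
Context {R : realType}.

(** A form of Cousin's lemma: the intervals [x, y] straddle their tag s, which is exactly where
    differentiability at s gives an estimate. The supremum of the points reached can be passed
    unless it is already [b]. *)
Lemma gauge_ind (a b : R) (P : R -> Prop) :
  a <= b -> P a ->
  (forall s, a <= s <= b -> exists2 d, 0 < d & forall x y,
     a <= x -> y <= b -> x <= s -> s <= y -> s - d < x -> y < s + d ->
     P x -> P y) ->
  P b.
Proof.
move=> ab Pa step; pose S := [set x | a <= x <= b /\ P x].
have Sa : S a by split=> //; rewrite lexx.
have S_sup : has_sup S by split; [exists a|exists b => x [/andP[]]].
have aS : a <= sup S := sup_upper_bound S_sup Sa.
have Sb : sup S <= b by apply: ge_sup; [exists a|move=> x [/andP[]]].
have [|d d0 dP] := step (sup S); first by rewrite aS Sb.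
have [x [/andP[ax xb] Px] xS] := sup_adherent d0 S_sup.
have xS' : x <= sup S by apply: sup_upper_bound => //; split=> //; rewrite ax.
have d2 : 0 < d / 2 by lra.
pose y := Num.min b (sup S + d / 2).
have yb : y <= b by rewrite ge_min lexx.
have Sy : sup S <= y by rewrite le_min Sb; lra.
have yd : y < sup S + d by rewrite gt_min; apply/orP; right; lra.
have Py : P y by apply: dP Px.
have [by_|Sdb] := leP b (sup S + d / 2); first by move: Py; rewrite /y min_l.
exfalso; have yE : y = sup S + d / 2 by rewrite /y min_r // ltW.
suff : y <= sup S by lra.
by apply: sup_upper_bound => //; split=> //; apply/andP; split=> //; lra.
Qed.

(** Half-open intervals stay disjoint when they share an endpoint. The list runs from right to left,
    since the gauge argument conses each new interval to the right of the earlier ones. *)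
Lemma disjoint_itv_measure (U : set R) (s : seq (R * R)) : measurable U ->
  (forall i, i \in s -> i.1 <= i.2 /\ (`[i.1, i.2[%classic `<=` U)) ->
  pairwise (fun i j => j.2 <= i.1) s ->
  ((\sum_(i <- s) (i.2 - i.1))%:E <= lebesgue_measure U)%E.
Proof.
move=> mU sU s_pw; set B := \big[setU/set0]_(i <- s) `[i.1, i.2[%classic.
have mB (l : seq (R * R)) :
    measurable (\big[setU/set0]_(i <- l) `[i.1, i.2[%classic : set R).
  by elim/big_ind: _ => //; move=> *; apply: measurableU.
suff sE : lebesgue_measure B = (\sum_(i <- s) (i.2 - i.1))%:E.
  rewrite -sE; apply: le_measure; rewrite ?inE //; first exact: mB.
  rewrite /B big_seq; elim/big_ind: _ => //.
    by move=> X Y XU YU x [/XU|/YU].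
  by move=> i /sU[].
rewrite /B; elim: s sU s_pw {B} => [|i s IHs] sU s_pw.
  by rewrite !big_nil measure0.
move: s_pw; rewrite pairwise_cons => /andP[is_ s_pw].
have [i12 _] := sU i (mem_head _ _).
rewrite !big_cons measureU //.
- have {}IHs := IHs (fun j js => sU j (@mem_behead _ (i :: s) j js)) s_pw.
  rewrite [X in (_ + X)%E]IHs.
  rewrite [X in (X + _)%E](lebesgue_measure_itv `[i.1, i.2[) /= lte_fin EFinD.
  congr (_ + _)%E.
  by case: ltP => // i21; rewrite (_ : i.1 = i.2) ?subrr //; apply/le_anti/andP.
- exact: mB.
apply/seteqP; split=> // x [] /=; rewrite in_itv /= => /andP[ix _].
rewrite -bigcup_seq => -[j /= js]; rewrite in_itv /= => /andP[_ xj].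
by have := allP is_ _ js; lra.
Qed.

(** Lists, unlike families over an ordinal, can grow by one interval at each step of [gauge_ind]. *)
Lemma absolutely_continuous_seq (V : normedModType R) (a b : R) (F : R -> V)
    (e : R) : absolutely_continuous a b F -> 0 < e ->
  exists2 d : R, 0 < d & forall s : seq (R * R),
    (forall i, i \in s -> [/\ a <= i.1, i.1 <= i.2 & i.2 <= b]) ->
    pairwise (fun i j => j.2 <= i.1) s ->
    \sum_(i <- s) (i.2 - i.1) < d -> \sum_(i <- s) `|F i.2 - F i.1| < e.
Proof.
move=> F_ac e0; have [d d0 dP] := F_ac _ e0; exists d => // s s_ab s_pw s_d.
rewrite (big_nth (0, 0)) big_mkord.
apply: (dP _ (fun i : 'I_(size s) => nth (0, 0) s i)).
- by move=> i; apply: s_ab; rewrite mem_nth.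
- apply/trivIsetP => i j _ _ ij.
  have disj (k l : nat) : (k < l < size s)%N ->
      (nth (0, 0) s l).2 <= (nth (0, 0) s k).1.
    move=> /andP[kl ls]; apply: (pairwiseP (0,0) s_pw) => //.
    by rewrite inE (ltn_trans kl ls).
  apply/seteqP; split=> // x [] /=; rewrite !in_itv /=.
  move=> /andP[ix xi] /andP[jx xj].
  have [ij'|ji|/val_inj ij'] := ltngtP i j.
  + by have := disj i j; rewrite ij' ltn_ord => /(_ isT); lra.
  + by have := disj j i; rewrite ji ltn_ord => /(_ isT); lra.
  + by move: ij; rewrite ij' eqxx.
- by move: s_d; rewrite (big_nth (0, 0)) big_mkord.
Qed.

(* A gauge argument: away from an open set [U] of small measure containing the
   exceptional points, [F] moves by at most [e (y - x)] on short intervals, and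
   the short intervals inside [U] contribute little by absolute continuity. *)
Lemma absolutely_continuous_derive0 (V : normedModType R) (a b : R)
    (F : R -> V) : a <= b -> absolutely_continuous a b F ->
  {ae @lebesgue_measure R, forall t, a < t < b -> is_derive t 1 F 0} ->
  F b = F a.
Proof.
move=> ab F_ac [N [mN N0 badN]].
suff small e : 0 < e -> `|F b - F a| <= e * (b - a) + e.
  apply/subr0_eq/eqP; rewrite -normr_le0; apply/ler_addgt0Pr => e e0.
  have ba : 0 < b - a + 1 by lra.
  have := small _ (divr_gt0 e0 ba); rewrite add0r.
  by have -> // : e / (b - a + 1) * (b - a) + e / (b - a + 1) = e by field; lra.
move=> e0; have [d d0 dP] := absolutely_continuous_seq F_ac e0.
(* The endpoints are exceptional too, because the derivative is only known inside the interval. *)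
pose N' := N `|` [set a; b].
have mab : measurable [set a; b] by apply: measurableU; exact: measurable_set1.
have mN' : measurable N' by apply: measurableU.
have N'0 : lebesgue_measure N' = 0%E.
  apply: measure_negligible => //; apply: negligibleU.
    by apply/negligibleP.
  by apply: negligibleU; apply/negligibleP => //; exact: lebesgue_measure_set1.
have [|U [oU N'U muU]] := lebesgue_regularity_outer mN' _ d0.
  by apply: (@le_lt_trans _ _ 0%E); [rewrite -N'0 lexx|exact: ltry].
have mU : measurable U := measurable_realfun.open_measurable oU.
have {}muU : (lebesgue_measure U < d%:E)%E.
  rewrite -(setDUK N'U); apply: (le_lt_trans (measureU2 _ _ _)) => //.
    exact: measurableD.
  by rewrite [X in (X + _)%E]N'0 add0e.
pose covers x (s : seq (R * R)) :=
  (forall i, i \in s -> [/\ a <= i.1, i.1 <= i.2, i.2 <= x &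
     `[i.1, i.2[%classic `<=` U]) /\ pairwise (fun i j => j.2 <= i.1) s.
have [s [s_x s_pw] sF] : exists2 s, covers b s &
    `|F b - F a| <= e * (b - a) + \sum_(i <- s) `|F i.2 - F i.1|.
  apply: (@gauge_ind a b (fun x => exists2 s, covers x s &
    `|F x - F a| <= e * (x - a) + \sum_(i <- s) `|F i.2 - F i.1|)) => //.
    by exists [::]; rewrite ?big_nil ?subrr ?normr0 ?mulr0 ?addr0.
  move=> t /andP[at_ tb]; have [Nt|Nt] := pselect (N' t).
    have /nbhs_ballP[r /= r0 rU] := open_nbhs_nbhs (conj oU (N'U _ Nt)).
    exists r => // x y ax yb xt ty xr yr [s [s_x s_pw] sF].
    exists ((x, y) :: s); last first.
      rewrite big_cons /=.
      have := ler_normD (F y - F x) (F x - F a); rewrite subrKA.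
      have xy : x <= y by lra.
      have : e * (x - a) <= e * (y - a) by rewrite ler_pM2l //; lra.
      by move: sF; lra.
    split; last first.
      by rewrite pairwise_cons s_pw andbT; apply/allP => i /s_x[].
    move=> i; rewrite in_cons => /orP[/eqP->/=|/s_x[? ? ? ?]].
      split=> //; first lra.
      move=> z /=; rewrite in_itv /= => /andP[xz zy].
      by apply: rU; rewrite /ball /= ltr_norml; lra.
    by split=> //; lra.
  have t_der : is_derive t 1 F 0.
    have [//|nab] := pselect (a < t < b -> is_derive t 1 F 0).
      apply; apply/andP; split; rewrite lt_neqAle ?at_ ?tb andbT.
        by apply/eqP => ta; apply: Nt; right; left.
      by apply/eqP => tb'; apply: Nt; right; right.
    by exfalso; apply: Nt; left; apply: badN.
  have [r r0 rP] := is_derive1_local t_der e0.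
  exists r => // x y ax yb xt ty xr yr [s [s_x s_pw] sF].
  exists s.
    by split=> // i /s_x[? ? ? ?]; split=> //; lra.
  have : `|F x - F t| <= e * (t - x).
    have := rP x; rewrite scaler0 subr0 ltr_norml.
    rewrite (_ : `|x - t| = t - x); last by rewrite ler0_norm; lra.
    by apply; lra.
  have : `|F y - F t| <= e * (y - t).
    have := rP y; rewrite scaler0 subr0 ltr_norml.
    rewrite (_ : `|y - t| = y - t); last by rewrite ger0_norm; lra.
    by apply; lra.
  have := ler_normD (F y - F t + (F t - F x)) (F x - F a).
  have := ler_normD (F y - F t) (F t - F x).
  rewrite !subrKA (distrC (F t)).
  have -> : e * (y - a) = e * (y - t) + e * (t - x) + e * (x - a) by ring.
  by move: sF; lra.
apply: (le_trans sF); rewrite lerD2l ltW //; apply: dP => //.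
  by move=> i /s_x[].
rewrite -lte_fin; apply: le_lt_trans muU; apply: disjoint_itv_measure => //.
by move=> i /s_x[].
Qed.

Lemma lipschitz_absolutely_continuous (V : normedModType R) (a b k : R)
    (F : R -> V) : 0 <= k ->
  (forall x y, a <= x -> x <= y -> y <= b -> `|F y - F x| <= k * (y - x)) ->
  absolutely_continuous a b F.
Proof.
move=> k0 F_lip e e0; exists (e / (k + 1)); first by rewrite divr_gt0 //; lra.
move=> n I I_ab _; rewrite ltr_pdivlMr; last lra.
move=> I_e; apply: (@le_lt_trans _ _ (\sum_i k * ((I i).2 - (I i).1))).
  by apply: ler_sum => i _; have [? ? ?] := I_ab i; apply: F_lip.
rewrite -mulr_sumr; apply: le_lt_trans I_e; rewrite mulrC ler_wpM2l //; last lra.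
by apply: sumr_ge0 => i _; have [? ? ?] := I_ab i; lra.
Qed.

Lemma absolutely_continuous_sub (V W : normedModType R) (a b a' b' : R)
    (F : R -> V) (G : R -> W) :
  absolutely_continuous a b F -> a <= a' -> b' <= b ->
  (forall x y, a' <= x -> x <= y -> y <= b' ->
     `|G y - G x| <= `|F y - F x|) -> absolutely_continuous a' b' G.
Proof.
move=> F_ac aa bb GF e e0; have [d d0 dP] := F_ac _ e0; exists d => //.
move=> n I I_ab I_tr I_d; apply: le_lt_trans (dP n I _ I_tr I_d).
  by apply: ler_sum => i _; have [? ? ?] := I_ab i; apply: GF.
by move=> i; have [? ? ?] := I_ab i; split=> //; lra.
Qed.

(** The term [y - x] leaves room for a Lipschitz factor: [solution_entry] multiplies an entry of a
    solution by the exponential. *)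
Lemma absolutely_continuous_dominated (V W : normedModType R) (a b k : R)
    (F : R -> V) (G : R -> W) : 0 <= k ->
  absolutely_continuous a b F ->
  (forall x y, a <= x -> x <= y -> y <= b ->
     `|G y - G x| <= k * (`|F y - F x| + (y - x))) ->
  absolutely_continuous a b G.
Proof.
move=> k0 F_ac GF e e0; pose e' := e / (2 * (k + 1)).
have e'0 : 0 < e' by rewrite divr_gt0 //; lra.
have [d d0 dP] := F_ac _ e'0; exists (Num.min d e'); first by rewrite lt_min d0.
move=> n I I_ab I_tr; rewrite lt_min => /andP[Id Ie].
have := dP n I I_ab I_tr Id => IF.
apply: (@le_lt_trans _ _ (k * (\sum_i `|F (I i).2 - F (I i).1| +
   \sum_i ((I i).2 - (I i).1)))).
  rewrite -big_split /= mulr_sumr; apply: ler_sum => i _.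
  by have [? ? ?] := I_ab i; apply: GF.
have -> : e = (k + 1) * (e' + e') by rewrite /e'; field; lra.
have : k * (\sum_i `|F (I i).2 - F (I i).1| + \sum_i ((I i).2 - (I i).1)) <=
       k * (e' + e') by rewrite ler_wpM2l //; lra.
by lra.
Qed.

End AbsoluteContinuity.

(** * Solutions and strict best replies *)

Section States.
Context {R : realType}.
Implicit Types (x y : state R) (A B : 'M[R]_3).

Definition strictA A x (i : 'I_3) :=
  forall k, k != i -> payoffA A x.2 k < payoffA A x.2 i.
Definition strictB B x (j : 'I_3) :=
  forall k, k != j -> payoffB B x.1 k < payoffB B x.1 j.

Lemma mx_entry_le (m n : nat) (M : 'M[R]_(m, n)) i j : `|M i j| <= `|M|.
Proof.
rewrite [`|M|]mx_normrE (bigD1 (i, j)) //= le_max lexx //.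
Qed.

Lemma mx_norm_le (m n : nat) (M : 'M[R]_(m, n)) e :
  0 <= e -> (forall i j, `|M i j| <= e) -> `|M| <= e.
Proof.
move=> e0 Me; rewrite [`|M|]mx_normrE.
by elim/big_ind: _ => // x y xe ye; rewrite ge_max xe ye.
Qed.

Lemma state_entry1_le x k : `|x.1 0 k| <= `|x|.
Proof. by rewrite prod_normE le_max mx_entry_le. Qed.

Lemma state_entry2_le x k : `|x.2 k 0| <= `|x|.
Proof. by rewrite prod_normE le_max mx_entry_le orbT. Qed.

Lemma state_norm_le x e : 0 <= e ->
  (forall k, `|x.1 0 k| <= e) -> (forall k, `|x.2 k 0| <= e) -> `|x| <= e.
Proof.
move=> e0 x1 x2; rewrite prod_normE ge_max; apply/andP; split.
  by apply: mx_norm_le => // i j; rewrite ord1.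
by apply: mx_norm_le => // i j; rewrite (ord1 j).
Qed.

Lemma stateP x y :
  (forall k, x.1 0 k = y.1 0 k) -> (forall k, x.2 k 0 = y.2 k 0) -> x = y.
Proof.
case: x y => [x1 x2] [y1 y2] /= H1 H2; congr (_, _).
  by apply/rowP => k.
by apply/colP => k.
Qed.

Lemma state_space_entry x : state_space x ->
  (forall k, 0 <= x.1 0 k <= 1) /\ (forall k, 0 <= x.2 k 0 <= 1).
Proof.
move=> [[x1 s1] [x2 s2]]; split=> k; rewrite ?x1 ?x2 /=.
  rewrite -s1 big_ord1 (bigD1 k) //= lerDl; exact: sumr_ge0.
rewrite -s2 (bigD1 k) //= big_ord1 lerDl; apply: sumr_ge0 => i _.
by rewrite big_ord1.
Qed.

Lemma state_space_sum x : state_space x ->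
  \sum_k x.1 0 k = 1 /\ \sum_k x.2 k 0 = 1.
Proof.
move=> [[_ s1] [_ s2]]; split; first by rewrite -s1 big_ord1.
by rewrite -s2; apply: eq_bigr => k _; rewrite big_ord1.
Qed.

Lemma state_spaceP x :
  (forall k, 0 <= x.1 0 k) -> (forall k, 0 <= x.2 k 0) ->
  \sum_k x.1 0 k = 1 -> \sum_k x.2 k 0 = 1 -> state_space x.
Proof.
move=> x1 x2 s1 s2; split; split=> /=.
- by move=> i j; rewrite ord1.
- by rewrite big_ord1.
- by move=> i j; rewrite (ord1 j).
- by rewrite -s2; apply: eq_bigr => k _; rewrite big_ord1.
Qed.

Lemma weights_on_max_strict (v w : 'I_3 -> R) (i : 'I_3) :
  (forall k, k != i -> v k < v i) -> weights_on_max v w ->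
  forall k, w k = (k == i)%:R.
Proof.
move=> vi [w0 w1 wmax].
have wk k : k != i -> w k = 0.
  move=> ki; apply/eqP; apply: contraT => /wmax /(_ i).
  by rewrite leNgt vi.
move=> k; have [->|/wk//] := eqVneq k i.
by rewrite -w1 (bigD1 i) //= big1 ?addr0.
Qed.

Lemma BR_A_strict A x i q : strictA A x i -> BR_A A x.2 q -> q = pureA R i.
Proof.
move=> Ai [w /(weights_on_max_strict Ai) wE <-].
rewrite (bigD1 i) //= wE eqxx scale1r big1 ?addr0 // => k ki.
by rewrite wE (negPf ki) scale0r.
Qed.

Lemma BR_B_strict B x j q : strictB B x j -> BR_B B x.1 q -> q = pureB R j.
Proof.
move=> Bj [w /(weights_on_max_strict Bj) wE <-].
rewrite (bigD1 j) //= wE eqxx scale1r big1 ?addr0 // => k kj.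
by rewrite wE (negPf kj) scale0r.
Qed.

Lemma pureA_BR A x i : strictA A x i -> BR_A A x.2 (pureA R i).
Proof.
move=> Ai; exists (fun k => (k == i)%:R).
  split=> [k||k]; first by rewrite ler0n.
    by rewrite (bigD1 i) //= eqxx big1 ?addr0 // => k /negPf->.
  have [-> _ l|_] := eqVneq k i; last by rewrite eqxx.
  by have [->|/Ai/ltW] := eqVneq l i.
rewrite (bigD1 i) //= eqxx scale1r big1 ?addr0 // => k /negPf->.
by rewrite scale0r.
Qed.

Lemma pureB_BR B x j : strictB B x j -> BR_B B x.1 (pureB R j).
Proof.
move=> Bj; exists (fun k => (k == j)%:R).
  split=> [k||k]; first by rewrite ler0n.
    by rewrite (bigD1 j) //= eqxx big1 ?addr0 // => k /negPf->.
  have [-> _ l|_] := eqVneq k j; last by rewrite eqxx.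
  by have [->|/Bj/ltW] := eqVneq l j.
rewrite (bigD1 j) //= eqxx scale1r big1 ?addr0 // => k /negPf->.
by rewrite scale0r.
Qed.

Definition vertex (i j : 'I_3) : state R := (pureA R i, pureB R j).

Lemma vertex1E i j k : (vertex i j).1 0 k = (k == i)%:R.
Proof. by rewrite /vertex /pureA /= mxE. Qed.

Lemma vertex2E i j k : (vertex i j).2 k 0 = (k == j)%:R.
Proof. by rewrite /vertex /pureB /= mxE andbT. Qed.

Lemma state_entry1_continuous k : continuous (fun x => x.1 0 k).
Proof.
move=> x; apply: (@continuous_comp _ _ _ fst (fun v : 'rV[R]_3 => v 0 k)).
  exact: cvg_fst.
exact: coord_continuous.
Qed.

Lemma state_entry2_continuous k : continuous (fun x => x.2 k 0).
Proof.
move=> x; apply: (@continuous_comp _ _ _ snd (fun v : 'cV[R]_3 => v k 0)).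
  exact: cvg_snd.
exact: coord_continuous.
Qed.

Lemma payoffA_continuous A k : continuous (fun x : state R => payoffA A x.2 k).
Proof.
move=> x; rewrite /payoffA.
have -> : (fun y : state R => (A *m y.2) k 0) =
          (fun y : state R => \sum_l A k l * y.2 l 0).
  by apply/funext => y; rewrite mxE.
apply: cvg_big => [|l _]; first exact: add_continuous.
apply: cvgM; first exact: cvg_cst.
exact: state_entry2_continuous.
Qed.

Lemma payoffB_continuous B k : continuous (fun x : state R => payoffB B x.1 k).
Proof.
move=> x; rewrite /payoffB.
have -> : (fun y : state R => (y.1 *m B) 0 k) =
          (fun y : state R => \sum_l y.1 0 l * B l k).
  by apply/funext => y; rewrite mxE.
apply: cvg_big => [|l _]; first exact: add_continuous.
apply: cvgM; last exact: cvg_cst.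
exact: state_entry1_continuous.
Qed.

Lemma strictA_near A x i : strictA A x i -> \forall y \near x, strictA A y i.
Proof.
move=> Ai; have H k : \forall y \near x,
    k != i -> payoffA A y.2 k < payoffA A y.2 i.
  have [->|ki] := eqVneq k i; first by near=> y.
  near=> y => _; rewrite -subr_gt0; near: y.
  apply: (cvgr_gt (payoffA A x.2 i - payoffA A x.2 k)).
    by apply: cvgB; apply: payoffA_continuous.
  by rewrite subr_gt0 Ai.
by apply: filterS (filter_forall _ H) => y + k; apply.
Unshelve. all: by end_near. Qed.

Lemma strictB_near B x j : strictB B x j -> \forall y \near x, strictB B y j.
Proof.
move=> Bj; have H k : \forall y \near x,
    k != j -> payoffB B y.1 k < payoffB B y.1 j.
  have [->|kj] := eqVneq k j; first by near=> y.
  near=> y => _; rewrite -subr_gt0; near: y.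
  apply: (cvgr_gt (payoffB B x.1 j - payoffB B x.1 k)).
    by apply: cvgB; apply: payoffB_continuous.
  by rewrite subr_gt0 Bj.
by apply: filterS (filter_forall _ H) => y + k; apply.
Unshelve. all: by end_near. Qed.

Lemma payoffAZ A (a : R) (v : 'cV[R]_3) k :
  payoffA A (a *: v) k = a * payoffA A v k.
Proof. by rewrite /payoffA -scalemxAr mxE. Qed.

Lemma payoffBZ B (a : R) (v : 'rV[R]_3) k :
  payoffB B (a *: v) k = a * payoffB B v k.
Proof. by rewrite /payoffB -scalemxAl mxE. Qed.

Lemma strictAZ A (a : R) x i : 0 < a -> strictA A (a *: x) i <-> strictA A x i.
Proof.
by move=> a0; split=> H k /H; rewrite /= !payoffAZ ltr_pM2l.
Qed.

Lemma strictBZ B (a : R) x i : 0 < a -> strictB B (a *: x) i <-> strictB B x i.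
Proof.
by move=> a0; split=> H k /H; rewrite /= !payoffBZ ltr_pM2l.
Qed.

End States.

Section Solutions.
Context {R : realType} (A B : 'M[R]_3).

Lemma expR_lip (x y d : R) : x <= y -> y <= d ->
  0 <= expR y - expR x <= expR d * (y - x).
Proof.
move=> xy yd; rewrite subr_ge0 ler_expR xy /=.
have H : expR y * (1 + (x - y)) <= expR x.
  rewrite -[in leRHS](subrK y x) expRD mulrC ler_wpM2r ?expR_ge0 //.
  exact: expR_ge1Dx.
have : expR y * (y - x) <= expR d * (y - x).
  by rewrite ler_wpM2r ?subr_ge0 ?ler_expR.
by lra.
Qed.

Variables (b : R) (p : R -> state R).
Hypothesis p_sol : fp_solution_upto A B b p.

(* The entry [u] of a solution has derivative [c0 - u] while the corresponding
   player heads for a fixed vertex, so that [e^t (u - c0)] is constant. *)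
Lemma solution_entry (ent : state R -> R) (c0 c d : R) :
  linear ent -> continuous ent -> (forall x, `|ent x| <= `|x|) ->
  0 <= c0 <= 1 -> (forall x, state_space x -> 0 <= ent x <= 1) ->
  0 <= c -> c <= d -> d <= b ->
  (forall t, c < t < d -> forall qA qB, BR_A A (p t).2 qA ->
    BR_B B (p t).1 qB -> ent (qA, qB) = c0) ->
  expR d * (ent (p d) - c0) = expR c * (ent (p c) - c0).
Proof.
move=> ent_lin ent_cont ent_le c01 ent01 c0' cd db ent_c0.
have entB x y : ent (x - y) = ent x - ent y.
  by rewrite addrC -scaleN1r ent_lin scaleN1r addrC.
have [p_ss p_ac p_ae] := p_sol.
apply: (absolutely_continuous_derive0
  (F := fun t => expR t * (ent (p t) - c0)) cd).
- apply: (@absolutely_continuous_dominated _ _ _ c d (expR d) p).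
  + exact: expR_ge0.
  + by apply: (absolutely_continuous_sub p_ac).
  move=> x y cx xy yd.
  have x01 := ent01 _ (p_ss x _); have y01 := ent01 _ (p_ss y _).
  have {}x01 : 0 <= ent (p x) <= 1 by apply: x01; lra.
  have {}y01 : 0 <= ent (p y) <= 1 by apply: y01; lra.
  have -> : expR y * (ent (p y) - c0) - expR x * (ent (p x) - c0) =
    expR y * (ent (p y) - ent (p x)) + (expR y - expR x) * (ent (p x) - c0).
    by ring.
  apply: (le_trans (ler_normD _ _)); rewrite [leRHS]mulrDr; apply: lerD.
    rewrite normrM ger0_norm ?expR_ge0 //; apply: ler_pM => //.
    - by rewrite ler_expR.
    - by rewrite -entB.
  have /andP[e0 e1] := expR_lip xy yd.
  rewrite normrM ger0_norm // -[leRHS]mulr1; apply: ler_pM => //.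
  by rewrite ler_norml; lra.
apply: (filterS (F := almost_everywhere lebesgue_measure) _ p_ae) => t p_t ctd.
have [|qA [qB [qAt qBt p_der]]] := p_t; first lra.
have ent_der : is_derive t 1 (ent \o p) (c0 - ent (p t)).
  by rewrite -(ent_c0 t ctd _ _ qAt qBt) -entB; exact: is_derive1_image.
have := is_deriveM (is_derive_expR t) (is_deriveB ent_der (is_derive_cst c0 t 1)).
move=> H; apply: is_derive_eq H _ => /=.
rewrite /GRing.scale /=; rewrite !fctE /=; ring.
Qed.

Lemma solution_strictA c d i : 0 <= c -> c <= d -> d <= b ->
  (forall t, c < t < d -> strictA A (p t) i) ->
  expR d *: (p d).1 = expR c *: (p c).1 + (expR d - expR c) *: pureA R i.
Proof.
move=> c0 cd db Ai; apply/rowP => k; rewrite !mxE.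
suff : expR d * ((p d).1 0 k - (k == i)%:R) =
       expR c * ((p c).1 0 k - (k == i)%:R) by rewrite eqxx /=; lra.
apply: (@solution_entry (fun x => x.1 0 k)) => //.
- by move=> a x y; rewrite /= !mxE.
- exact: state_entry1_continuous.
- by move=> x; exact: state_entry1_le.
- by case: eqVneq; rewrite ?lexx ?ler01.
- by move=> x /state_space_entry[].
- by move=> t ctd qA qB /(BR_A_strict (Ai _ ctd))-> _; rewrite /= mxE eqxx.
Qed.

Lemma solution_strictB c d j : 0 <= c -> c <= d -> d <= b ->
  (forall t, c < t < d -> strictB B (p t) j) ->
  expR d *: (p d).2 = expR c *: (p c).2 + (expR d - expR c) *: pureB R j.
Proof.
move=> c0 cd db Bj; apply/colP => k; rewrite !mxE.
suff : expR d * ((p d).2 k 0 - (k == j)%:R) =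
       expR c * ((p c).2 k 0 - (k == j)%:R) by rewrite eqxx andbT /=; lra.
apply: (@solution_entry (fun x => x.2 k 0)) => //.
- by move=> a x y; rewrite /= !mxE.
- exact: state_entry2_continuous.
- by move=> x; exact: state_entry2_le.
- by case: eqVneq; rewrite ?lexx ?ler01.
- by move=> x /state_space_entry[].
- move=> t ctd qA qB _ /(BR_B_strict (Bj _ ctd))->.
  by rewrite /= mxE eqxx andbT.
Qed.

Lemma solution_continuous t e : 0 <= t <= b -> 0 < e ->
  exists2 d, 0 < d & forall s, 0 <= s <= b -> `|s - t| < d ->
    `|p s - p t| < e.
Proof.
move=> tb e0; have [_ p_ac _] := p_sol.
have [d d0 dP] := absolutely_continuous_seq p_ac e0; exists d => // s sb sd.
wlog st : s t tb sb sd / s <= t.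
  move=> H; have [st|/ltW ts] := leP s t; first exact: H.
  by rewrite distrC; apply: H => //; rewrite distrC.
have := dP [:: (s, t)]; rewrite !big_seq1 /= distrC; apply=> //.
  by move=> i; rewrite inE => /eqP->/=; split=> //; lra.
by move: sd; rewrite ltr_norml; lra.
Qed.

Lemma solution_near t (P : state R -> Prop) : 0 <= t <= b ->
  (\forall x \near p t, P x) ->
  exists2 d, 0 < d & forall s, 0 <= s <= b -> `|s - t| < d -> P (p s).
Proof.
move=> tb /nbhs_ballP[e /= e0 eP]; have [d d0 dP] := solution_continuous tb e0.
exists d => // s sb sd; apply: eP.
by rewrite -ball_normE /ball_ /= distrC; apply: dP.
Qed.

End Solutions.

(** * Straight motion towards a vertex, and solutions glued from such pieces *)

Section Flow.
Context {R : realType}.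

(** [gauge_ind] applied to the property that [P] holds on all of [c, t]. *)
Lemma real_ind (c d : R) (P : R -> Prop) : c <= d -> P c ->
  (forall s, c < s <= d -> (forall x, c <= x < s -> P x) -> P s) ->
  (forall s, c <= s < d -> (forall x, c <= x <= s -> P x) ->
     exists2 r, 0 < r & forall y, s < y < s + r -> y <= d -> P y) ->
  forall t, c <= t <= d -> P t.
Proof.
move=> cd Pc left_closed right_open.
suff Q : forall x, c <= x <= d -> P x by [].
apply: (@gauge_ind _ c d (fun t => forall x, c <= x <= t -> P x)) => //.
  by move=> x xc; rewrite (_ : x = c) //; apply/le_anti; rewrite andbC.
move=> s /andP[cs sd].
(* If [P] already fails at some [x0] before s, the gauge [s - x0] forces x beyond [x0], where the
   hypothesis on [c, x] is false. *)
have [Ps|/existsNP[x0 /not_implyP[/andP[cx0 x0s] nP]]] :=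
    pselect (forall x, c <= x < s -> P x); last first.
  exists (s - x0); first by rewrite subr_gt0.
  move=> x y cx yd xs sy xr yr Px; exfalso; apply: nP; apply: Px.
  by apply/andP; split; lra.
have Pss : P s.
  have [->//|sc] := eqVneq s c; apply: left_closed => //.
  by rewrite lt_neqAle eq_sym sc cs.
have {}Ps x : c <= x <= s -> P x.
  by move=> /andP[cx]; rewrite le_eqVlt => /orP[/eqP->//|xs]; apply: Ps; rewrite cx.
have [s_lt_d|ds] := ltP s d; last first.
  exists 1 => // x y cx yd xs sy xr yr _ z /andP[cz zy].
  by apply: Ps; rewrite cz; lra.
have [|r r0 rP] := right_open s _ Ps; first by rewrite cs.
exists r => // x y cx yd xs sy xr yr _ z /andP[cz zy].
have [zs|sz] := leP z s; first by apply: Ps; rewrite cz.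
by apply: rP; lra.
Qed.

Implicit Types (v x y : state R).

(* The solution at time [t] of [x' = v - x] starting at [x]. *)
Definition go v x (t : R) : state R := v + expR (- t) *: (x - v).

Lemma go0 v x : go v x 0 = x.
Proof. by rewrite /go oppr0 expR0 scale1r addrC subrK. Qed.

Lemma goD v x s t : go v (go v x s) t = go v x (s + t).
Proof.
rewrite /go (_ : _ + _ *: (x - v) - v = expR (- s) *: (x - v)).
  by rewrite scalerA -expRD opprD (addrC (- t)).
by rewrite addrAC subrr add0r.
Qed.

Lemma go1E v x t k :
  (go v x t).1 0 k = v.1 0 k + expR (- t) * (x.1 0 k - v.1 0 k).
Proof. by rewrite /go /= !mxE. Qed.

Lemma go2E v x t k :
  (go v x t).2 k 0 = v.2 k 0 + expR (- t) * (x.2 k 0 - v.2 k 0).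
Proof. by rewrite /go /= !mxE. Qed.

Lemma go1P v x y (c d : R) :
  expR d *: y.1 = expR c *: x.1 + (expR d - expR c) *: v.1 ->
  y.1 = (go v x (d - c)).1.
Proof.
move=> H; have e0 : expR d != 0 by rewrite gt_eqF ?expR_gt0.
apply: (scalerI e0); rewrite H /go /= opprB expRB scalerDr scalerA.
have -> : expR d * (expR c / expR d) = expR c by rewrite mulrC mulfVK.
by rewrite scalerBr scalerBl addrCA addrA -addrA.
Qed.

Lemma go2P v x y (c d : R) :
  expR d *: y.2 = expR c *: x.2 + (expR d - expR c) *: v.2 ->
  y.2 = (go v x (d - c)).2.
Proof.
move=> H; have e0 : expR d != 0 by rewrite gt_eqF ?expR_gt0.
apply: (scalerI e0); rewrite H /go /= opprB expRB scalerDr scalerA.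
have -> : expR d * (expR c / expR d) = expR c by rewrite mulrC mulfVK.
by rewrite scalerBr scalerBl addrCA addrA -addrA.
Qed.

Lemma go_lip v x (s t : R) : `|x - v| <= 1 -> 0 <= s -> s <= t ->
  `|go v x t - go v x s| <= t - s.
Proof.
move=> xv s0 st; rewrite /go opprD addrACA subrr add0r -scalerBl normrZ -[leRHS]mulr1.
apply: ler_pM => //; rewrite distrC.
have /andP[e0 e1] := @expR_lip R (- t) (- s) 0 ltac:(lra) ltac:(lra).
by rewrite ger0_norm //; rewrite expR0 in e1; lra.
Qed.

Lemma go_continuous v x : continuous (go v x).
Proof.
move=> t; apply: cvgD; first exact: cvg_cst.
apply: cvgZ; last exact: cvg_cst.
apply: (@continuous_comp _ _ _ -%R expR); last exact: continuous_expR.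
exact: opp_continuous.
Qed.

Lemma go_derive v x (t : R) : is_derive t 1 (go v x) (v - go v x t).
Proof.
have e_der : is_derive t 1 (fun u : R => expR (- u)) (- expR (- t)).
  apply: is_derive_eq (is_derive1_comp (f := expR) (g := -%R)
    (is_derive_expR (- t)) (is_deriveNid t (1 : R))) _.
  by rewrite mulrN1.
have -> : v - go v x t = (- expR (- t)) *: (x - v).
  by rewrite /go opprD addrA subrr add0r scaleNr.
apply/is_derive1P.
have -> : (fun h : R => h^-1 *: (go v x (h + t) - go v x t)) =
    (fun h : R => (h^-1 *: (expR (- (h + t)) - expR (- t))) *: (x - v)).
  by apply/funext => h; rewrite /go [- (v + _)]opprD addrACA subrr add0r -scalerBl scalerA.
by apply: cvgZr_tmp; apply/is_derive1P.
Qed.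

End Flow.

Section Pieces.
Context {R : realType} (A B : 'M[R]_3).

(* The motion of one player only depends on the strategy of the other one, so
   strictness of a single player at the start is enough to get going. *)
Lemma solution_piece b (p : R -> state R) c d i j :
  fp_solution_upto A B b p -> 0 <= c -> c <= d -> d <= b ->
  (strictA A (p c) i \/ strictB B (p c) j) ->
  (forall t, c < t < d -> strictA A (go (vertex i j) (p c) (t - c)) i /\
                          strictB B (go (vertex i j) (p c) (t - c)) j) ->
  forall t, c <= t <= d -> p t = go (vertex i j) (p c) (t - c).
Proof.
move=> p_sol c0 cd db strict_c strict_cd.
pose q t := go (vertex i j) (p c) (t - c).
have q_cont : continuous q.
  move=> t; apply: (@continuous_comp _ _ _ (fun t => t - c)).
    by apply: cvgB; [exact: cvg_id|exact: cvg_cst].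
  exact: go_continuous.
apply: (real_ind cd); first by rewrite subrr go0.
  (* Limit from the left: [p] and [q] are both continuous at s and are compared through an earlier
     point [u] at which they agree. *)
  move=> s /andP[cs sd] pq; apply/subr0_eq/eqP; rewrite -normr_le0.
  apply/ler_addgt0Pr => e e0; rewrite add0r.
  have e2 : 0 < e / 2 by lra.
  have [|r r0 rP] := solution_continuous p_sol (t := s) _ e2; first lra.
  have /cvgrPdist_lt/(_ _ e2)/nbhs_ballP[r' /= r'0 rP'] := q_cont s.
  pose u := Num.max c (s - Num.min r r' / 2).
  have rr : 0 < Num.min r r' by rewrite lt_min r0.
  have cu : c <= u by rewrite le_max lexx.
  have us : u < s by rewrite gt_max cs; lra.
  have ur : s - Num.min r r' < u by rewrite lt_max; apply/orP; right; lra.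
  have : Num.min r r' <= r by rewrite ge_min lexx.
  have : Num.min r r' <= r' by rewrite ge_min lexx orbT.
  move=> ur' ur1.
  have H1 : `|p u - p s| < e / 2.
    by apply: rP; [lra|rewrite ltr_norml; lra].
  have H2 : `|q s - q u| < e / 2.
    by apply: rP'; rewrite /ball /= ltr_norml; lra.
  have pqu : p u = q u by apply: pq; rewrite cu.
  have -> : p s - go (vertex i j) (p c) (s - c) = (p s - p u) + (q u - q s).
    by rewrite pqu subrKA.
  apply: (le_trans (ler_normD _ _)); rewrite distrC (distrC (q u)); lra.
move=> s /andP[cs sd] pq.
have ps : p s = q s by apply: pq; rewrite cs lexx.
have strict_s : strictA A (p s) i \/ strictB B (p s) j.
  move: cs; rewrite le_eqVlt => /orP[/eqP<-//|cs].
  by left; rewrite ps; apply: (strict_cd s _).1; rewrite cs.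
have qE y : go (vertex i j) (p s) (y - s) = q y.
  by rewrite ps goD; congr go; ring.
have sb : 0 <= s <= b by lra.
case: strict_s => [/strictA_near|/strictB_near] /(solution_near p_sol sb)
    [r r0 rP].
  (* A remains strict for a short time, which determines [(p y).1]. The payoffs of B depend on this
     component only, so B is strict as it is along [q], and this determines [(p y).2]. The other
     case is symmetric. *)
  have pq1 y : s <= y -> y < s + r -> y <= d -> (p y).1 = (q y).1.
    move=> sy yr yd; rewrite -qE; apply: go1P.
    apply: (solution_strictA p_sol); [lra|lra|lra|].
    by move=> t syt; apply: rP; [lra|rewrite ltr_norml; lra].
  exists r => // y syr yd; rewrite [p y]surjective_pairing pq1; [|lra|lra|lra].
  suff -> : (p y).2 = (q y).2 by rewrite -surjective_pairing.
  rewrite -qE; apply: go2P; apply: (solution_strictB p_sol); [lra|lra|lra|].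
  move=> t syt k kj; rewrite pq1; [|lra|lra|lra].
  by apply: (strict_cd t _).2 => //; lra.
have pq2 y : s <= y -> y < s + r -> y <= d -> (p y).2 = (q y).2.
  move=> sy yr yd; rewrite -qE; apply: go2P.
  apply: (solution_strictB p_sol); [lra|lra|lra|].
  by move=> t syt; apply: rP; [lra|rewrite ltr_norml; lra].
exists r => // y syr yd; rewrite [p y]surjective_pairing pq2; [|lra|lra|lra].
suff -> : (p y).1 = (q y).1 by rewrite -surjective_pairing.
rewrite -qE; apply: go1P; apply: (solution_strictA p_sol); [lra|lra|lra|].
move=> t syt k kj; rewrite pq2; [|lra|lra|lra].
by apply: (strict_cd t _).1 => //; lra.
Qed.

(** The form in which solutions are constructed: Lipschitz bounds and finite exceptional sets
    survive concatenation, and the exceptional times are the places where two pieces are joined. *)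
Definition lipschitz_solution (b : R) (p : R -> state R) : Prop :=
  [/\ forall t, 0 <= t <= b -> state_space (p t),
      forall s t, 0 <= s -> s <= t -> t <= b -> `|p t - p s| <= t - s &
      exists E : seq R, forall t, 0 < t < b -> t \notin E ->
        exists (qA : 'rV[R]_3) (qB : 'cV[R]_3),
          [/\ BR_A A (p t).2 qA, BR_B B (p t).1 qB &
              is_derive t 1 p (qA - (p t).1, qB - (p t).2)]].

Lemma seq_negligible (E : seq R) :
  (@lebesgue_measure R).-negligible [set t | t \in E].
Proof.
elim: E => [|a E IHE].
  by rewrite (_ : [set _ | _] = set0); [exact: negligible_set0|
    apply/seteqP; split=> x].
have a0 : (@lebesgue_measure R).-negligible [set a].
  by apply/negligibleP; [exact: measurable_set1|exact: lebesgue_measure_set1].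
apply: negligibleS (negligibleU a0 IHE) => x /=.
by rewrite inE => /orP[/eqP->|]; [left|right].
Qed.

Lemma lipschitz_solution_upto b p : lipschitz_solution b p ->
  fp_solution_upto A B b p.
Proof.
move=> [p_ss p_lip [E pE]]; split=> //.
  apply: (@lipschitz_absolutely_continuous _ _ _ _ 1) => // s t s0 st tb.
  by rewrite mul1r; apply: p_lip.
apply: negligibleS (seq_negligible E) => t /= H.
by apply: contrapT => /negP tE; apply: H => tb; apply: pE.
Qed.

Lemma lipschitz_solutionS b b' p : b' <= b ->
  lipschitz_solution b p -> lipschitz_solution b' p.
Proof.
move=> bb [p_ss p_lip [E pE]]; split.
- by move=> t tb; apply: p_ss; lra.
- by move=> s t s0 st tb; apply: p_lip => //; lra.
by exists E => t tb; apply: pE; lra.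
Qed.

Lemma lipschitz_solution_ext b p p' :
  (forall t, 0 <= t <= b -> p t = p' t) ->
  lipschitz_solution b p -> lipschitz_solution b p'.
Proof.
move=> pp [p_ss p_lip [E pE]]; split.
- by move=> t tb; rewrite -pp //; apply: p_ss.
- by move=> s t s0 st tb; rewrite -!pp ?p_lip //; lra.
exists E => t tb tE; have [qA [qB [qAt qBt p_der]]] := pE t tb tE.
exists qA, qB; rewrite -pp; last lra; split=> //.
apply: near_eq_is_derive p_der; near=> s; apply: pp.
have : s \in `]0, b[ by near: s; apply: near_in_itvoo; rewrite in_itv.
by rewrite in_itv /=; lra.
Unshelve. all: by end_near. Qed.

Lemma lipschitz_solution_shift b c p : 0 <= c -> 
  lipschitz_solution b p -> lipschitz_solution (b - c) (fun t => p (t + c)).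
Proof.
move=> c0 [p_ss p_lip [E pE]]; split.
- by move=> t tb; apply: p_ss; lra.
- move=> s t s0 st tb; rewrite (_ : t - s = t + c - (s + c)); last by ring.
  by apply: p_lip; lra.
exists [seq x - c | x <- E] => t tb tE.
have [||qA [qB [qAt qBt p_der]]] := pE (t + c).
- by lra.
- apply: contra tE => tE; apply/mapP; exists (t + c) => //.
  by rewrite addrK.
exists qA, qB; split=> //.
move/is_derive1P in p_der; apply/is_derive1P; apply: cvg_trans p_der.
by apply: near_eq_cvg; near=> h; rewrite addrA.
Unshelve. all: by end_near. Qed.

Lemma lipschitz_solution_cat b1 b2 p : 0 <= b1 -> 0 <= b2 ->
  lipschitz_solution b1 p -> lipschitz_solution b2 (fun t => p (t + b1)) ->
  lipschitz_solution (b1 + b2) p.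
Proof.
move=> b10 b20 [p_ss p_lip [E pE]] [p_ss' p_lip' [E' pE']].
have p_ss2 t : b1 <= t <= b1 + b2 -> state_space (p t).
  by move=> tb; rewrite -(subrK b1 t); apply: p_ss'; lra.
have p_lip2 s t : b1 <= s -> s <= t -> t <= b1 + b2 -> `|p t - p s| <= t - s.
  move=> bs st tb; have := p_lip' (s - b1) (t - b1); rewrite !subrK.
  by rewrite opprB subrKA; apply; lra.
split.
- move=> t tb; have [tb1|b1t] := leP t b1; first by apply: p_ss; lra.
  by apply: p_ss2; lra.
- move=> s t s0 st tb; have [tb1|b1t] := leP t b1; first exact: p_lip.
  have [sb1|b1s] := leP s b1; last by apply: p_lip2 => //; lra.
  have := p_lip s b1 s0 sb1 (lexx _).
  have := p_lip2 b1 t (lexx _) (ltW b1t) tb.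
  by have := ler_normD (p t - p b1) (p b1 - p s); rewrite subrKA; lra.
exists (b1 :: E ++ [seq x + b1 | x <- E']) => t tb.
rewrite in_cons mem_cat !negb_or => /and3P[tb1 tE tE'].
have [t_lt|b1t|tb1'] := ltgtP t b1; last by rewrite tb1' eqxx in tb1.
  by apply: pE => //; lra.
have [||qA [qB]] := pE' (t - b1).
- by lra.
- by apply: contra tE' => tE'; apply/mapP; exists (t - b1) => //; rewrite subrK.
rewrite subrK => -[qAt qBt p_der]; exists qA, qB; split=> //.
move/is_derive1P in p_der; apply/is_derive1P; apply: cvg_trans p_der.
by apply: near_eq_cvg; near=> h; rewrite subrK -addrA subrK.
Unshelve. all: by end_near. Qed.

Lemma lipschitz_solution_go b i j x : state_space x ->
  (forall t, 0 < t < b -> strictA A (go (vertex i j) x t) i /\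
                          strictB B (go (vertex i j) x t) j) ->
  lipschitz_solution b (go (vertex i j) x).
Proof.
move=> x_ss strict_x.
have [x1 x2] := state_space_entry x_ss; have [s1 s2] := state_space_sum x_ss.
have sum_delta (l : 'I_3) : \sum_k (k == l)%:R = 1 :> R.
  by rewrite (bigD1 l) //= eqxx big1 ?addr0 // => k /negPf->.
have xv : `|x - vertex i j| <= 1.
  apply: state_norm_le => // k; rewrite ?mxE /= ?mxE ?eqxx ?andbT /=.
    by rewrite ler_norml; have := x1 k; case: eqVneq => _ /=; lra.
  by rewrite ler_norml; have := x2 k; case: eqVneq => _ /=; lra.
split.
- move=> t tb; have e0 := expR_gt0 (- t).
  have e1 : expR (- t) <= 1 by rewrite -expR0 ler_expR; lra.
  apply: state_spaceP => [k|k||].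
  + rewrite go1E vertex1E; have := x1 k; move: (expR _) e0 e1 (x.1 0 k).
    by move=> e e0 e1 y y01; case: eqVneq => _ /=; nra.
  + rewrite go2E vertex2E; have := x2 k; move: (expR _) e0 e1 (x.2 k 0).
    by move=> e e0 e1 y y01; case: eqVneq => _ /=; nra.
  + under eq_bigr do rewrite go1E vertex1E.
    by rewrite big_split /= -mulr_sumr sumrB s1 sum_delta subrr mulr0 addr0.
  + under eq_bigr do rewrite go2E vertex2E.
    by rewrite big_split /= -mulr_sumr sumrB s2 sum_delta subrr mulr0 addr0.
- by move=> s t s0 st tb; apply: go_lip.
exists [::] => t tb _; have [At Bt] := strict_x t tb.
exists (pureA R i), (pureB R j); split; first exact: pureA_BR.
  exact: pureB_BR.
exact: go_derive.
Qed.

End Pieces.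

(** * Phases of a cyclic pattern *)

(* [la] and [lb] list the strategies of the two players in the order in which
   they are used; indices count modulo 3.  While A plays [la n], B drifts towards
   [lb n]; while B plays [lb n], A drifts towards [la n.+1].  The payoff
   differences are normalised by [r] and [q]. *)
Record cyclic_game (R : realType) (A B : 'M[R]_3) (la lb : nat -> 'I_3)
    (r q rho kap : R) : Prop := CyclicGame {
  cg_r : 0 < r;
  cg_q : 0 < q;
  cg_kap : 0 < kap;
  cg_la3 : forall n, la n.+3 = la n;
  cg_lb3 : forall n, lb n.+3 = lb n;
  cg_la_uniq : forall n, uniq [:: la n; la n.+1; la n.+2];
  cg_lb_uniq : forall n, uniq [:: lb n; lb n.+1; lb n.+2];
  cg_A : forall n v, payoffA A v (la n) - payoffA A v (la n.+1) =
    r * (- v (lb n) 0 + rho * v (lb n.+1) 0 + (1 - rho) * v (lb n.+2) 0);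
  cg_B : forall n v, payoffB B v (lb n) - payoffB B v (lb n.+1) =
    q * (kap * v 0 (la n) - v 0 (la n.+1) + (1 - kap) * v 0 (la n.+2)) }.

Lemma ord3_cover (l : nat -> 'I_3) n k : uniq [:: l n; l n.+1; l n.+2] ->
  [\/ k = l n, k = l n.+1 | k = l n.+2].
Proof.
move=> l_uniq; have : k \in [:: l n; l n.+1; l n.+2].
  have [||_ ->] := @uniq_min_size _ _ (enum 'I_3) l_uniq.
  - by move=> ?; rewrite mem_enum.
  - by rewrite size_enum_ord.
  by rewrite mem_enum.
by rewrite !inE => /or3P[] /eqP->; [constructor 1|constructor 2|constructor 3].
Qed.

Section Phases.
Context {R : realType} (A B : 'M[R]_3) (la lb : nat -> 'I_3).
Variables (r q rho kap : R).
Hypothesis game : cyclic_game A B la lb r q rho kap.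

(** Up to the factors [r] and [q] these are the advantages of [la n] over [la n.+1] and of [lb n]
    over [lb n.+1]. They are linear forms on states of any mass, so they can be evaluated on e^t
    p(t). *)
Definition alpha n (x : state R) : R :=
  - x.2 (lb n) 0 + rho * x.2 (lb n.+1) 0 + (1 - rho) * x.2 (lb n.+2) 0.
Definition gamma n (x : state R) : R :=
  kap * x.1 0 (la n) - x.1 0 (la n.+1) + (1 - kap) * x.1 0 (la n.+2).

Lemma alphaD n x y : alpha n (x + y) = alpha n x + alpha n y.
Proof. by rewrite /alpha /= !mxE; ring. Qed.
Lemma alphaZ n a x : alpha n (a *: x) = a * alpha n x.
Proof. by rewrite /alpha /= !mxE; ring. Qed.
Lemma gammaD n x y : gamma n (x + y) = gamma n x + gamma n y.
Proof. by rewrite /gamma /= !mxE; ring. Qed.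
Lemma gammaZ n a x : gamma n (a *: x) = a * gamma n x.
Proof. by rewrite /gamma /= !mxE; ring. Qed.

Lemma alpha3 n x : alpha n.+3 x = alpha n x.
Proof. by rewrite /alpha !(cg_lb3 game). Qed.
Lemma gamma3 n x : gamma n.+3 x = gamma n x.
Proof. by rewrite /gamma !(cg_la3 game). Qed.

(** Payoff differences taken once around a cycle of three strategies cancel. *)
Lemma alpha_sum n x : alpha n.+1 x = - (alpha n x + alpha n.+2 x).
Proof. by rewrite /alpha !(cg_lb3 game); ring. Qed.
Lemma gamma_sum n x : gamma n.+1 x = - (gamma n x + gamma n.+2 x).
Proof. by rewrite /gamma !(cg_la3 game); ring. Qed.

Lemma la_neq n : [/\ (la n == la n.+1) = false, (la n == la n.+2) = false &
  (la n.+1 == la n.+2) = false].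
Proof.
have := cg_la_uniq game n; rewrite /= !inE !negb_or !andbT.
by move=> /andP[/andP[/negPf-> /negPf->] /negPf->].
Qed.

Lemma lb_neq n : [/\ (lb n == lb n.+1) = false, (lb n == lb n.+2) = false &
  (lb n.+1 == lb n.+2) = false].
Proof.
have := cg_lb_uniq game n; rewrite /= !inE !negb_or !andbT.
by move=> /andP[/andP[/negPf-> /negPf->] /negPf->].
Qed.

Lemma alpha_vertex n i : [/\ alpha n (vertex i (lb n)) = -1,
  alpha n.+1 (vertex i (lb n)) = 1 - rho & alpha n.+2 (vertex i (lb n)) = rho].
Proof.
have [b1 b2 b3] := lb_neq n.
rewrite /alpha !(cg_lb3 game) !vertex2E eqxx !(eq_sym (lb n.+1))
  !(eq_sym (lb n.+2)) b1 b2 /=; by split; ring.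
Qed.

Lemma gamma_vertex n j : [/\ gamma n (vertex (la n) j) = kap,
  gamma n.+1 (vertex (la n) j) = 1 - kap & gamma n.+2 (vertex (la n) j) = -1].
Proof.
have [a1 a2 a3] := la_neq n.
rewrite /gamma !(cg_la3 game) !vertex1E eqxx !(eq_sym (la n.+1))
  !(eq_sym (la n.+2)) a1 a2 /=; by split; ring.
Qed.

(** As [la n.+3 = la n], the form [alpha n.+2] compares [la n.+2] with [la n], so the two signs are
    the two comparisons with the rivals of [la n]. *)
Lemma strictAP n x : strictA A x (la n) <-> 0 < alpha n x /\ alpha n.+2 x < 0.
Proof.
have r0 := cg_r game; have [a1 a2 a3] := la_neq n.
have E1 : payoffA A x.2 (la n) - payoffA A x.2 (la n.+1) = r * alpha n x.
  exact: cg_A game n _.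
have E2 : payoffA A x.2 (la n.+2) - payoffA A x.2 (la n) = r * alpha n.+2 x.
  by rewrite -[in la n](cg_la3 game); exact: cg_A game n.+2 _.
split=> [H|[H1 H2] k].
  rewrite -(pmulr_rgt0 _ r0) -(pmulr_rlt0 _ r0) -E1 -E2 subr_gt0 subr_lt0.
  by split; apply: H; rewrite eq_sym ?a1 ?a2.
have := pmulr_rgt0 (alpha n x) r0; have := pmulr_rlt0 (alpha n.+2 x) r0.
rewrite -E1 -E2 H1 H2 subr_gt0 subr_lt0 => G2 G1.
by case: (ord3_cover k (cg_la_uniq game n)) => -> // /eqP.
Qed.

Lemma strictBP n x : strictB B x (lb n) <-> 0 < gamma n x /\ gamma n.+2 x < 0.
Proof.
have q0 := cg_q game; have [b1 b2 b3] := lb_neq n.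
have E1 : payoffB B x.1 (lb n) - payoffB B x.1 (lb n.+1) = q * gamma n x.
  exact: cg_B game n _.
have E2 : payoffB B x.1 (lb n.+2) - payoffB B x.1 (lb n) = q * gamma n.+2 x.
  by rewrite -[in lb n](cg_lb3 game); exact: cg_B game n.+2 _.
split=> [H|[H1 H2] k].
  rewrite -(pmulr_rgt0 _ q0) -(pmulr_rlt0 _ q0) -E1 -E2 subr_gt0 subr_lt0.
  by split; apply: H; rewrite eq_sym ?b1 ?b2.
have := pmulr_rgt0 (gamma n x) q0; have := pmulr_rlt0 (gamma n.+2 x) q0.
rewrite -E1 -E2 H1 H2 subr_gt0 subr_lt0 => G2 G1.
by case: (ord3_cover k (cg_lb_uniq game n)) => -> // /eqP.
Qed.

(* Coordinates [(d, f, g)] of a state (of arbitrary mass) at which B is about to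
   leave [lb n.+2] for [lb n]: A keeps to [la n] for a time [d], then plays
   [la n.+1] for a time [dwell]. *)
Definition section n (x : state R) : R * R * R :=
  (alpha n x, - alpha n.+2 x, gamma n x).

(** Time is measured here by the mass added. [gamma n] starts at [x.2], grows at rate [kap] for a
    time [x.1.1] and then falls at rate 1, so it vanishes after a further time [dwell]; this is the
    next switch of B. *)
Definition dwell (x : R * R * R) : R := x.2 + kap * x.1.1.
Definition dur (x : R * R * R) : R := x.1.1 + dwell x.
Definition step (x : R * R * R) : R * R * R :=
  (x.1.2 - rho * x.1.1 + (1 - rho) * dwell x, dwell x, x.1.1 + (kap - 1) * dwell x).

(** The signs that the relevant forms must have at the corners of a phase: at its start, at the
    switch of A (the fourth condition is the sign of [- alpha n.+2] there) and at its end. Between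
    corners the forms are affine, so no further condition arises. *)
Definition valid (x : R * R * R) : Prop :=
  [/\ 0 < x.1.1, 0 < x.1.2, 0 < x.2, 0 < x.1.2 - rho * x.1.1 &
      0 < (step x).1.1 /\ 0 < (step x).2].

Definition mass (x : state R) : R := \sum_k x.2 k 0.

Lemma massD x y : mass (x + y) = mass x + mass y.
Proof. by rewrite /mass -big_split; apply: eq_bigr => k _; rewrite mxE. Qed.
Lemma massZ a x : mass (a *: x) = a * mass x.
Proof. by rewrite /mass mulr_sumr; apply: eq_bigr => k _; rewrite mxE. Qed.
Lemma mass_vertex i j : mass (vertex i j) = 1.
Proof.
rewrite /mass; under eq_bigr do rewrite vertex2E.
by rewrite (bigD1 j) //= eqxx big1 ?addr0 // => k /negPf->.
Qed.

(** This is e^t p(t) after mass [s] has been added: motion towards a vertex just adds mass to it.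
    The minimum and maximum cover both halves of the phase, A switching when the added mass reaches
    [alpha n x]. *)
Definition cumul n (x : state R) (s : R) : state R :=
  x + Num.min s (alpha n x) *: vertex (la n) (lb n)
    + Num.max 0 (s - alpha n x) *: vertex (la n.+1) (lb n).

Definition path_at n (x : state R) (s : R) : state R :=
  (mass x + s)^-1 *: cumul n x s.

Lemma min_max_sum (s a : R) : Num.min s a + Num.max 0 (s - a) = s.
Proof. by case: (leP s a) => sa; [rewrite max_l|rewrite max_r]; lra. Qed.

Lemma mass_cumul n x s : mass (cumul n x s) = mass x + s.
Proof.
by rewrite /cumul !massD !massZ !mass_vertex !mulr1 -addrA min_max_sum.
Qed.

Lemma cumul0 n x : 0 <= alpha n x -> cumul n x 0 = x.
Proof.
move=> a0; rewrite /cumul min_l // max_l; last lra.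
by rewrite !scale0r !addr0.
Qed.

Lemma alpha_cumul n x s : [/\ alpha n (cumul n x s) = alpha n x - s,
  alpha n.+1 (cumul n x s) = alpha n.+1 x + (1 - rho) * s &
  alpha n.+2 (cumul n x s) = alpha n.+2 x + rho * s].
Proof.
have [e1 e2 e3] := alpha_vertex n (la n).
have [f1 f2 f3] := alpha_vertex n (la n.+1).
rewrite /cumul !alphaD !alphaZ e1 e2 e3 f1 f2 f3.
rewrite -!addrA -!mulrDl min_max_sum; split; ring.
Qed.

Lemma gamma_cumul1 n x s : s <= alpha n x ->
  [/\ gamma n (cumul n x s) = gamma n x + kap * s &
      gamma n.+2 (cumul n x s) = gamma n.+2 x - s].
Proof.
move=> sx; have [e1 e2 e3] := gamma_vertex n (lb n).
rewrite /cumul !gammaD !gammaZ e1 e3 min_l // max_l ?subr_le0 //.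
by split; ring.
Qed.

Lemma gamma_cumul2 n x s : alpha n x <= s ->
  [/\ gamma n (cumul n x s) =
        gamma n x + kap * alpha n x - (s - alpha n x) &
      gamma n.+2 (cumul n x s) =
        gamma n.+2 x - alpha n x - (kap - 1) * (s - alpha n x)].
Proof.
move=> sx; have [e1 e2 e3] := gamma_vertex n (lb n).
have [f1 f2 f3] := gamma_vertex n.+1 (lb n); rewrite gamma3 in f3.
rewrite /cumul !gammaD !gammaZ e1 e3 f2 f3 min_r // max_r ?subr_ge0 //.
by split; ring.
Qed.

Definition next n x : state R := cumul n x (dur (section n x)).

(** By the choice of [dwell], [gamma n] vanishes at the end of the phase, and [gamma n.+3] is the
    same form: the next phase starts at a tie of B again. *)
Lemma section_next n x : gamma n.+2 x = 0 -> 0 <= dwell (section n x) ->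
  gamma n.+3 (next n x) = 0 /\ section n.+1 (next n x) = step (section n x).
Proof.
rewrite /next; set s := dur _ => x0 e0.
have sx : alpha n x <= s by rewrite /s /dur /=; lra.
have [a1 a2 a3] := alpha_cumul n x s; have [g1 g2] := gamma_cumul2 sx.
rewrite gamma3 /section /step alpha3 (gamma_sum n) a1 a2 g1 g2 (alpha_sum n).
rewrite x0 /s /dur /dwell /=; split; first by ring.
by congr (_, _, _); ring.
Qed.

Lemma mass_next n x : mass (next n x) = mass x + dur (section n x).
Proof. exact: mass_cumul. Qed.

(** The ranges of s are half-open at opposite ends: B ties at the start of the phase, and A ties
    when it switches. *)
Lemma valid_strict1 n x s : gamma n.+2 x = 0 -> valid (section n x) ->
  [/\ 0 <= s < alpha n x -> strictA A (cumul n x s) (la n) &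
      0 < s <= alpha n x -> strictB B (cumul n x s) (lb n)].
Proof.
have k0 := cg_kap game.
move=> x0 [/= d0 f0 g0 fd0 _]; have [a1 _ a2] := alpha_cumul n x s.
split=> sd; first apply/strictAP; last apply/strictBP.
  (* The sign of [rho] decides at which end of the interval [alpha n.+2] is largest. *)
  rewrite a1 a2; have [rho0|rho0] := leP 0 rho; split; nra.
have [|g1 g2] := @gamma_cumul1 n x s; first lra.
by rewrite g1 g2 x0; split; nra.
Qed.

Lemma valid_strict2 n x s : gamma n.+2 x = 0 -> valid (section n x) ->
  [/\ alpha n x < s <= dur (section n x) ->
        strictA A (cumul n x s) (la n.+1) &
      alpha n x <= s < dur (section n x) -> strictB B (cumul n x s) (lb n)].
Proof.
have k0 := cg_kap game.
move=> x0 [/= d0 f0 g0 fd0]; rewrite /dur /dwell /= => -[d1 g1].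
have [a1 a2 _] := alpha_cumul n x s.
split=> sd; first apply/strictAP; last apply/strictBP.
  rewrite alpha3 a1 a2 (alpha_sum n).
  have [rho0|rho0] := leP 0 (1 - rho); split; nra.
have [|h1 h2] := @gamma_cumul2 n x s; first lra.
rewrite h1 h2 x0; split; first by lra.
by have [kap0|kap0] := leP 0 (kap - 1); nra.
Qed.

Lemma cumul_shift1 n x s t : s <= alpha n x -> t <= alpha n x ->
  cumul n x t = cumul n x s + (t - s) *: vertex (la n) (lb n).
Proof.
move=> sx tx; rewrite /cumul !min_l // !max_l ?subr_le0 // !scale0r !addr0.
by rewrite -addrA -scalerDl; congr (_ + _ *: _); ring.
Qed.

Lemma cumul_shift2 n x s t : alpha n x <= s -> alpha n x <= t ->
  cumul n x t = cumul n x s + (t - s) *: vertex (la n.+1) (lb n).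
Proof.
move=> sx tx; rewrite /cumul !min_r // !max_r ?subr_ge0 //.
by rewrite -[RHS]addrA -scalerDl; congr (_ + _ *: _); ring.
Qed.

(** Multiplying the state by a mass proportional to e^t turns exponential relaxation towards v into
    addition of multiples of v. *)
Lemma go_cumul (v y : state R) (M M' t : R) : 0 < M -> expR t = M' / M ->
  go v (M^-1 *: y) t = M'^-1 *: (y + (M' - M) *: v).
Proof.
move=> M0 tM; have M'0 : 0 < M' by rewrite -(pmulr_lgt0 _ (_ : 0 < M^-1)) ?invr_gt0 // -tM expR_gt0.
rewrite /go expRN tM scalerBr scalerDr !scalerA invf_div.
have -> : M / M' * M^-1 = M'^-1 by field; lra.
rewrite addrCA; congr (_ + _); rewrite -[X in X - _]scale1r -scalerBl.
by congr (_ *: _); field; lra.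
Qed.

Lemma strictA_path n x s i : 0 < mass x + s ->
  strictA A (path_at n x s) i <-> strictA A (cumul n x s) i.
Proof. by move=> s0; apply: strictAZ; rewrite invr_gt0. Qed.
Lemma strictB_path n x s i : 0 < mass x + s ->
  strictB B (path_at n x s) i <-> strictB B (cumul n x s) i.
Proof. by move=> s0; apply: strictBZ; rewrite invr_gt0. Qed.

Lemma go_path1 n x (mu c t : R) : 0 < mu ->
  mu * expR c <= mass x + alpha n x -> mu * expR t <= mass x + alpha n x ->
  go (vertex (la n) (lb n)) (path_at n x (mu * expR c - mass x)) (t - c) =
  path_at n x (mu * expR t - mass x).
Proof.
move=> mu0 cd td; have ec := expR_gt0 c; have et := expR_gt0 t.
rewrite /path_at addrC subrK (addrC (mass x)) subrK.
rewrite (@go_cumul _ _ _ (mu * expR t)); last first.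
- by rewrite expRB; field; rewrite !gt_eqF.
- exact: mulr_gt0.
congr (_ *: _); rewrite [RHS](@cumul_shift1 _ _ (mu * expR c - mass x)).
- by congr (_ + _ *: _); ring.
- by lra.
- by lra.
Qed.

Lemma go_path2 n x (mu c t : R) : 0 < mu ->
  mass x + alpha n x <= mu * expR c -> mass x + alpha n x <= mu * expR t ->
  go (vertex (la n.+1) (lb n)) (path_at n x (mu * expR c - mass x)) (t - c) =
  path_at n x (mu * expR t - mass x).
Proof.
move=> mu0 cd td; have ec := expR_gt0 c; have et := expR_gt0 t.
rewrite /path_at addrC subrK (addrC (mass x)) subrK.
rewrite (@go_cumul _ _ _ (mu * expR t)); last first.
- by rewrite expRB; field; rewrite !gt_eqF.
- exact: mulr_gt0.
congr (_ *: _); rewrite [RHS](@cumul_shift2 _ _ (mu * expR c - mass x)).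
- by congr (_ + _ *: _); ring.
- by lra.
- by lra.
Qed.

(* [mu * expR t] is the mass at time [t] of the cumulative state. *)
Section Phase.
Variables (n : nat) (x : state R) (mu : R).
Hypotheses (mu0 : 0 < mu) (x_tie : gamma n.+2 x = 0)
  (x_valid : valid (section n x)).
Let at_time t : state R := path_at n x (mu * expR t - mass x).

Let strict1 t : mass x < mu * expR t < mass x + alpha n x ->
  strictA A (at_time t) (la n) /\ strictB B (at_time t) (lb n).
Proof.
move=> tx; have [HA HB] := @valid_strict1 n x (mu * expR t - mass x) x_tie x_valid.
have m0 : 0 < mass x + (mu * expR t - mass x).
  by rewrite addrC subrK mulr_gt0 ?expR_gt0.
by split; [apply/strictA_path => //; apply: HA; lra
          |apply/strictB_path => //; apply: HB; lra].
Qed.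

Let strict2 t :
  mass x + alpha n x < mu * expR t < mass x + dur (section n x) ->
  strictA A (at_time t) (la n.+1) /\ strictB B (at_time t) (lb n).
Proof.
move=> tx; have [HA HB] := @valid_strict2 n x (mu * expR t - mass x) x_tie x_valid.
have m0 : 0 < mass x + (mu * expR t - mass x).
  by rewrite addrC subrK mulr_gt0 ?expR_gt0.
by split; [apply/strictA_path => //; apply: HA; lra
          |apply/strictB_path => //; apply: HB; lra].
Qed.

Let lt_mu (s t : R) : s < t -> mu * expR s < mu * expR t.
Proof. by move=> st; rewrite ltr_pM2l // ltr_expR. Qed.
Let le_mu (s t : R) : s <= t -> mu * expR s <= mu * expR t.
Proof. by move=> st; rewrite ler_pM2l // ler_expR. Qed.

(* Found by [done] when [strictA_path] and [strictB_path] are applied. *)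
Let mass_pos t : 0 < mass x + (mu * expR t - mass x).
Proof. by rewrite addrC subrK mulr_gt0 ?expR_gt0. Qed.

Let phase_piece1 b p c t : fp_solution_upto A B b p -> 0 <= c ->
  p c = at_time c -> c <= t -> t <= b ->
  mass x <= mu * expR c -> mu * expR t <= mass x + alpha n x ->
  p t = at_time t.
Proof.
move=> p_sol c0 pc; rewrite le_eqVlt => /orP[/eqP<-//|ct] tb xc tx.
have ct' := lt_mu ct.
rewrite (solution_piece (i := la n) (j := lb n) p_sol c0 (ltW ct) tb).
- by rewrite pc go_path1 //; lra.
- left; rewrite pc; apply/strictA_path => //.
  have [HA _] := @valid_strict1 n x (mu * expR c - mass x) x_tie x_valid.
  by apply: HA; lra.
- move=> u /andP[cu ut]; have cu' := lt_mu cu; have ut' := lt_mu ut.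
  by rewrite pc go_path1 //; [apply: strict1; lra|lra|lra].
by rewrite (ltW ct) lexx.
Qed.

Let phase_piece2 b p c t : fp_solution_upto A B b p -> 0 <= c ->
  p c = at_time c -> c <= t -> t <= b ->
  mass x + alpha n x <= mu * expR c ->
  mu * expR t <= mass x + dur (section n x) ->
  p t = at_time t.
Proof.
move=> p_sol c0 pc; rewrite le_eqVlt => /orP[/eqP<-//|ct] tb xc tx.
have ct' := lt_mu ct.
rewrite (solution_piece (i := la n.+1) (j := lb n) p_sol c0 (ltW ct) tb).
- by rewrite pc go_path2 //; lra.
- right; rewrite pc; apply/strictB_path => //.
  have [_ HB] := @valid_strict2 n x (mu * expR c - mass x) x_tie x_valid.
  by apply: HB; lra.
- move=> u /andP[cu ut]; have cu' := lt_mu cu; have ut' := lt_mu ut.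
  by rewrite pc go_path2 //; [apply: strict2; lra|lra].
by rewrite (ltW ct) lexx.
Qed.

Lemma mass_time (m : R) : 0 < m -> mu * expR (ln (m / mu)) = m.
Proof. by move=> m0; rewrite lnK ?posrE ?divr_gt0 // mulrC divfK ?gt_eqF. Qed.

Lemma le_mass_time (s t : R) : mu * expR s <= mu * expR t -> s <= t.
Proof. by rewrite ler_pM2l // ler_expR. Qed.

(** At the start of the phase only A is strict, at the switch of A only B. One strict player
    suffices for [solution_piece], so the two halves are treated separately and joined at the time
    [u] of that switch. *)
Lemma phase_unique b p c t : fp_solution_upto A B b p -> 0 <= c ->
  p c = at_time c -> c <= t -> t <= b ->
  mass x <= mu * expR c -> mu * expR t <= mass x + dur (section n x) ->
  p t = at_time t.
Proof.
move=> p_sol c0 pc ct tb xc tx; have [d0 _ _ _ _] := x_valid.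
have [tx1|x1t] := leP (mu * expR t) (mass x + alpha n x).
  exact: phase_piece1 p_sol c0 pc ct tb xc tx1.
have [xc1|cx1] := leP (mass x + alpha n x) (mu * expR c).
  exact: phase_piece2 p_sol c0 pc ct tb xc1 tx.
have x1_pos : 0 < mass x + alpha n x.
  by apply: lt_trans cx1; rewrite mulr_gt0 ?expR_gt0.
set u := ln ((mass x + alpha n x) / mu); have uE := mass_time x1_pos.
rewrite -/u in uE.
have cu : c <= u by apply: le_mass_time; rewrite uE ltW.
have ut : u <= t by apply: le_mass_time; rewrite uE ltW.
apply: (@phase_piece2 b p u) => //; [lra| |by rewrite uE lexx].
by apply: (@phase_piece1 b p c) => //; [lra|rewrite uE lexx].
Qed.

Lemma phase_solution b : mu = mass x -> state_space (path_at n x 0) ->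
  0 <= b -> mu * expR b <= mass x + dur (section n x) ->
  lipschitz_solution A B b at_time.
Proof.
move=> mux x_ss b0 bx; have d0 : 0 < alpha n x by case: x_valid.
have [mux' mu0'] : mu <= mass x <= mu /\ 0 < mu by split; [rewrite mux lexx|exact: mu0].
have at0 : at_time 0 = path_at n x 0.
  by rewrite /at_time expR0 mulr1 mux subrr.
have x1_pos : 0 < mass x + alpha n x by lra.
set u := ln ((mass x + alpha n x) / mu); have uE := mass_time x1_pos.
rewrite -/u in uE.
have u0 : 0 <= u by apply: le_mass_time; rewrite uE expR0 mulr1; lra.
have piece1 c : 0 <= c -> c <= u -> lipschitz_solution A B c at_time.
  move=> c0 cu; have cu' := le_mu cu.
  have E t : t <= u -> go (vertex (la n) (lb n)) (at_time 0) t = at_time t.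
    move=> tu; have tu' := le_mu tu; have u0' := le_mu u0.
    by rewrite -[in LHS](subr0 t) go_path1 //; lra.
  apply: (@lipschitz_solution_ext _ _ _ _ (go (vertex (la n) (lb n)) (at_time 0))).
    by move=> t tc; apply: E; lra.
  apply: lipschitz_solution_go; first by rewrite at0.
  move=> t tc; rewrite E; last lra.
  have t0' := @lt_mu 0 t ltac:(lra); have tc' := @lt_mu t c ltac:(lra).
  by apply: strict1; rewrite expR0 mulr1 in t0'; lra.
have [bu|ub] := leP b u; first exact: piece1.
have u_sol := piece1 u u0 (lexx _).
have u_ss : state_space (at_time u).
  by case: u_sol => + _ _; apply; rewrite u0 lexx.
have -> : b = u + (b - u) by ring.
apply: lipschitz_solution_cat => //; first lra.
have E t : 0 <= t -> go (vertex (la n.+1) (lb n)) (at_time u) t = at_time (t + u).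
  move=> t0; have tu' := @le_mu u (t + u) ltac:(lra).
  by rewrite -[in LHS](addrK u t) go_path2 //; lra.
apply: (@lipschitz_solution_ext _ _ _ _ (go (vertex (la n.+1) (lb n)) (at_time u))).
  by move=> t tc; apply: E; lra.
apply: lipschitz_solution_go => // t tc; rewrite E; last lra.
have t0' := @lt_mu u (t + u) ltac:(lra); have tb' := @lt_mu (t + u) b ltac:(lra).
by apply: strict2; lra.
Qed.

End Phase.
End Phases.

(** * Linear recurrences of order three *)

Section LinearRecurrences.
Context {R : realType}.

(** The hypotheses are the Schur criterion for both roots of z^2 + p z + q to lie inside the unit
    disc. A quadratic Lyapunov function gives the decay without solving for the roots, which may be
    complex. *)
Lemma rec2_geometric (p q : R) : 0 <= q < 1 -> `|p| < 1 + q ->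
  exists C r, [/\ 0 <= C, 0 < r < 1 & forall w : nat -> R,
    (forall n, w n.+2 = - p * w n.+1 - q * w n) ->
    forall n, `|w n| <= C * r ^+ n * (`|w 0%N| + `|w 1%N|)].
Proof.
move=> /andP[q0 q1] pq.
(* A quarter of the slack in the two inequalities: they remain true for [P] and [Q], the
   coefficients after division of the sequence by r^n. *)
pose h := Num.min (1 + q - `|p|) (1 - q) / 4; pose r := 1 - h.
have m0 : 0 < Num.min (1 + q - `|p|) (1 - q) by rewrite lt_min; lra.
have m1 : Num.min (1 + q - `|p|) (1 - q) <= 1 + q - `|p| by rewrite ge_min lexx.
have m2 : Num.min (1 + q - `|p|) (1 - q) <= 1 - q by rewrite ge_min lexx orbT.
have p0 : 0 <= `|p| := normr_ge0 _.
have r0 : 0 < r by rewrite /r /h; lra.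
have r1 : r < 1 by rewrite /r /h; lra.
have rr : 1 - 2 * h <= r ^+ 2 by rewrite /r; have := sqr_ge0 h; lra.
have r20 : 0 < r ^+ 2 by rewrite exprn_gt0.
pose P := p / r; pose Q := q / r ^+ 2.
have Q0 : 0 <= Q by rewrite divr_ge0 // ltW.
have Q1 : Q < 1 by rewrite ltr_pdivrMr // mul1r /h in rr *; lra.
have PE : `|P| = `|p| * r / r ^+ 2.
  by rewrite normrM normfV (gtr0_norm r0); field; lra.
have c0 : 0 < 1 + Q - `|P|.
  have -> : 1 + Q - `|P| = (r ^+ 2 + q - `|p| * r) / r ^+ 2.
    by rewrite PE /Q; field; lra.
  rewrite divr_gt0 //; have : `|p| * r <= `|p| by rewrite ler_piMr // ltW.
  by rewrite /h in rr; lra.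
set c := 1 + Q - `|P| in c0; pose C := 1 + 4 / c.
have C1 : 1 <= C by rewrite lerDl divr_ge0 // ltW.
exists (C / r), r; split; first by rewrite divr_ge0 ?ltW //; lra.
  by rewrite r0.
move=> w w_rec; pose v n := w n / r ^+ n.
have rn n : r ^+ n != 0 by rewrite expf_neq0 // gt_eqF.
have v_rec n : v n.+2 = - P * v n.+1 - Q * v n.
  by rewrite /v w_rec /P /Q !exprS; field; rewrite rn /= gt_eqF.
(* The quadratic form that the recurrence preserves when Q = 1. It decreases by (1 - Q) times a
   square, and it is positive definite because |P| < 1 + Q. *)
pose V n := (1 + Q) * (v n.+1 ^+ 2 + v n ^+ 2) + 2 * P * v n.+1 * v n.
have V_dec n : V n <= V 0%N.
  elim: n => // n; apply: le_trans; rewrite /V v_rec -subr_ge0.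
  have -> : (1 + Q) * (v n.+1 ^+ 2 + v n ^+ 2) + 2 * P * v n.+1 * v n -
    ((1 + Q) * ((- P * v n.+1 - Q * v n) ^+ 2 + v n.+1 ^+ 2) +
     2 * P * (- P * v n.+1 - Q * v n) * v n.+1) =
    (1 - Q) * (- P * v n.+1 - Q * v n - v n) ^+ 2 by ring.
  by rewrite mulr_ge0 ?sqr_ge0 //; lra.
have amgm (x y z : R) : `|2 * x * y * z| <= `|x| * (y ^+ 2 + z ^+ 2).
  rewrite !normrM (ger0_norm (_ : 0 <= 2 :> R)) //.
  rewrite -(real_normK (num_real y)) -(real_normK (num_real z)).
  by have := mulr_ge0 (normr_ge0 x) (sqr_ge0 (`|y| - `|z|)); lra.
have Pvv n := amgm P (v n.+1) (v n).
have V_low n : c * v n ^+ 2 <= V n.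
  have := Pvv n; rewrite ler_norml => /andP[+ _].
  have : 0 <= c * v n.+1 ^+ 2 by rewrite mulr_ge0 ?sqr_ge0 // ltW.
  by rewrite /V /c; lra.
have V0 : V 0%N <= 4 * (`|v 0%N| + `|v 1%N|) ^+ 2.
  have := Pvv 0%N; rewrite ler_norml => /andP[_ +].
  set S := v 1%N ^+ 2 + v 0%N ^+ 2 => PS.
  have S0 : 0 <= S by rewrite addr_ge0 ?sqr_ge0.
  have SS : S <= (`|v 0%N| + `|v 1%N|) ^+ 2.
    rewrite /S -(real_normK (num_real (v 1%N))) -(real_normK (num_real (v 0%N))).
    by have := mulr_ge0 (normr_ge0 (v 1%N)) (normr_ge0 (v 0%N)); lra.
  rewrite /V -/S.
  have : (1 + Q + `|P|) * S <= 4 * S by rewrite ler_wpM2r //; rewrite /c in c0; lra.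
  by lra.
have v_bound n : `|v n| <= C * (`|v 0%N| + `|v 1%N|).
  have a0 : 0 <= `|v 0%N| + `|v 1%N| by rewrite addr_ge0.
  rewrite -(@ler_pXn2r _ 2) ?nnegrE ?mulr_ge0 //; last lra.
  rewrite real_normK ?num_real // [leRHS]exprMn -(ler_pM2l c0).
  apply: (le_trans (V_low n)); apply: (le_trans (V_dec n)).
  apply: (le_trans V0); rewrite [leRHS]mulrA ler_wpM2r ?sqr_ge0 //.
  have -> : c * C ^+ 2 = c + 8 + 16 / c by rewrite /C; field; lra.
  have : 0 <= 16 / c by rewrite divr_ge0 // ltW.
  lra.
move=> n; have wE : w n = v n * r ^+ n by rewrite /v divfK.
rewrite wE normrM (ger0_norm (exprn_ge0 _ (ltW r0))).
have -> : C / r * r ^+ n * (`|w 0%N| + `|w 1%N|) =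
          C * ((`|w 0%N| + `|w 1%N|) / r) * r ^+ n by field; lra.
apply: ler_wpM2r; first exact: exprn_ge0 (ltW r0).
apply: (le_trans (v_bound n)).
rewrite ler_wpM2l //; first lra.
rewrite /v expr0 expr1 divr1 normrM normfV (gtr0_norm r0) mulrDl lerD2r.
by rewrite ler_pdivlMr // ler_piMr // ltW.
Qed.

Definition chi (T S z : R) := z ^+ 3 - T * z ^+ 2 + S * z - 1.

(* Under the stated inequalities [l] strictly dominates the two other roots. *)
Lemma rec3_cvg (T S l : R) : 1 < l -> chi T S l = 0 -> T < l ->
  0 < 1 + T * l ^+ 2 ->
  exists C, 0 <= C /\ forall u : nat -> R,
    (forall n, u n.+3 = T * u n.+2 - S * u n.+1 + u n) ->
    cvgn (fun n => u n / l ^+ n) /\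
    forall n, `|u n / l ^+ n| <= C * (`|u 0%N| + `|u 1%N| + `|u 2%N|).
Proof.
move=> l1 chil Tl dom; have l0 : 0 < l by lra.
have l3 : 1 < l ^+ 3 by rewrite exprn_egt1.
(* The coefficients of the quadratic cofactor of z - l in [chi], after the substitution z = l w. *)
pose p := (l - T) / l; pose q := (l ^+ 3)^-1.
have p0 : 0 < p by rewrite divr_gt0 //; lra.
have q0 : 0 < q by rewrite invr_gt0; lra.
have q1 : q < 1 by rewrite invf_lt1 //; lra.
have pq : `|p| < 1 + q.
  rewrite gtr0_norm // -subr_gt0.
  have -> : 1 + q - p = (1 + T * l ^+ 2) / l ^+ 3 by rewrite /p /q; field; lra.
  by rewrite divr_gt0 //; lra.
have [|C [r [C0 /andP[r0 r1] CP]]] := rec2_geometric _ pq; first by rewrite ltW.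
have ln n : l ^+ n != 0 by rewrite expf_neq0 // gt_eqF.
have SE : S = (1 + T * l ^+ 2 - l ^+ 3) / l.
  by move: chil; rewrite /chi => chil; rewrite -[LHS](mulfK (lt0r_neq0 l0)); congr (_ / _); lra.
exists (1 + 2 * C / (1 - r)); split.
  by rewrite addr_ge0 // divr_ge0 ?mulr_ge0 //; lra.
(* Division by l^n moves the root l to 1, and taking differences removes that root. *)
move=> u u_rec; pose v n := u n / l ^+ n; pose w n := v n.+1 - v n.
have w_rec n : w n.+2 = - p * w n.+1 - q * w n.
  rewrite /w /v u_rec SE /p /q !exprS; field.
  by rewrite ln gt_eqF.
have v1 n : `|u n / l ^+ n| <= `|u n|.
  have lpos : 0 < l ^+ n by rewrite exprn_gt0.
  rewrite normrM normfV (gtr0_norm lpos) ler_piMr // invf_le1 //.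
  by rewrite exprn_ege1 // ltW.
have w01 : `|w 0%N| + `|w 1%N| <= 2 * (`|u 0%N| + `|u 1%N| + `|u 2%N|).
  have := ler_normB (v 1%N) (v 0%N); have := ler_normB (v 2%N) (v 1%N).
  have := v1 0%N; have := v1 1%N; have := v1 2%N; rewrite /w /v.
  have := normr_ge0 (u 2%N); have := normr_ge0 (u 0%N); lra.
set W := `|w 0%N| + `|w 1%N| in w01.
have W0 : 0 <= W by rewrite addr_ge0.
have w_bound n : `|w n| <= C * W * r ^+ n.
  by apply: (le_trans (CP w w_rec n)); rewrite mulrAC.
have vE n : v n = v 0%N + series w n.
  elim: n => [|n IHn]; first by rewrite /series /= big_geq // addr0.
  rewrite seriesSr addrA -IHn /w; ring.
have geo : cvgn (series (geometric (C * W) r)).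
  by apply: is_cvg_geometric_series; rewrite gtr0_norm.
have w_cvg : cvgn (series w).
  apply: normed_cvg; apply: series_le_cvg geo => n //=.
  by rewrite mulr_ge0 ?mulr_ge0 // exprn_ge0 // ltW.
split.
  rewrite (_ : (fun n => u n / l ^+ n) = (fun n => v 0%N + series w n)).
    by apply: is_cvgD => //; exact: is_cvg_cst.
  by apply/funext.
move=> n; rewrite -/(v n) vE; apply: (le_trans (ler_normD _ _)).
have s_bound : `|series w n| <= C * W / (1 - r).
  apply: (@le_trans _ _ (series (geometric (C * W) r) n)).
    rewrite !seriesEord; apply: (le_trans (ler_norm_sum _ _ _)).
    by apply: ler_sum => i _; exact: w_bound.
  rewrite geometric_seriesE ?lt_eqF //= ler_pM2r ?invr_gt0; last lra.
  by rewrite ler_piMr ?mulr_ge0 //; have := exprn_ge0 n (ltW r0); lra.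
have := v1 0%N; rewrite -/(v 0%N) => v0.
have : C * W / (1 - r) <= 2 * C / (1 - r) * (`|u 0%N| + `|u 1%N| + `|u 2%N|).
  have -> : 2 * C / (1 - r) * (`|u 0%N| + `|u 1%N| + `|u 2%N|) =
            C * (2 * (`|u 0%N| + `|u 1%N| + `|u 2%N|)) / (1 - r) by field; lra.
  apply: ler_wpM2r; first by rewrite invr_ge0; lra.
  exact: ler_wpM2l.
rewrite mulrDl mul1r; have := normr_ge0 (u 1%N); have := normr_ge0 (u 2%N).
lra.
Qed.

End LinearRecurrences.

(** * The section map and its attracting direction *)

Section SectionMap.
Context {R : realType} (rho kap : R).
Implicit Types x y : R * R * R.
Local Notation step := (step rho kap).
Local Notation dur := (dur kap).

Definition scl (a : R) x : R * R * R := (a * x.1.1, a * x.1.2, a * x.2).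

Lemma sclA a b x : scl a (scl b x) = scl (a * b) x.
Proof. by rewrite /scl /= !mulrA. Qed.
Lemma scl1 x : scl 1 x = x.
Proof. by case: x => [[a b] c]; rewrite /scl /= !mul1r. Qed.

Lemma step_scl a x : step (scl a x) = scl a (step x).
Proof. by rewrite /step /scl /dwell /=; congr (_, _, _); ring. Qed.
Lemma iter_step_scl n a x : iter n step (scl a x) = scl a (iter n step x).
Proof. by elim: n => //= n ->; rewrite step_scl. Qed.
Lemma dur_scl a x : dur (scl a x) = a * dur x.
Proof. by rewrite /dur /dwell /scl /=; ring. Qed.

(** Trace of [step] and, in [sec], the sum of its principal 2 x 2 minors. The determinant is 1, as
    [step_cayley] shows. *)
Definition trc : R := 2 * kap - rho - rho * kap - 1.
Definition sec : R := 2 * rho - kap - rho * kap - 1.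
Local Notation chi := (chi trc sec).

Lemma step_cayley x : step (step (step x)) =
  (trc * (step (step x)).1.1 - sec * (step x).1.1 + x.1.1,
   trc * (step (step x)).1.2 - sec * (step x).1.2 + x.1.2,
   trc * (step (step x)).2 - sec * (step x).2 + x.2).
Proof. by rewrite /step /dwell /trc /sec /=; congr (_, _, _); ring. Qed.

Definition weight x : R := (x.1.1 + x.1.2 + x.2) / (kap - rho).

Lemma weight_scl a x : weight (scl a x) = a * weight x.
Proof. by rewrite /weight /scl /=; ring. Qed.

Lemma weight_step x : kap != rho -> weight (step x) = weight x + dur x.
Proof.
move=> kr; rewrite /weight /step /dur /dwell /=; field.
by rewrite subr_eq0.
Qed.

(** The mass at the start of phase n when phase 0 starts with mass 1: the durations are summed in
    closed form by [weight]. *)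
Definition relmass n x : R := 1 - weight x + weight (iter n step x).

Lemma relmassS n x : kap != rho ->
  relmass n.+1 x = relmass n x + dur (iter n step x).
Proof. by move=> kr; rewrite /relmass iterS weight_step // addrA. Qed.

Lemma relmass0 x : relmass 0 x = 1.
Proof. by rewrite /relmass /= subrK. Qed.

(** The second and third components of the eigenvalue equation give (1 + l kap) d = (l + 1 - kap) l
    f and g = l f - kap d, so the eigenspace is a line; the weight fixes the scale. *)
Lemma eigen_unique l x y : kap != rho -> 1 + l * kap != 0 ->
  step x = scl l x -> step y = scl l y -> weight y = 1 -> x = scl (weight x) y.
Proof.
case: x => [[d f] g]; case: y => [[d' f'] g'] kr lk.
rewrite /step /scl /weight /dwell /= => -[x1 x2 x3] [y1 y2 y3] w1.
have kr0 : kap - rho != 0 by rewrite subr_eq0.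
have D : d' + f' + g' = kap - rho.
  by rewrite -[RHS]mul1r -w1 mulfVK.
have E : d * f' = d' * f.
  apply: (mulfI lk).
  have a1 : (1 + l * kap) * d = (l + 1 - kap) * (l * f).
    have -> : l * f = g + kap * d by rewrite x2.
    have : l * (g + kap * d) - l * kap * d = d + (kap - 1) * (g + kap * d).
      by rewrite x3; ring.
    by lra.
  have a2 : (1 + l * kap) * d' = (l + 1 - kap) * (l * f').
    have -> : l * f' = g' + kap * d' by rewrite y2.
    have : l * (g' + kap * d') - l * kap * d' = d' + (kap - 1) * (g' + kap * d').
      by rewrite y3; ring.
    by lra.
  by rewrite !mulrA a1 a2; ring.
have gE : g = l * f - kap * d by lra.
have gE' : g' = l * f' - kap * d' by lra.
rewrite -D; have D0 : d' + f' + g' != 0 by rewrite D.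
congr (_, _, _); apply: (mulIf D0); rewrite mulrAC divfK // gE gE'.
- have : l * (d * f') = l * (d' * f) by rewrite E.
  by lra.
- have : kap * (d * f') = kap * (d' * f) by rewrite E.
  by lra.
- have : l * (d * f') = l * (d' * f) by rewrite E.
  have : kap * (d * f') = kap * (d' * f) by rewrite E.
  by lra.
Qed.

Lemma coord11_continuous : continuous (fun x => x.1.1).
Proof.
move=> x; apply: (@continuous_comp _ _ _ fst fst); exact: cvg_fst.
Qed.
Lemma coord12_continuous : continuous (fun x => x.1.2).
Proof.
move=> x; apply: (@continuous_comp _ _ _ fst snd); first exact: cvg_fst.
exact: cvg_snd.
Qed.
Lemma coord2_continuous : continuous (fun x => x.2).
Proof. by move=> x; exact: cvg_snd. Qed.

Lemma triple_cvg (T : Type) (F : set_system T) (FF : Filter F)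
    (f1 f2 f3 : T -> R) (a b c : R) :
  f1 @ F --> a -> f2 @ F --> b -> f3 @ F --> c ->
  (fun t => (f1 t, f2 t, f3 t)) @ F --> ((a, b), c).
Proof. by move=> c1 c2 c3; exact: (cvg_pair (cvg_pair c1 c2) c3). Qed.

Lemma dwell_continuous : continuous (dwell kap).
Proof.
move=> x; apply: cvgD; first exact: coord2_continuous.
by apply: cvgM; [exact: cvg_cst|exact: coord11_continuous].
Qed.

Lemma dur_continuous : continuous dur.
Proof.
by move=> x; apply: cvgD; [exact: coord11_continuous|exact: dwell_continuous].
Qed.

Lemma step_continuous : continuous step.
Proof.
move=> x; have e1 := @coord11_continuous x; have e2 := @dwell_continuous x.
apply: triple_cvg => //.
- apply: cvgD; last by apply: cvgM => //; exact: cvg_cst.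
  apply: cvgB; first exact: coord12_continuous.
  by apply: cvgM => //; exact: cvg_cst.
- by apply: cvgD => //; apply: cvgM => //; exact: cvg_cst.
Qed.

Lemma iter_step_continuous n : continuous (iter n step).
Proof.
elim: n => [|n IHn] x; first exact: cvg_id.
by apply: (@continuous_comp _ _ _ (iter n step)); [exact: IHn|
  exact: step_continuous].
Qed.

Lemma weight_continuous : continuous weight.
Proof.
move=> x; apply: cvgM; last exact: cvg_cst.
apply: cvgD; last exact: coord2_continuous.
by apply: cvgD; [exact: coord11_continuous|exact: coord12_continuous].
Qed.

Lemma relmass_continuous n : continuous (relmass n).
Proof.
move=> x; apply: cvgD; last first.
  apply: (@continuous_comp _ _ _ (iter n step)).
    exact: iter_step_continuous.
  exact: weight_continuous.
by apply: cvgB; [exact: cvg_cst|exact: weight_continuous].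
Qed.

Lemma scl_cvg (T : Type) (F : set_system T) (FF : Filter F)
    (f : T -> R) (g : T -> R * R * R) (a : R) x :
  f @ F --> a -> g @ F --> x -> (fun t => scl (f t) (g t)) @ F --> scl a x.
Proof.
move=> fa gx; apply: triple_cvg; apply: cvgM => //.
- exact: (continuous_cvg _ (@coord11_continuous x) gx).
- exact: (continuous_cvg _ (@coord12_continuous x) gx).
- exact: (continuous_cvg _ (@coord2_continuous x) gx).
Qed.

Section Attraction.
Variables (l : R) (xi : R * R * R).
Hypotheses (kr : kap != rho) (lk : 1 + l * kap != 0) (l1 : 1 < l)
  (chil : chi l = 0) (trl : trc < l) (dom : 0 < 1 + trc * l ^+ 2)
  (xi_step : step xi = scl l xi) (xi_weight : weight xi = 1).

Let iter_xi n : iter n step xi = scl (l ^+ n) xi.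
Proof.
elim: n => [|n IHn]; first by rewrite expr0 scl1.
by rewrite iterS IHn step_scl xi_step sclA exprSr.
Qed.

Let l0 : 0 < l. Proof. exact: lt_trans l1. Qed.
Let ln0 n : l ^+ n != 0. Proof. by rewrite expf_neq0 // gt_eqF ?l0. Qed.

Let normalised n x := scl (l ^+ n)^-1 (iter n step x).

(* Both the section coordinates and the mass grow like [l ^+ n]. *)
Lemma normalised_cvg : exists C, 0 <= C /\
  forall c : R * R * R -> R,
  (c = (fun x => x.1.1) \/ c = (fun x => x.1.2) \/ c = (fun x => x.2)) ->
  forall x, cvgn (fun n => c (normalised n x)) /\ forall n,
  `|c (normalised n x) - c xi| <= C * (`|c (iter 0 step x) - c (iter 0 step xi)|
    + `|c (iter 1 step x) - c (iter 1 step xi)|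
    + `|c (iter 2 step x) - c (iter 2 step xi)|).
Proof.
have [C [C0 CP]] := rec3_cvg l1 chil trl dom; exists C; split=> // c cE x.
have cscl a y : c (scl a y) = a * c y by case: cE => [->|[->|->]].
have crec y n : c (iter n.+3 step y) = trc * c (iter n.+2 step y) -
    sec * c (iter n.+1 step y) + c (iter n step y).
  by rewrite !iterS step_cayley; case: cE => [->|[->|->]].
have normE y n : c (normalised n y) = c (iter n step y) / l ^+ n.
  by rewrite /normalised cscl mulrC.
split.
  rewrite (_ : (fun n => _) = (fun n => c (iter n step x) / l ^+ n)).
    by apply: (CP _ (crec x)).1.
  by apply/funext => n; rewrite normE.
move=> n; have [k|_ /(_ n)] :=
    CP (fun n => c (iter n step x) - c (iter n step xi)).
  by rewrite !crec; ring.
have -> : c (iter n step x) - c (iter n step xi) = 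
   (c (normalised n x) - c xi) * l ^+ n.
  by rewrite normE mulrBl divfK // iter_xi cscl (mulrC (c xi)).
by rewrite mulfK.
Qed.

(** The bound of [normalised_cvg] does not depend on n, so closeness of the first three iterates
    gives closeness for all n. The scaled mass [M n] stays near 1 for the same reason, which makes
    the quotient legitimate. *)
Lemma section_attract (U : set (R * R * R)) : nbhs xi U ->
  \forall x \near xi,
    (forall n, 0 < relmass n x /\ U (scl (relmass n x)^-1 (iter n step x))) /\
    (scl (relmass n x)^-1 (iter n step x)) @[n --> \oo] --> xi.
Proof.
move=> xiU; have [C [C0 CP]] := normalised_cvg.
have scl_at1 : (fun ay : R * (R * R * R) => scl ay.1^-1 ay.2) @ ((1 : R), xi) --> xi.
  rewrite -[X in _ --> X]scl1 -[X in _ --> scl X _]invr1; apply: scl_cvg; last exact: cvg_snd.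
  by apply: cvgV; [exact: oner_neq0|exact: cvg_fst].
have pos_at1 : \forall ay \near ((1 : R), xi), 2^-1 < ay.1.
  have : (fun ay : R * (R * R * R) => ay.1) @ ((1 : R), xi) --> (1 : R).
    exact: cvg_fst.
  by move=> H; apply: (cvgr_gt 1 H); lra.
have [[V W] /= [V1 Wxi] VW] := filterI pos_at1 (scl_at1 _ xiU).
have [v /= v0 vV] := (nbhs_ballP _ _).1 V1.
have weight_near : \forall y \near xi, `|weight xi - weight y| < v / 2.
  have /cvgrPdist_lt := weight_continuous (x := xi); apply.
  by rewrite divr_gt0.
have [w /= w0 wW] := (nbhs_ballP _ _).1 (filterI Wxi weight_near).
have coord_near c : (c = (fun x => x.1.1) \/ c = (fun x => x.1.2) \/ c = (fun x => x.2)) ->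
  \forall x \near xi, C * (`|c (iter 0 step x) - c (iter 0 step xi)|
    + `|c (iter 1 step x) - c (iter 1 step xi)|
    + `|c (iter 2 step x) - c (iter 2 step xi)|) < w.
  move=> cE; have c_cont : continuous c.
    by case: cE => [->|[->|->]]; [exact: coord11_continuous|
      exact: coord12_continuous|exact: coord2_continuous].
  have dist_cvg n : `|c (iter n step x) - c (iter n step xi)| @[x --> xi] --> (0 : R).
    rewrite -(normr0 R); apply: cvg_norm.
    rewrite -(subrr (c (iter n step xi))); apply: cvgB; last exact: cvg_cst.
    by apply: (@continuous_comp _ _ _ (iter n step)); [exact: iter_step_continuous|exact: c_cont].
  have H : C * (`|c (iter 0 step x) - c (iter 0 step xi)|
    + `|c (iter 1 step x) - c (iter 1 step xi)|
    + `|c (iter 2 step x) - c (iter 2 step xi)|) @[x --> xi] --> C * (0 + 0 + 0).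
    by apply: cvgM; [exact: cvg_cst|apply: cvgD; [apply: cvgD|]; exact: dist_cvg].
  by rewrite !addr0 mulr0 in H; exact: (cvgr_lt 0 H w w0).
near=> x.
have c11 : C * (`|x.1.1 - xi.1.1| + `|(step x).1.1 - (step xi).1.1| +
    `|(step (step x)).1.1 - (step (step xi)).1.1|) < w.
  by near: x; apply: (coord_near (fun x => x.1.1)); left.
have c12 : C * (`|x.1.2 - xi.1.2| + `|(step x).1.2 - (step xi).1.2| +
    `|(step (step x)).1.2 - (step (step xi)).1.2|) < w.
  by near: x; apply: (coord_near (fun x => x.1.2)); right; left.
have c2 : C * (`|x.2 - xi.2| + `|(step x).2 - (step xi).2| +
    `|(step (step x)).2 - (step (step xi)).2|) < w.
  by near: x; apply: (coord_near (fun x => x.2)); right; right.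
have wx : `|weight xi - weight x| < v / 2 by near: x.
have [n11 b11] := CP (fun x => x.1.1) (or_introl erefl) x.
have [n12 b12] := CP (fun x => x.1.2) (or_intror (or_introl erefl)) x.
have [n2 b2] := CP (fun x => x.2) (or_intror (or_intror erefl)) x.
pose M n := relmass n x / l ^+ n.
have ME n : M n = (1 - weight x) / l ^+ n + weight (normalised n x).
  by rewrite /M /relmass mulrDl /normalised weight_scl; congr (_ + _); exact: mulrC.
have sclE n : scl (relmass n x)^-1 (iter n step x) =
    scl (M n)^-1 (normalised n x).
  by rewrite /normalised sclA /M invf_div mulrAC divff ?ln0 // mul1r.
have near_n n : W (normalised n x) /\
    `|weight xi - weight (normalised n x)| < v / 2.
  apply: wW; split; [split|]; rewrite /ball /= distrC.
  - exact: le_lt_trans (b11 n) c11.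
  - exact: le_lt_trans (b12 n) c12.
  - exact: le_lt_trans (b2 n) c2.
have M1 n : `|1 - M n| < v.
  rewrite ME; have [_] := near_n n; rewrite xi_weight => b.
  have -> : 1 - ((1 - weight x) / l ^+ n + weight (normalised n x)) =
    (1 - weight (normalised n x)) - (1 - weight x) / l ^+ n by ring.
  apply: (le_lt_trans (ler_normB _ _)).
  suff : `|(1 - weight x) / l ^+ n| <= `|1 - weight x|.
    by rewrite xi_weight in wx; lra.
  have lpos : 0 < l ^+ n by rewrite exprn_gt0 ?l0.
  rewrite normrM normfV (gtr0_norm lpos) ler_piMr // invf_le1 //.
  by rewrite exprn_ege1 // ltW.
have good n : 2^-1 < M n /\ U (scl (M n)^-1 (normalised n x)).
  apply: (VW (M n, normalised n x)); split=> /=; last by case: (near_n n).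
  by apply: vV; rewrite /ball /=.
split=> [n|].
  have [g1 g2] := good n; rewrite sclE; split=> //.
  have : 0 < M n by lra.
  by rewrite /M pmulr_lgt0 // invr_gt0 exprn_gt0 ?l0.
(* The normalised sequence converges to an eigenvector, a multiple of [xi]. *)
pose L := (limn (fun n => (normalised n x).1.1),
           limn (fun n => (normalised n x).1.2),
           limn (fun n => (normalised n x).2)).
have L_cvg : normalised n x @[n --> \oo] --> L.
  rewrite (_ : (fun n => normalised n x) = (fun n => ((normalised n x).1.1,
    (normalised n x).1.2, (normalised n x).2))); last first.
    by apply/funext => n; case: (normalised n x) => [[]].
  exact: triple_cvg.
have L_step : step L = scl l L.
  have c1 : step (normalised n x) @[n --> \oo] --> step L.
    exact: (continuous_cvg _ (@step_continuous L) L_cvg).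
  have c2' : step (normalised n x) @[n --> \oo] --> scl l L.
    rewrite (_ : (fun n => step (normalised n x)) =
                 (fun n => scl l (normalised n.+1 x))); last first.
      apply/funext => n; rewrite /normalised step_scl iterS sclA; congr scl.
      by rewrite exprS; field; rewrite ln0 gt_eqF ?l0.
    apply: scl_cvg; first exact: cvg_cst.
    by move=> P /L_cvg[N _ NP]; exists N => // n Nn; apply: NP; exact: leqW.
  exact: cvg_unique c1 c2'.
have LE := eigen_unique kr lk L_step xi_step xi_weight.
have M_cvg : M n @[n --> \oo] --> weight L.
  rewrite (_ : M = (fun n => (1 - weight x) / l ^+ n + weight (normalised n x))).
    rewrite -[X in _ --> X]add0r; apply: cvgD; last first.
      exact: (continuous_cvg _ (@weight_continuous L) L_cvg).
    rewrite -[X in _ --> X](mulr0 (1 - weight x)); apply: cvgM; first exact: cvg_cst.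
    rewrite (_ : (fun n => (l ^+ n)^-1) = (fun n => l^-1 ^+ n)).
      apply: cvg_expr; rewrite ger0_norm ?invr_ge0 ?ltW ?l0 // invf_lt1 ?l0 //.
    by apply/funext => n; rewrite exprVn.
  by apply/funext => n.
have L0 : weight L != 0.
  suff : 2^-1 <= weight L by move=> L2; rewrite gt_eqF //; lra.
  rewrite -(cvg_lim _ M_cvg) //; apply: limr_ge; first exact: cvgP M_cvg.
  by near=> n; apply: ltW; case: (good n).
rewrite (_ : (fun n => _) = (fun n => scl (M n)^-1 (normalised n x))); last first.
  by apply/funext => n.
have -> : xi = scl (weight L)^-1 L by rewrite -[LHS]scl1 -(mulVf L0) -sclA -LE.
by apply: scl_cvg => //; apply: cvgV.
Unshelve. all: by end_near. Qed.

End Attraction.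
End SectionMap.

Section MinMax.
Context {R : realType} (T : Type) (F : set_system T) (FF : Filter F).
Implicit Types f g : T -> R.

Lemma cvg_minr2 f g (a b : R) : f t @[t --> F] --> a -> g t @[t --> F] --> b ->
  Num.min (f t) (g t) @[t --> F] --> Num.min a b.
Proof.
by move=> fa gb; exact: (continuous_cvg _ (@min_continuous _ R (a, b)) (cvg_pair fa gb)).
Qed.

Lemma cvg_maxr2 f g (a b : R) : f t @[t --> F] --> a -> g t @[t --> F] --> b ->
  Num.max (f t) (g t) @[t --> F] --> Num.max a b.
Proof.
by move=> fa gb; exact: (continuous_cvg _ (@max_continuous _ R (a, b)) (cvg_pair fa gb)).
Qed.

End MinMax.

(** * Reconstruction of states from their section coordinates *)

Section Base.
Context {R : realType} (A B : 'M[R]_3) (la lb : nat -> 'I_3).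
Variables (r q rho kap : R).
Hypothesis game : cyclic_game A B la lb r q rho kap.
Local Notation alpha := (alpha lb rho).
Local Notation gamma := (gamma la kap).
Local Notation section := (section la lb rho kap).
Local Notation cumul := (cumul la lb rho).
Local Notation path_at := (path_at la lb rho).
Local Notation next := (next la lb rho kap).

Lemma sum_labels (h : nat -> 'I_3) n (F : 'I_3 -> R) :
  uniq [:: h n; h n.+1; h n.+2] ->
  \sum_k F k = F (h n) + F (h n.+1) + F (h n.+2).
Proof.
move=> h_uniq; have cover := ord3_cover (l := h) (n := n) _ h_uniq.
move: h_uniq; rewrite /= !inE !negb_or andbT => /andP[/andP[h01 h02] h12].
rewrite (bigD1 (h n)) //= (bigD1 (h n.+1)) 1?eq_sym //=.
rewrite (bigD1 (h n.+2)) /=; last by rewrite eq_sym h02 eq_sym h12.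
rewrite big1 ?addr0 ?addrA // => k /andP[/andP[k0 k1] k2].
by case: (cover k) => kE; rewrite kE eqxx in k0 k1 k2.
Qed.

Definition massA (x : state R) : R := \sum_k x.1 0 k.
(** [mass] reads only the component of B; for balanced states it is the mass of both components. *)
Definition balanced x := massA x = mass x.

Lemma massAD x y : massA (x + y) = massA x + massA y.
Proof. by rewrite /massA -big_split; apply: eq_bigr => k _; rewrite mxE. Qed.
Lemma massAZ a x : massA (a *: x) = a * massA x.
Proof. by rewrite /massA mulr_sumr; apply: eq_bigr => k _; rewrite mxE. Qed.
Lemma massA_vertex i j : massA (vertex i j) = 1.
Proof.
rewrite /massA; under eq_bigr do rewrite vertex1E.
by rewrite (bigD1 i) //= eqxx big1 ?addr0 // => k /negPf->.
Qed.

Lemma balanced_cumul n x s : balanced x -> balanced (cumul n x s).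
Proof.
move=> xb; rewrite /balanced (mass_cumul la lb) /cumul !massAD !massAZ.
by rewrite !massA_vertex !mulr1 xb -addrA (@min_max_sum R).
Qed.

Lemma state_space_balanced x : state_space x -> mass x = 1 /\ balanced x.
Proof. by move=> /state_space_sum[sA sB]; rewrite /balanced /massA /mass sA sB. Qed.

(* The coefficients solve the linear system that prescribes the mass [m] of both
   components, the section coordinates [x] and [gamma n.+2 = 0]. *)
Definition base n (x : R * R * R) (m : R) : state R :=
  let D := 3 * (rho ^+ 2 - rho + 1) in
  let K := 3 * (kap ^+ 2 - kap + 1) in
  ((m / 3 + (2 * kap - 1) * x.2 / K) *: pureA R (la n)
   + (m / 3 - (1 + kap) * x.2 / K) *: pureA R (la n.+1)
   + (m / 3 + (2 - kap) * x.2 / K) *: pureA R (la n.+2),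
   (m / 3 + ((rho - 2) * x.1.1 - (2 * rho - 1) * x.1.2) / D) *: pureB R (lb n)
   + (m / 3 + ((1 + rho) * x.1.1 - (2 - rho) * x.1.2) / D) *: pureB R (lb n.+1)
   + (m / 3 + ((1 - 2 * rho) * x.1.1 + (1 + rho) * x.1.2) / D)
     *: pureB R (lb n.+2)).

Lemma quad_gt0 (z : R) : 0 < z ^+ 2 - z + 1.
Proof.
have -> : z ^+ 2 - z + 1 = (z - 2^-1) ^+ 2 + 3 / 4 by field.
by have := sqr_ge0 (z - 2^-1); lra.
Qed.
Let D0 : rho ^+ 2 - rho + 1 != 0. Proof. by rewrite gt_eqF ?quad_gt0. Qed.
Let K0 : kap ^+ 2 - kap + 1 != 0. Proof. by rewrite gt_eqF ?quad_gt0. Qed.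

Lemma base1E n x m : let K := 3 * (kap ^+ 2 - kap + 1) in
  [/\ (base n x m).1 0 (la n) = m / 3 + (2 * kap - 1) * x.2 / K,
      (base n x m).1 0 (la n.+1) = m / 3 - (1 + kap) * x.2 / K &
      (base n x m).1 0 (la n.+2) = m / 3 + (2 - kap) * x.2 / K].
Proof.
have [e1 e2 e3] := la_neq game n.
rewrite /base /= !mxE !eqxx !(eq_sym (la n.+1)) !(eq_sym (la n.+2)) e1 e2 e3 /=.
by split; ring.
Qed.

Lemma base2E n x m : let D := 3 * (rho ^+ 2 - rho + 1) in
  [/\ (base n x m).2 (lb n) 0 =
        m / 3 + ((rho - 2) * x.1.1 - (2 * rho - 1) * x.1.2) / D,
      (base n x m).2 (lb n.+1) 0 =
        m / 3 + ((1 + rho) * x.1.1 - (2 - rho) * x.1.2) / D &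
      (base n x m).2 (lb n.+2) 0 =
        m / 3 + ((1 - 2 * rho) * x.1.1 + (1 + rho) * x.1.2) / D].
Proof.
have [e1 e2 e3] := lb_neq game n.
rewrite /base /= !mxE !eqxx !(eq_sym (lb n.+1)) !(eq_sym (lb n.+2)) e1 e2 e3 /=.
by split; ring.
Qed.

Lemma base_section n x m : [/\ section n (base n x m) = x,
  gamma n.+2 (base n x m) = 0, mass (base n x m) = m & balanced (base n x m)].
Proof.
have [a1 a2 a3] := base1E n x m; have [b1 b2 b3] := base2E n x m.
have mB : mass (base n x m) = m.
  rewrite /mass (sum_labels _ (cg_lb_uniq game n)) b1 b2 b3; field.
  exact: D0.
split=> //; last first.
- rewrite /balanced mB /massA (sum_labels _ (cg_la_uniq game n)) a1 a2 a3; field.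
  exact: K0.
- by rewrite /gamma !(cg_la3 game) a1 a2 a3; field.
case: x a1 a2 a3 b1 b2 b3 {mB} => [[d f] g] a1 a2 a3 b1 b2 b3.
rewrite /section /alpha /gamma !(cg_lb3 game) a1 a2 a3 b1 b2 b3 /=.
by congr (_, _, _); field.
Qed.

(** A state has six entries; the two masses, the tie and the three section coordinates are six
    linear conditions on them, independent because [rho ^+ 2 - rho + 1] and [kap ^+ 2 - kap + 1] do
    not vanish. *)
Lemma base_unique n x : gamma n.+2 x = 0 -> balanced x ->
  x = base n (section n x) (mass x).
Proof.
move=> x_tie x_bal.
have [a1 a2 a3] := base1E n (section n x) (mass x).
have [b1 b2 b3] := base2E n (section n x) (mass x).
have mA : mass x = x.1 0 (la n) + x.1 0 (la n.+1) + x.1 0 (la n.+2).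
  by rewrite -x_bal /massA (sum_labels _ (cg_la_uniq game n)).
have mB : mass x = x.2 (lb n) 0 + x.2 (lb n.+1) 0 + x.2 (lb n.+2) 0.
  by rewrite /mass (sum_labels _ (cg_lb_uniq game n)).
have tie : x.1 0 (la n) = kap * x.1 0 (la n.+2) - (kap - 1) * x.1 0 (la n.+1).
  by move: x_tie; rewrite /gamma !(cg_la3 game); lra.
apply: stateP => k.
  case: (ord3_cover k (cg_la_uniq game n)) => ->; rewrite ?a1 ?a2 ?a3 mA
    /section /gamma /= tie; field; exact: K0.
case: (ord3_cover k (cg_lb_uniq game n)) => ->; rewrite ?b1 ?b2 ?b3 mB
  /section /alpha /= !(cg_lb3 game); field; exact: D0.
Qed.

Lemma sectionZ n a x : section n (a *: x) = scl a (section n x).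
Proof.
by rewrite /section alphaZ gammaZ alphaZ /scl /= mulrN.
Qed.

Lemma cumulZ n a x s : 0 <= a -> cumul n (a *: x) (a * s) = a *: cumul n x s.
Proof.
move=> a0; rewrite /cumul alphaZ -mulrBr.
have -> : Num.max 0 (a * (s - alpha n x)) = a * Num.max 0 (s - alpha n x).
  by rewrite maxr_pMr // mulr0.
by rewrite -minr_pMr // !scalerDr !scalerA.
Qed.

Lemma path_atZ n a x s : 0 < a -> path_at n (a *: x) (a * s) = path_at n x s.
Proof.
move=> a0; rewrite /path_at massZ -mulrDr cumulZ ?ltW // scalerA invfM.
by rewrite mulrAC mulVf ?gt_eqF // mul1r.
Qed.

Lemma baseZ n a x m : base n (scl a x) (a * m) = a *: base n x m.
Proof.
have [s1 t1 m1 b1] := base_section n x m.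
rewrite [RHS](@base_unique n); first by rewrite sectionZ massZ s1 m1.
  by rewrite gammaZ t1 mulr0.
by rewrite /balanced massAZ massZ b1.
Qed.

Lemma next_base n x : gamma n.+2 x = 0 -> balanced x ->
  0 <= dwell kap (section n x) ->
  next n x = base n.+1 (step rho kap (section n x))
    (mass x + dur kap (section n x)).
Proof.
move=> x_tie x_bal e0; have [t s] := section_next game x_tie e0.
by rewrite -s -mass_next; apply: base_unique => //; apply: balanced_cumul.
Qed.

Lemma alpha_continuous n : continuous (alpha n).
Proof.
move=> x; apply: cvgD; first apply: cvgD.
- by apply: cvgN; exact: state_entry2_continuous.
- by apply: cvgM; [exact: cvg_cst|exact: state_entry2_continuous].
- by apply: cvgM; [exact: cvg_cst|exact: state_entry2_continuous].
Qed.

Lemma gamma_continuous n : continuous (gamma n).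
Proof.
move=> x; apply: cvgD; first apply: cvgB.
- by apply: cvgM; [exact: cvg_cst|exact: state_entry1_continuous].
- exact: state_entry1_continuous.
- by apply: cvgM; [exact: cvg_cst|exact: state_entry1_continuous].
Qed.

Lemma section_continuous n : continuous (section n).
Proof.
move=> x; apply: triple_cvg; [exact: alpha_continuous| |exact: gamma_continuous].
by apply: cvgN; exact: alpha_continuous.
Qed.

Lemma base_cvg (T : Type) (F : set_system T) (FF : Filter F) n
    (f : T -> R * R * R) (g : T -> R) x m :
  f t @[t --> F] --> x -> g t @[t --> F] --> m ->
  base n (f t) (g t) @[t --> F] --> base n x m.
Proof.
move=> fx gm; have c1 : (f t).1.1 @[t --> F] --> x.1.1 := continuous_cvg _ (@coord11_continuous R x) fx.
have c2 : (f t).1.2 @[t --> F] --> x.1.2 := continuous_cvg _ (@coord12_continuous R x) fx.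
have c3 : (f t).2 @[t --> F] --> x.2 := continuous_cvg _ (@coord2_continuous R x) fx.
have cst (a : R) : a @[t --> F] --> a by exact: cvg_cst.
have gm3 : g t / 3 @[t --> F] --> m / 3.
  by apply: cvgM; [exact: gm|exact: cst].
have PA : (base n (f t) (g t)).1 @[t --> F] --> (base n x m).1.
  apply: cvgD; first apply: cvgD; apply: cvgZr_tmp.
  - by apply: cvgD; [exact: gm3|apply: cvgM; [apply: cvgM; [exact: cst|exact: c3]|exact: cst]].
  - by apply: cvgB; [exact: gm3|apply: cvgM; [apply: cvgM; [exact: cst|exact: c3]|exact: cst]].
  - by apply: cvgD; [exact: gm3|apply: cvgM; [apply: cvgM; [exact: cst|exact: c3]|exact: cst]].
have PB : (base n (f t) (g t)).2 @[t --> F] --> (base n x m).2.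
  apply: cvgD; first apply: cvgD; apply: cvgZr_tmp.
  - by apply: cvgD; [exact: gm3|apply: cvgM; [apply: cvgB; apply: cvgM; (exact: cst || exact: c1 || exact: c2)|exact: cst]].
  - by apply: cvgD; [exact: gm3|apply: cvgM; [apply: cvgB; apply: cvgM; (exact: cst || exact: c1 || exact: c2)|exact: cst]].
  - by apply: cvgD; [exact: gm3|apply: cvgM; [apply: cvgD; apply: cvgM; (exact: cst || exact: c1 || exact: c2)|exact: cst]].
exact: (cvg_pair PA PB).
Qed.

Lemma mass_continuous : continuous (@mass R).
Proof.
move=> x; apply: cvg_big => [|k _]; first exact: add_continuous.
exact: state_entry2_continuous.
Qed.

Lemma path_at_cvg (T : Type) (F : set_system T) (FF : Filter F) n
    (f : T -> state R) (g : T -> R) x s : mass x + s != 0 ->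
  f t @[t --> F] --> x -> g t @[t --> F] --> s ->
  path_at n (f t) (g t) @[t --> F] --> path_at n x s.
Proof.
move=> xs fx gs; have fa : alpha n (f t) @[t --> F] --> alpha n x :=
  continuous_cvg _ (@alpha_continuous n x) fx.
apply: cvgZ.
  by apply: cvgV => //; apply: cvgD => //; exact: (continuous_cvg _ (@mass_continuous x) fx).
apply: cvgD; first apply: cvgD => //.
  by apply: cvgZr_tmp; apply: cvg_minr2; [exact: gs|exact: fa].
by apply: cvgZr_tmp; apply: cvg_maxr2; [exact: cvg_cst|apply: cvgB; [exact: gs|exact: fa]].
Qed.

(* Inverts [cumul]: every balanced state is [cumul n (origin n x) (elapsed n x)]. *)
Definition late n (x : state R) : R := Num.max 0 (- alpha n x).
Definition early n (x : state R) : R := - gamma n.+2 x - (kap - 1) * late n x.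
Definition elapsed n x : R := early n x + late n x.
Definition origin n (x : state R) : state R :=
  x - (early n x *: vertex (la n) (lb n) + late n x *: vertex (la n.+1) (lb n)).

Lemma alpha_origin n x : alpha n (origin n x) = alpha n x + elapsed n x.
Proof.
have [e1 _ _] := alpha_vertex game n (la n).
have [f1 _ _] := alpha_vertex game n (la n.+1).
by rewrite /origin -scaleN1r !(alphaD, alphaZ) e1 f1 /elapsed; ring.
Qed.

Lemma cumul_origin n x : cumul n (origin n x) (elapsed n x) = x.
Proof.
have oE : elapsed n x - (alpha n x + elapsed n x) = - alpha n x by ring.
rewrite /cumul alpha_origin oE -/(late n x).
have -> : Num.min (elapsed n x) (alpha n x + elapsed n x) = early n x.
  rewrite /elapsed /late; case: (leP 0 (- alpha n x)) => ax.
    by rewrite min_r; lra.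
  by rewrite min_l; lra.
by rewrite /origin -addrA subrK.
Qed.

Lemma gamma_origin n x : gamma n.+2 (origin n x) = 0.
Proof.
have [_ _ e3] := gamma_vertex game n (lb n).
have [_ f2 _] := gamma_vertex game n.+1 (lb n).
by rewrite /origin -scaleN1r !(gammaD, gammaZ) e3 f2 /early; ring.
Qed.

Lemma mass_origin n x : mass (origin n x) = mass x - elapsed n x.
Proof.
have := mass_cumul la lb rho n (origin n x) (elapsed n x).
by rewrite cumul_origin => ->; rewrite addrK.
Qed.

Lemma balanced_origin n x : balanced x -> balanced (origin n x).
Proof.
move=> xb; rewrite /balanced /origin -scaleN1r !(massAD, massAZ, massD, massZ).
by rewrite !massA_vertex !mass_vertex xb.
Qed.

Lemma path_origin n x : mass x = 1 -> path_at n (origin n x) (elapsed n x) = x.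
Proof.
by move=> x1; rewrite /path_at mass_origin subrK x1 invr1 scale1r cumul_origin.
Qed.

Lemma late_cumul n x s : late n (cumul n x s) = Num.max 0 (s - alpha n x).
Proof.
by have [H _ _] := alpha_cumul game n x s; rewrite /late H opprB.
Qed.

Lemma elapsed_cumul n x s : gamma n.+2 x = 0 -> elapsed n (cumul n x s) = s.
Proof.
move=> x0; rewrite /elapsed /early late_cumul.
have [sx|xs] := leP s (alpha n x).
  have [_ ->] := gamma_cumul1 game sx; rewrite max_l ?subr_le0 // x0; ring.
have [_ ->] := gamma_cumul2 game (ltW xs).
by rewrite max_r ?subr_ge0 ?ltW // x0; ring.
Qed.

Lemma origin_cumul n x s : gamma n.+2 x = 0 -> origin n (cumul n x s) = x.
Proof.
move=> x0; have E := elapsed_cumul s x0.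
have early_cumul : early n (cumul n x s) = Num.min s (alpha n x).
  have := @min_max_sum R s (alpha n x).
  by rewrite /elapsed late_cumul in E; lra.
rewrite /origin early_cumul late_cumul /cumul.
by set u := _ *: vertex (la n) _; rewrite -[x + u + _]addrA addrK.
Qed.

Lemma lateZ n a x : 0 <= a -> late n (a *: x) = a * late n x.
Proof. by move=> a0; rewrite /late alphaZ maxr_pMr // mulr0 mulrN. Qed.
Lemma earlyZ n a x : 0 <= a -> early n (a *: x) = a * early n x.
Proof. by move=> a0; rewrite /early gammaZ lateZ //; ring. Qed.
Lemma elapsedZ n a x : 0 <= a -> elapsed n (a *: x) = a * elapsed n x.
Proof. by move=> a0; rewrite /elapsed (earlyZ _ _ a0) (lateZ _ _ a0); ring. Qed.
Lemma originZ n a x : 0 <= a -> origin n (a *: x) = a *: origin n x.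
Proof.
by move=> a0; rewrite /origin earlyZ // lateZ // scalerBr scalerDr !scalerA.
Qed.

Lemma late_continuous n : continuous (late n).
Proof.
move=> x; apply: cvg_maxr2; first exact: cvg_cst.
by apply: cvgN; exact: alpha_continuous.
Qed.

Lemma early_continuous n : continuous (early n).
Proof.
move=> x; apply: cvgB; first by apply: cvgN; exact: gamma_continuous.
by apply: cvgM; [exact: cvg_cst|exact: late_continuous].
Qed.

Lemma elapsed_continuous n : continuous (elapsed n).
Proof.
by move=> x; apply: cvgD; [exact: early_continuous|exact: late_continuous].
Qed.

Lemma origin_continuous n : continuous (origin n).
Proof.
move=> x; apply: cvgB; first exact: cvg_id.
by apply: cvgD; apply: cvgZr_tmp; [exact: early_continuous|exact: late_continuous].
Qed.

End Base.

(** * Stability *)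

Section Orbit.
Context {R : realType} (A B : 'M[R]_3) (la lb : nat -> 'I_3).
Variables (r q rho kap : R).
Hypothesis game : cyclic_game A B la lb r q rho kap.
Local Notation alpha := (alpha lb rho).
Local Notation gamma := (gamma la kap).
Local Notation section := (section la lb rho kap).
Local Notation cumul := (cumul la lb rho).
Local Notation path_at := (path_at la lb rho).
Local Notation next := (next la lb rho kap).
Local Notation base := (base la lb rho kap).
Local Notation step := (step rho kap).
Local Notation dur := (dur kap).
Local Notation valid := (valid rho kap).

Fixpoint phase_start k (x : state R) n : state R :=
  if n is n'.+1 then next (k + n') (phase_start k x n') else x.

Lemma valid_dwell x : valid x -> 0 < dwell kap x.
Proof.
by case=> d0 f0 g0 _ _; rewrite /dwell addr_gt0 // mulr_gt0 // (cg_kap game).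
Qed.

Lemma valid_dur x : valid x -> 0 < dur x.
Proof. by move=> xv; rewrite addr_gt0 ?valid_dwell //; case: xv. Qed.

Lemma valid_scl a x : 0 < a -> valid (scl a x) <-> valid x.
Proof.
move=> a0; rewrite /valid step_scl /scl /= mulrCA -mulrBr !(pmulr_rgt0 _ a0).
by [].
Qed.

Lemma phase_start_section k x n : gamma k.+2 x = 0 -> balanced x ->
  (forall m, (m < n)%N -> valid (iter m step (section k x))) ->
  [/\ gamma (k + n).+2 (phase_start k x n) = 0,
      balanced (phase_start k x n) &
      section (k + n) (phase_start k x n) = iter n step (section k x)].
Proof.
move=> x_tie x_bal; elim: n => [|n IHn] x_valid; first by rewrite addn0.
have [|t b s] := IHn; first by move=> m mn; apply: x_valid; exact: leqW.
rewrite addnS /=; have e0 : 0 <= dwell kap (section (k + n) (phase_start k x n)).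
  by rewrite s ltW // valid_dwell //; exact: x_valid.
have [t' s'] := section_next game t e0.
by split=> //; [exact: balanced_cumul|rewrite s' s].
Qed.

Lemma mass_phase_start k x n : mass (phase_start k x n.+1) =
  mass (phase_start k x n) + dur (section (k + n) (phase_start k x n)).
Proof. exact: mass_next. Qed.

Lemma path_at_end n x : path_at n x (dur (section n x)) =
  (mass (next n x))^-1 *: next n x.
Proof. by rewrite /path_at mass_next. Qed.

Lemma path_at0 n x : 0 <= alpha n x -> path_at n x 0 = (mass x)^-1 *: x.
Proof. by move=> a0; rewrite /path_at addr0 cumul0. Qed.

(** The solution may start inside a phase, with mass [s0] already added. The current phase is found
    by comparing the mass [(mass x + s0) * expR t] with the masses of the phase starts, and the
    induction passes from one phase to the next at the time [c] when these masses coincide. *)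
Lemma solution_track b p k x s0 n t : gamma k.+2 x = 0 -> balanced x ->
  (forall m, (m <= n)%N -> valid (iter m step (section k x))) ->
  0 <= s0 <= dur (section k x) -> 0 < mass x + s0 ->
  fp_solution_upto A B b p -> p 0 = path_at k x s0 -> 0 <= t <= b ->
  mass (phase_start k x n) <= (mass x + s0) * expR t ->
  (mass x + s0) * expR t <= mass (phase_start k x n.+1) ->
  p t = path_at (k + n) (phase_start k x n)
          ((mass x + s0) * expR t - mass (phase_start k x n)).
Proof.
move=> x_tie x_bal + s0d mu0 p_sol p0; set mu := mass x + s0 in mu0 *.
elim: n t => [|n IHn] t x_valid t0 tn tn'.
  have := @phase_unique _ _ _ _ _ _ _ _ _ game k x mu mu0 x_tie (x_valid 0%N isT)
    b p 0 t p_sol (lexx _).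
  rewrite addn0; apply; rewrite ?expR0 ?mulr1.
  - by rewrite p0 /mu addrC addKr.
  - by case/andP: t0.
  - by case/andP: t0.
  - by rewrite /mu lerDl; case/andP: s0d.
  - by move: tn'; rewrite /= ?addn0 mass_next.
have [|tie bal sec_n] := @phase_start_section k x n.+1 x_tie x_bal.
  by move=> m mn; apply: x_valid; exact: ltnW.
have mass_mono m : (m <= n)%N -> mass (phase_start k x 1) <= mass (phase_start k x m.+1).
  elim: m => [//|m IHm] mn; apply: (le_trans (IHm (ltnW mn))).
  rewrite (mass_phase_start k x m.+1) lerDl.
  have [|_ _ ->] := @phase_start_section k x m.+1 x_tie x_bal.
    by move=> j jm; apply: x_valid; apply: leq_trans (ltnW jm) _; exact: leqW.
  by apply: ltW; apply: valid_dur; apply: x_valid; exact: leqW.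
set xn := phase_start k x n.+1 in tie bal sec_n tn *.
have mu_xn : mu <= mass xn.
  apply: le_trans (mass_mono n (leqnn _)).
  by rewrite mass_phase_start /= addn0 /mu lerD2l; case/andP: s0d.
have xn0 : 0 < mass xn by exact: lt_le_trans mu_xn.
set c := ln (mass xn / mu); have cE := mass_time mu0 xn0; rewrite -/c in cE.
have c0 : 0 <= c by apply: (le_mass_time mu0); rewrite cE expR0 mulr1.
have ct : c <= t by apply: (le_mass_time mu0); rewrite cE.
have xn_valid : valid (section (k + n.+1) xn) by rewrite sec_n; exact: x_valid.
have pc : p c = path_at (k + n.+1) xn (mu * expR c - mass xn).
  rewrite (IHn c).
  - rewrite cE subrr path_at0; last by apply: ltW; case: xn_valid.
    have -> : mass xn - mass (phase_start k x n) =
        dur (section (k + n) (phase_start k x n)).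
      by rewrite /xn mass_phase_start addrC addKr.
    exact: path_at_end.
  - by move=> m mn; apply: x_valid; exact: leqW.
  - by rewrite c0; case/andP: t0 => _; exact: le_trans.
  - rewrite cE /xn mass_phase_start lerDl.
    have [|_ _ ->] := @phase_start_section k x n x_tie x_bal.
      by move=> m mn; apply: x_valid; apply: leq_trans (ltnW mn) _; exact: leqW.
    by apply: ltW; apply: valid_dur; apply: x_valid; exact: leqW.
  - by rewrite cE lexx.
apply: (phase_unique game mu0 tie xn_valid p_sol c0 pc ct).
- by case/andP: t0.
- by rewrite cE.
- by move: tn'; rewrite mass_phase_start.
Qed.

Variables (l : R) (xi : R * R * R).
Hypotheses (rk : rho < kap) (l1 : 1 < l) (xi_step : step xi = scl l xi)
  (xi_weight : weight rho kap xi = 1) (xi_valid : valid xi).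

Let kr : kap != rho. Proof. by rewrite gt_eqF. Qed.
Let l0 : 0 < l. Proof. exact: lt_trans l1. Qed.

Lemma dur_xi : dur xi = l - 1.
Proof.
have := weight_step xi kr; rewrite xi_step weight_scl xi_weight; lra.
Qed.

Definition orb n (s : R) : state R := path_at n (base n xi 1) s.
Definition cycle : set (state R) :=
  [set x | exists n s, 0 <= s <= l - 1 /\ x = orb n s].

Lemma base3 n x m : base n.+3 x m = base n x m.
Proof. by rewrite /base !(cg_la3 game) !(cg_lb3 game). Qed.

Lemma path_at3 n x s : path_at n.+3 x s = path_at n x s.
Proof.
by rewrite /path_at /cumul /alpha !(cg_la3 game) !(cg_lb3 game).
Qed.

Lemma orb3 n s : orb n.+3 s = orb n s.
Proof. by rewrite /orb base3 path_at3. Qed.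

Lemma orb_mod n s : orb n s = orb (n %% 3) s.
Proof.
rewrite {1}(divn_eq n 3); elim: (n %/ 3)%N => [|m IHm]; first by rewrite mul0n.
by rewrite mulSn -addnA add3n orb3.
Qed.

Lemma base_next n x : 0 <= dwell kap x ->
  next n (base n x 1) = base n.+1 (step x) (1 + dur x).
Proof.
move=> e0; have [s t m b] := base_section game n x 1.
by rewrite (next_base game) ?s ?m.
Qed.

(** Section coordinates and mass are both multiplied by l: the former as [xi] is an eigenvector, the
    latter as 1 + [dur xi] = l. *)
Lemma next_orb n : next n (base n xi 1) = l *: base n.+1 xi 1.
Proof.
rewrite base_next ?ltW ?valid_dwell // xi_step dur_xi addrC subrK.
by rewrite -(baseZ game) mulr1.
Qed.

Lemma alpha_base n x m : alpha n (base n x m) = x.1.1.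
Proof. by have [s _ _ _] := base_section game n x m; rewrite -[in RHS]s. Qed.

Lemma orb0 n : orb n 0 = base n xi 1.
Proof.
rewrite /orb path_at0; last by rewrite alpha_base ltW //; case: xi_valid.
by have [_ _ -> _] := base_section game n xi 1; rewrite invr1 scale1r.
Qed.

Lemma orb_end n : orb n (l - 1) = orb n.+1 0.
Proof.
rewrite orb0 /orb -dur_xi; have [s t m b] := base_section game n xi 1.
have := path_at_end n (base n xi 1); rewrite s => ->.
by rewrite mass_next s m next_orb dur_xi addrC subrK scalerA mulVf ?gt_eqF // scale1r.
Qed.

Lemma orb_continuous n s : 0 <= s -> {for s, continuous (orb n)}.
Proof.
move=> s0; have [_ _ m _] := base_section game n xi 1.
apply: path_at_cvg; [by rewrite m gt_eqF //; lra|exact: cvg_cst|exact: cvg_id].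
Qed.

(** Translates nearness to the cycle into section coordinates: tracing [z] back to the start of its
    phase and scaling that start to mass one gives coordinates in [W]. *)
Definition tracked (W : set (R * R * R)) (z : state R) : Prop :=
  exists k x s, [/\ gamma k.+2 x = 0, balanced x, 0 < mass x,
    W (scl (mass x)^-1 (section k x)) &
    0 <= s <= dur (section k x) /\ z = path_at k x s].

Lemma back_orb n s : 0 <= s <= l - 1 ->
  [/\ elapsed la lb rho kap n (orb n s) = s / (1 + s) &
      origin la lb rho kap n (orb n s) = (1 + s)^-1 *: base n xi 1].
Proof.
move=> s01; have [sec tie m b] := base_section game n xi 1.
have s1 : 0 <= (1 + s)^-1 by rewrite invr_ge0; lra.
rewrite /orb /path_at m (elapsedZ la lb rho kap _ _ s1) (originZ la lb rho kap _ _ s1).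
by rewrite (elapsed_cumul game) // (origin_cumul game) // mulrC.
Qed.

Lemma back_cvg n s : 0 <= s <= l - 1 -> let z := orb n s in
  [/\ mass (origin la lb rho kap n y) @[y --> z] --> (1 + s)^-1,
      scl (mass (origin la lb rho kap n y))^-1
          (section n (origin la lb rho kap n y)) @[y --> z] --> xi,
      elapsed la lb rho kap n y @[y --> z] --> s / (1 + s) &
      dur (section n (origin la lb rho kap n y)) - elapsed la lb rho kap n y
        @[y --> z] --> (l - 1 - s) / (1 + s)].
Proof.
move=> s01 z; have [ez oz] := back_orb n s01.
have [sec tie m b] := base_section game n xi 1.
have o_cvg : origin la lb rho kap n y @[y --> z] --> (1 + s)^-1 *: base n xi 1.
  by rewrite -oz; exact: (@origin_continuous R la lb rho kap n).
have m_cvg : mass (origin la lb rho kap n y) @[y --> z] --> (1 + s)^-1.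
  rewrite -[X in _ --> X]mulr1 -[X in _ * X]m -massZ.
  exact: (continuous_cvg _ (@mass_continuous R _) o_cvg).
have s_cvg : section n (origin la lb rho kap n y) @[y --> z] -->
    scl (1 + s)^-1 xi.
  rewrite -[X in _ --> scl _ X]sec -sectionZ.
  exact: (continuous_cvg _ (@section_continuous R la lb rho kap n _) o_cvg).
have s10 : 1 + s != 0 by rewrite gt_eqF //; lra.
have e_cvg : elapsed la lb rho kap n y @[y --> z] --> s / (1 + s).
  by rewrite -ez; exact: (@elapsed_continuous R la lb rho kap n).
split=> //.
- have -> : xi = scl (1 + s)^-1^-1 (scl (1 + s)^-1 xi).
    by rewrite sclA mulVf ?scl1 // invr_eq0.
  by apply: scl_cvg => //; apply: cvgV => //; rewrite invr_eq0.
rewrite mulrBl; apply: cvgB => //.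
have -> : (l - 1) / (1 + s) = dur (scl (1 + s)^-1 xi).
  by rewrite dur_scl dur_xi mulrC.
exact: (continuous_cvg _ (@dur_continuous R kap _) s_cvg).
Qed.

Lemma tracked_inner W n s : nbhs xi W -> 0 < s < l - 1 ->
  \forall y \near orb n s, state_space y -> tracked W y.
Proof.
move=> WW s01; have s01' : 0 <= s <= l - 1 by lra.
have [m_cvg x_cvg e_cvg d_cvg] := back_cvg n s01'.
have s1 : 0 < (1 + s)^-1 by rewrite invr_gt0; lra.
near=> y; move=> /state_space_balanced[y1 yb].
exists n, (origin la lb rho kap n y), (elapsed la lb rho kap n y); split.
- exact: (gamma_origin game).
- exact: balanced_origin.
- by near: y; apply: (cvgr_gt _ m_cvg).
- by near: y; apply: x_cvg.
split; last by rewrite (path_origin game).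
apply/andP; split; apply: ltW.
  by near: y; apply: (cvgr_gt _ e_cvg); rewrite mulr_gt0 //; lra.
rewrite -subr_gt0; near: y.
by apply: (cvgr_gt _ d_cvg); rewrite mulr_gt0 //; lra.
Unshelve. all: by end_near. Qed.

(** Near a switch of B a state can lie on either side of the tie: the sign of [gamma n.+3 y] decides
    whether it is at the beginning of phase n + 1 or still at the end of phase n. *)
Lemma tracked_start W n : nbhs xi W ->
  \forall y \near orb n.+1 0, state_space y -> tracked W y.
Proof.
move=> WW; have l1' := l1; have l10 : 0 <= (0 : R) <= l - 1 by lra.
have l11 : 0 <= l - 1 <= l - 1 by lra.
have [m_cvg x_cvg e_cvg d_cvg] := back_cvg n.+1 l10.
have [m_cvg' x_cvg' e_cvg' d_cvg'] := back_cvg n l11.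
rewrite orb_end in m_cvg' x_cvg' e_cvg' d_cvg'.
have a_cvg : alpha n.+1 y @[y --> orb n.+1 0] --> xi.1.1.
  rewrite -[X in _ --> X](alpha_base n.+1 xi 1) -orb0.
  exact: alpha_continuous.
have a_cvg' : alpha n y @[y --> orb n.+1 0] --> (xi.1.1 - (l - 1)) / l.
  have -> : (xi.1.1 - (l - 1)) / l = alpha n (orb n.+1 0).
    rewrite -orb_end /orb /path_at alphaZ; have [_ _ -> _] := base_section game n xi 1.
    have [-> _ _] := alpha_cumul game n (base n xi 1) (l - 1).
    by rewrite alpha_base [1 + _]subrKC mulrC.
  exact: alpha_continuous.
have [d0 _ _ _ _] := xi_valid.
near=> y; move=> y_ss; have [y1 yb] := state_space_balanced y_ss.
have [g0|g0] := leP (gamma n.+3 y) 0.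
  have late0 : late lb rho n.+1 y = 0.
    rewrite /late max_l // oppr_le0 ltW //; near: y.
    exact: (cvgr_gt _ a_cvg).
  have eE : elapsed la lb rho kap n.+1 y = - gamma n.+3 y.
    by rewrite /elapsed /early late0 mulr0 subr0 addr0.
  exists n.+1, (origin la lb rho kap n.+1 y), (elapsed la lb rho kap n.+1 y); split.
  - exact: (gamma_origin game).
  - exact: balanced_origin.
  - by near: y; apply: (cvgr_gt _ m_cvg); rewrite invr_gt0; lra.
  - by near: y; apply: x_cvg.
  split; last by rewrite (path_origin game).
  rewrite {1}eE oppr_ge0 g0 /= ltW // -subr_gt0; near: y.
  by apply: (cvgr_gt _ d_cvg); rewrite divr_gt0; lra.
exists n, (origin la lb rho kap n y), (elapsed la lb rho kap n y); split.
- exact: (gamma_origin game).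
- exact: balanced_origin.
- by near: y; apply: (cvgr_gt _ m_cvg'); rewrite invr_gt0; lra.
- by near: y; apply: x_cvg'.
split; last by rewrite (path_origin game).
apply/andP; split; apply: ltW.
  by near: y; apply: (cvgr_gt _ e_cvg'); rewrite divr_gt0; lra.
set x := origin la lb rho kap n y; set s := elapsed la lb rho kap n y.
have xs : alpha n x <= s.
  have ay : alpha n y < 0.
    near: y; apply: (cvgr_lt _ a_cvg').
    have dE : xi.1.1 + dwell kap xi = l - 1 by exact: dur_xi.
    have e0 := valid_dwell xi_valid.
    by rewrite pmulr_llt0 ?invr_gt0; lra.
  by rewrite /x /s (alpha_origin game); lra.
have [gx _] := gamma_cumul2 game xs.
move: g0; rewrite (gamma3 game) -{1}(cumul_origin game n y) gx -/x /dur /dwell /=.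
by lra.
Unshelve. all: by end_near. Qed.

(** The pointwise neighbourhoods become uniform by compactness of [0, l - 1], and only three phases
    are distinct. *)
Lemma cycle_tracked W : nbhs xi W -> exists2 d, 0 < d &
  forall y, state_space y -> thickening cycle d y -> tracked W y.
Proof.
move=> WW; have l1' := l1.
have track_pt n s : 0 <= s <= l - 1 ->
    \forall y \near orb n s, state_space y -> tracked W y.
  move=> /andP[s0 sl].
  (* [tracked_start] speaks of a successor index; a shift by three turns n into one. *)
  have [->|s0'] := eqVneq s 0; first by rewrite -orb3; exact: tracked_start.
  have [->|sl'] := eqVneq s (l - 1); first by rewrite orb_end; exact: tracked_start.
  by apply: tracked_inner => //; rewrite !lt_neqAle s0 sl sl' eq_sym s0'.
have track_seg n : \forall d \near 0^'+, `[0, l - 1] `<=` (fun s =>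
    forall y, state_space y -> `|y - orb n s| < d -> tracked W y).
  have := (compact_near_coveringP _).1 (@segment_compact R 0 (l - 1)).
  apply=> s /=; rewrite in_itv /= => s01.
  have /nbhs_ballP[e /= e0 eP] := track_pt n s s01.
  have e2 : 0 < e / 2 by lra.
  have s_ge0 : 0 <= s by case/andP: s01.
  have /cvgrPdist_lt/(_ _ e2) orb_near := orb_continuous (n := n) s_ge0.
  exists ([set s' | `|orb n s - orb n s'| < e / 2], [set d | d < e / 2]).
    by split=> //=; near=> d; near: d; exact: nbhs_right_lt.
  move=> [s' d] /= [s's de] y y_ss yd; apply: eP => //.
  rewrite -ball_normE /ball_ /=; have := ler_normD (orb n s - orb n s') (orb n s' - y).
  rewrite subrKA distrC in yd *; rewrite (distrC (orb n s') y).
  by move: s's yd de; rewrite (distrC y); lra.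
have [d [d0 dP]] : exists d : R, 0 < d /\ forall n : 'I_3, `[0, l - 1] `<=` (fun s =>
    forall y, state_space y -> `|y - orb n s| < d -> tracked W y).
  have H := filter_forall (F := (0 : R)^'+) _ (fun n : 'I_3 => track_seg n).
  near (0 : R)^'+ => d; exists d; split; near: d.
    exact: nbhs_right_gt.
  exact: H.
exists d => // y y_ss [z [n [s [s01 ->]]]] yd.
rewrite orb_mod in yd.
apply: (dP (Ordinal (ltn_pmod n (isT : 0 < 3)%N)) s) => //=.
Unshelve. all: by end_near. Qed.

(** The range of s depends on x, so compactness is applied to the fixed segment [0, l], which
    contains it for x near [xi]. *)
Lemma near_cycle e : 0 < e -> \forall x \near xi, forall n s,
  0 <= s <= dur x -> thickening cycle e (path_at n (base n x 1) s).
Proof.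
move=> e0; have l1' := l1.
have near_n n : \forall x \near xi, `[0, l] `<=` (fun s =>
    0 <= s <= dur x -> thickening cycle e (path_at n (base n x 1) s)).
  apply: ((compact_near_coveringP _).1 (@segment_compact R 0 l) _ (nbhs xi)
    (fun x s => 0 <= s <= dur x -> thickening cycle e (path_at n (base n x 1) s))).
  move=> s /=; rewrite in_itv /= => s0l.
  have [sl|ls] := leP s (l - 1).
    have m1 : mass (base n xi 1) + s != 0.
      by have [_ _ -> _] := base_section game n xi 1; rewrite gt_eqF //; lra.
    have H : path_at n (base n sx.2 1) sx.1 @[sx --> (s, xi)] --> orb n s.
      apply: path_at_cvg => //; last exact: cvg_fst.
      by apply: base_cvg; [exact: cvg_snd|exact: cvg_cst].
    have /cvgrPdist_lt/(_ _ e0) [[U V] /= UV sub] := H.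
    exists (U, V) => // sx [/= Us Vx] _; exists (orb n s).
      by exists n, s; split=> //; lra.
    by have := sub sx (conj Us Vx); rewrite /= distrC.
  have dx : dur x @[x --> xi] --> l - 1.
    by rewrite -dur_xi; exact: dur_continuous.
  (* A value strictly between l - 1 and s: for nearby pairs it separates [dur x] from the time, so
     the condition on the time fails. *)
  pose m := (s + (l - 1)) / 2.
  exists ([set s' | m < s'], [set x | dur x < m]).
    have ids : s' @[s' --> s] --> s by exact: cvg_id.
    split=> /=; first by apply: (cvgr_gt _ ids); rewrite /m; lra.
    by apply: (cvgr_lt _ dx); rewrite /m; lra.
  by move=> [s' x] /= [ms xm] sx; lra.
have dx : \forall x \near xi, dur x < l.
  have H : dur x @[x --> xi] --> l - 1.
    by rewrite -dur_xi; exact: dur_continuous.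
  by apply: (cvgr_lt _ H); lra.
have H := filter_forall (F := nbhs xi) _ (fun n : 'I_3 => near_n n).
near=> x; move=> n s s_dur.
have xn : forall n : 'I_3, `[0, l] `<=` (fun s =>
    0 <= s <= dur x -> thickening cycle e (path_at n (base n x 1) s)).
    by near: x; exact: H.
have xl : dur x < l by near: x; exact: dx.
have -> : path_at n (base n x 1) s = path_at (n %% 3) (base (n %% 3) x 1) s.
  rewrite {1 2}(divn_eq n 3); elim: (n %/ 3)%N => [|m IHm]; first by rewrite mul0n.
  by rewrite mulSn -addnA add3n path_at3 base3.
apply: (xn (Ordinal (ltn_pmod n (isT : 0 < 3)%N)) s) => //=.
by rewrite in_itv /=; lra.
Unshelve. all: by end_near. Qed.

End Orbit.

Section Stability.
Context {R : realType} (A B : 'M[R]_3) (la lb : nat -> 'I_3).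
Variables (r q rho kap : R).
Hypothesis game : cyclic_game A B la lb r q rho kap.
Local Notation section := (section la lb rho kap).
Local Notation path_at := (path_at la lb rho).
Local Notation base := (base la lb rho kap).
Local Notation phase_start := (phase_start la lb rho kap).
Local Notation step := (step rho kap).
Local Notation dur := (dur kap).
Local Notation valid := (valid rho kap).
Local Notation relmass := (relmass rho kap).
Local Notation gamma := (gamma la kap).

Lemma valid_near x : valid x -> \forall y \near x, valid y.
Proof.
case=> d0 f0 g0 fd0 [s1 s2].
have c1 := @coord11_continuous R; have c2 := @coord12_continuous R.
have c3 := @coord2_continuous R; have sx := @step_continuous R rho kap x.
have fd_cvg : y.1.2 - rho * y.1.1 @[y --> x] --> x.1.2 - rho * x.1.1.
  by apply: cvgB; [exact: c2|apply: cvgM; [exact: cvg_cst|exact: c1]].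
have s1_cvg : (step y).1.1 @[y --> x] --> (step x).1.1.
  exact: (continuous_cvg _ (c1 _) sx).
have s2_cvg : (step y).2 @[y --> x] --> (step x).2.
  exact: (continuous_cvg _ (c3 _) sx).
near=> y; split.
- by near: y; exact: (cvgr_gt _ (c1 x)).
- by near: y; exact: (cvgr_gt _ (c2 x)).
- by near: y; exact: (cvgr_gt _ (c3 x)).
- by near: y; exact: (cvgr_gt _ fd_cvg).
by split; near: y; [exact: (cvgr_gt _ s1_cvg)|exact: (cvgr_gt _ s2_cvg)].
Unshelve. all: by end_near. Qed.

Lemma phase_start_normal k x n : rho < kap -> 0 < mass x ->
  gamma k.+2 x = 0 -> balanced x ->
  let x1 := scl (mass x)^-1 (section k x) in
  (forall m, (m < n)%N -> valid (iter m step x1)) ->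
  mass (phase_start k x n) = mass x * relmass n x1 /\
  (relmass n x1 != 0 -> phase_start k x n = (mass x * relmass n x1) *:
    base (k + n) (scl (relmass n x1)^-1 (iter n step x1)) 1).
Proof.
move=> rk m0 x_tie x_bal x1 x1_valid.
have secE : section k x = scl (mass x) x1.
  by rewrite /x1 sclA divff ?gt_eqF // scl1.
have x_valid m : (m < n)%N -> valid (iter m step (section k x)).
  by move=> mn; rewrite secE iter_step_scl (valid_scl _ _ _ m0); exact: x1_valid.
have massE m : (m <= n)%N -> mass (phase_start k x m) = mass x * relmass m x1.
  elim: m => [_|m IHm mn]; first by rewrite relmass0 mulr1.
  rewrite mass_phase_start (IHm (ltnW mn)) relmassS ?gt_eqF //.
  have [j jm|_ _ ->] := @phase_start_section _ _ _ _ _ _ _ _ _ game k x m x_tie x_bal.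
    by apply: x_valid; exact: ltn_trans mn.
  by rewrite secE iter_step_scl dur_scl -mulrDr.
split=> [|rel0]; first exact: massE.
have [t b s] := @phase_start_section _ _ _ _ _ _ _ _ _ game k x n x_tie x_bal x_valid.
rewrite [LHS](base_unique game t b) s massE // -(baseZ game) mulr1 sclA -mulrA.
by rewrite divff // mulr1 -iter_step_scl -secE.
Qed.

Variables (l : R) (xi : R * R * R).
Hypotheses (rk : rho < kap) (l1 : 1 < l) (xi_step : step xi = scl l xi)
  (xi_weight : weight rho kap xi = 1) (xi_valid : valid xi).
Local Notation cycle := (cycle la lb rho kap l xi).
Hypotheses (chil : chi (trc rho kap) (sec rho kap) l = 0) (trl : trc rho kap < l)
  (dom : 0 < 1 + trc rho kap * l ^+ 2).

(** Stability and attraction are proved together, as both read the solution through the same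
    normalised phase starts [y n]: these all lie in [U], and they tend to [xi]. *)
Theorem cycle_attracts e : 0 < e -> exists2 d, 0 < d &
  forall p, fp_solution A B p -> thickening cycle d (p 0) ->
    (forall t, 0 <= t -> thickening cycle e (p t)) /\
    (forall e', 0 < e' -> \forall t \near +oo, thickening cycle e' (p t)).
Proof.
move=> e0; pose close e := [set y : R * R * R | forall n s,
  0 <= s <= dur y -> thickening cycle e (path_at n (base n y 1) s)].
have close_near e' : 0 < e' -> nbhs xi (close e').
  exact: (near_cycle game rk l1 xi_step xi_weight).
(* The lower bound on [dur] makes the masses of the phase starts unbounded, so that every time
   belongs to some phase. *)
pose U := [set y : R * R * R | [/\ valid y, (l - 1) / 2 < dur y & close e y]].
have xiU : nbhs xi U.
  have d_cvg : dur y @[y --> xi] --> l - 1.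
    by rewrite -(dur_xi rk xi_step xi_weight); exact: dur_continuous.
  have H1 := valid_near xi_valid; have H2 := close_near e e0.
  near=> y; split.
  - by near: y.
  - by near: y; apply: (cvgr_gt _ d_cvg); have := l1; lra.
  - by near: y.
have kr : kap != rho by rewrite gt_eqF.
have lk : 1 + l * kap != 0.
  by rewrite gt_eqF // ltr_wpDr ?ltr01 // mulr_ge0 ?ltW ?(lt_trans _ l1) // (cg_kap game).
have W := section_attract kr lk l1 chil trl dom xi_step xi_weight xiU.
have [d d0 dP] := cycle_tracked game rk l1 xi_step xi_weight xi_valid W.
exists d => // p p_sol p0_near.
have p_ss t : 0 <= t -> state_space (p t).
  move=> t0; have [|H _ _] := p_sol (t + 1); first lra.
  by apply: H; lra.
have [k [x [s [x_tie x_bal m0 [x_all x_cvg] [s_dur p0]]]]] :=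
  dP _ (p_ss _ (lexx 0)) p0_near.
set x1 := scl (mass x)^-1 (section k x) in x_all x_cvg.
pose y n := scl (relmass n x1)^-1 (iter n step x1).
have rel0 n : 0 < relmass n x1 by case: (x_all n).
have y_valid n : [/\ valid (y n), (l - 1) / 2 < dur (y n) & close e (y n)].
  by case: (x_all n).
have x1_valid n : valid (iter n step x1).
  apply/(valid_scl rho kap (iter n step x1) (_ : 0 < (relmass n x1)^-1)).
    by rewrite invr_gt0.
  by case: (y_valid n).
have x_valid n : valid (iter n step (section k x)).
  have -> : section k x = scl (mass x) x1.
    by rewrite /x1 sclA divff ?gt_eqF // scl1.
  by rewrite iter_step_scl (valid_scl _ _ _ m0); exact: x1_valid.
have normal n := phase_start_normal (n := n) rk m0 x_tie x_bal (fun j _ => x1_valid j).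
pose M n := mass (phase_start k x n).
have ME n : M n = mass x * relmass n x1 by case: (normal n).
have M0 n : 0 < M n by rewrite ME mulr_gt0.
have durE n : M n.+1 = M n * (1 + dur (y n)).
  rewrite !ME relmassS // /y dur_scl.
  by move: (relmass n x1) (dur _) (rel0 n) => c e' c0; field; lra.
have M_lt n : M n < M n.+1.
  rewrite durE ltr_pMr // ltrDl; have [_ + _] := y_valid n.
  by have := l1; lra.
have M_mono m n : (m <= n)%N -> M m <= M n.
  by move=> /subnK <-; elim: (n - m)%N => // j /le_trans; apply; rewrite addSn ltW.
have M_large (K : R) : exists n, K < M n.
  pose h := mass x * ((l - 1) / 2).
  have h0 : 0 < h by rewrite mulr_gt0 //; have := l1; lra.
  have M_lin n : n%:R * h <= M n.
    elim: n => [|n IHn]; first by rewrite mul0r ltW.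
    have [_ dn _] := y_valid n; have Mn : mass x <= M n by exact: (@M_mono 0%N).
    rewrite durE mulrDr mulr1 mulrSr mulrDl mul1r lerD // /h.
    by apply: ler_pM => //; [exact: ltW|have := l1; lra|exact: ltW].
  exists (Num.truncn (K / h)).+1; apply: lt_le_trans (M_lin _).
  by rewrite -ltr_pdivrMr // truncnS_gt.
set mu := mass x + s.
have mu0 : 0 < mu by rewrite /mu; lra.
have locate t : 0 <= t -> exists n, M n <= mu * expR t < M n.+1.
  move=> t0; have exM : exists n, mu * expR t < M n by exact: M_large.
  case: (ex_minnP exM) => -[|n] nM n_min.
    have : mu * 1 <= mu * expR t by rewrite ler_pM2l // -expR0 ler_expR.
    by move: nM; rewrite /M /= /mu; lra.
  exists n; rewrite nM andbT leNgt; apply/negP => /n_min.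
  by rewrite ltnn.
have pathE t n : 0 <= t -> M n <= mu * expR t < M n.+1 ->
    p t = path_at (k + n) (base (k + n) (y n) 1) ((mu * expR t - M n) / M n) /\
    0 <= (mu * expR t - M n) / M n <= dur (y n).
  move=> t0 /andP[tn tn']; split; last first.
    rewrite divr_ge0 ?(ltW (M0 n)) ?subr_ge0 //= ler_pdivrMr //.
    by move: tn'; rewrite durE; lra.
  have b0 : 0 < t + 1 by lra.
  have tb : 0 <= t <= t + 1 by lra.
  rewrite (solution_track game x_tie x_bal (fun m _ => x_valid m) s_dur mu0
    (p_sol _ b0) p0 tb tn (ltW tn')) -/mu -/(M n).
  have [_ /(_ (lt0r_neq0 (rel0 n)))] := normal n; rewrite -/(y n) -ME => ->.
  rewrite -[in RHS](path_atZ la lb rho _ _ _ (M0 n)); congr path_at.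
  by rewrite [RHS]mulrCA divff ?mulr1 // gt_eqF.
split=> [t t0|e' e'0].
  have [n tn] := locate t t0; have [-> sn] := pathE t n t0 tn.
  by case: (y_valid n) => _ _; apply.
have [N _ yN] := x_cvg _ (close_near e' e'0).
near=> t; have t0 : 0 <= t by near: t; apply: nbhs_pinfty_ge; exact: num_real.
have tN : M N <= mu * expR t.
  rewrite -(mass_time mu0 (M0 N)) ler_pM2l // ler_expR; near: t.
  apply: nbhs_pinfty_ge; exact: num_real.
have [n tn] := locate t t0; have [-> sn] := pathE t n t0 tn.
apply: yN => //=; rewrite leqNgt; apply/negP => nN.
have := M_mono _ _ nN; case/andP: tn => _; lra.
Unshelve. all: by end_near. Qed.

Corollary cycle_stable : stable A B cycle.
Proof.
move=> e e0; have [d d0 dP] := cycle_attracts e0; exists d => // p p_sol p0.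
by case: (dP p p_sol p0).
Qed.

Corollary cycle_attracting : attracting A B cycle.
Proof.
split; first exact: cycle_stable.
have [d d0 dP] := cycle_attracts ltr01; exists d => // p p_sol p0.
by case: (dP p p_sol p0).
Qed.

End Stability.

(** * The periodic orbit *)

Section PeriodicOrbit.
Context {R : realType} (A B : 'M[R]_3) (la lb : nat -> 'I_3).
Variables (r q rho kap : R).
Hypothesis game : cyclic_game A B la lb r q rho kap.
Local Notation path_at := (path_at la lb rho).
Local Notation base := (base la lb rho kap).
Variables (l : R) (xi : R * R * R).
Hypotheses (rk : rho < kap) (l1 : 1 < l) (xi_step : step rho kap xi = scl l xi)
  (xi_weight : weight rho kap xi = 1) (xi_valid : valid rho kap xi)
  (xi_space : forall n, state_space (base n xi 1)).
Local Notation cycle := (cycle la lb rho kap l xi).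
Local Notation orb := (orb la lb rho kap xi).

Definition period3 : R := ln l.
(** An integer rather than a natural number: periodicity is required at negative times as well. *)
Definition phase_index (t : R) : int := Num.floor (t / ln l).
Definition orbit (t : R) : state R :=
  orb `|(phase_index t %% 3)%Z|%N (expR (t - (phase_index t)%:~R * ln l) - 1).

Lemma period3_gt0 : 0 < period3.
Proof. exact: ln_gt0. Qed.

Let l0 : 0 < l. Proof. exact: lt_trans l1. Qed.
Let tau0 : 0 < ln l. Proof. exact: period3_gt0. Qed.

Lemma phase_index_itv t : (phase_index t)%:~R * ln l <= t < ((phase_index t) + 1)%:~R * ln l.
Proof.
rewrite -ler_pdivlMr // -ltr_pdivrMr // /phase_index.
by rewrite floor_le ?floorD1_gt.
Qed.

Lemma orbit_phase n t : n%:R * ln l <= t <= n.+1%:R * ln l ->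
  orbit t = orb n (expR (t - n%:R * ln l) - 1).
Proof.
(* At the right endpoint the floor has already jumped; [orb_end] identifies the two formulas. *)
move=> /andP[nt]; rewrite le_eqVlt => /orP[/eqP tE|tn].
  have iE : phase_index t = n.+1%:Z.
    by rewrite /phase_index tE mulfK ?gt_eqF // pmulrn intrKfloor.
  have modE : `|(n.+1%:Z %% 3)%Z|%N = (n.+1 %% 3)%N by rewrite modz_nat.
  rewrite /orbit iE modE -(orb_mod game) tE -pmulrn subrr expR0 subrr.
  rewrite -(orb_end game rk l1 xi_step xi_weight xi_valid); congr (orb _ _).
  have -> : n.+1%:R * ln l - n%:R * ln l = ln l by rewrite mulrSr; ring.
  by rewrite lnK ?posrE.
have iE : phase_index t = n%:Z.
  apply/floor_def; rewrite ler_pdivlMr // ltr_pdivrMr // intrD -!pmulrn nt /=.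
  by rewrite -mulrSr.
have modE : `|(n%:Z %% 3)%Z|%N = (n %% 3)%N by rewrite modz_nat.
by rewrite /orbit iE modE -(orb_mod game) -pmulrn.
Qed.

Lemma orbit_periodic t : orbit (t + 3 * ln l) = orbit t.
Proof.
have iE : phase_index (t + 3 * ln l) = phase_index t + 3.
  rewrite /phase_index mulrDl mulfK ?gt_eqF //.
  by rewrite (_ : 3 = 3%:~R) // floorDrz ?intr_int // intrKfloor.
rewrite /orbit iE modzDr; congr (orb _ (expR _ - 1)).
by rewrite intrD; ring.
Qed.

Lemma orbit_range : range orbit = cycle.
Proof.
apply/seteqP; split=> [_ [t _ <-]|_ [n [s [s01 ->]]]].
  exists `|(phase_index t %% 3)%Z|%N, (expR (t - (phase_index t)%:~R * ln l) - 1).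
  have /andP[h1 h2] := phase_index_itv t; split=> //.
  set u := t - _; rewrite intrD in h2.
  have u0 : 1 <= expR u by rewrite -expR0 ler_expR /u; lra.
  have ul : expR u <= expR (ln l) by rewrite ler_expR /u; lra.
  by rewrite lnK ?posrE // in ul; lra.
exists (n%:R * ln l + ln (1 + s)) => //; have s1 : 0 < 1 + s by lra.
have ln0 : 0 <= ln (1 + s) by rewrite ln_ge0; lra.
have lnl : ln (1 + s) <= ln l by rewrite ler_ln ?posrE //; lra.
rewrite (orbit_phase (n := n)); last by rewrite mulrSr; lra.
by rewrite (addrC (n%:R * ln l)) addrK lnK ?posrE // addrC addKr.
Qed.

Lemma orbit_lipschitz n : lipschitz_solution A B (n%:R * ln l) orbit.
Proof.
have phase k : lipschitz_solution A B (ln l) (fun t => orbit (t + k%:R * ln l)).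
  have [s t m b] := base_section game k xi 1.
  apply: (@lipschitz_solution_ext _ _ _ _
    (fun t => path_at k (base k xi 1) (1 * expR t - mass (base k xi 1)))).
    move=> u u_tau; rewrite (orbit_phase (n := k)); last by rewrite mulrSr; lra.
    by rewrite mul1r m addrK.
  apply: (phase_solution game ltr01); rewrite ?s ?m //.
  - rewrite -/(orb k 0) (orb0 game xi_valid); exact: xi_space.
  - exact: ltW.
  by rewrite mul1r lnK ?posrE // (dur_xi rk xi_step xi_weight) addrC subrK.
have nl k : 0 <= k%:R * ln l by rewrite mulr_ge0 ?ler0n ?(ltW tau0).
elim: n => [|n IHn].
  have := phase 0%N; rewrite mul0r; under eq_fun do rewrite addr0.
  by apply: lipschitz_solutionS; exact: ltW.
by rewrite mulrSr mulrDl mul1r; apply: lipschitz_solution_cat => //; exact: ltW.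
Qed.

Lemma orbit_solution : fp_solution A B orbit.
Proof.
move=> b b0; apply: lipschitz_solution_upto.
apply: lipschitz_solutionS (orbit_lipschitz (Num.truncn (b / ln l)).+1).
by rewrite -ler_pdivrMr // ltW // truncnS_gt.
Qed.

Lemma orbit_periodic_solution : periodic_solution A B (3 * ln l) orbit.
Proof.
split; [by rewrite mulr_gt0|exact: orbit_solution|exact: orbit_periodic].
Qed.

(** B switches at the even indices, the multiples of [ln l]; A switches at the odd ones, where the
    mass has grown by [xi.1.1] within the phase. *)
Definition switch_time (n : nat) : R :=
  n./2%:R * ln l + (if odd n then ln (1 + xi.1.1) else 0).

Let d0 : 0 < xi.1.1. Proof. by case: xi_valid. Qed.

Lemma first_switch : 0 < ln (1 + xi.1.1) < ln l.
Proof.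
have e0 := valid_dwell game xi_valid.
have dE : xi.1.1 + dwell kap xi = l - 1 := dur_xi rk xi_step xi_weight.
have d0' := d0.
rewrite ln_gt0 /=; last lra.
by rewrite ltr_ln ?posrE //; lra.
Qed.

Lemma switch_time_lt n : switch_time n < switch_time n.+1.
Proof.
have := first_switch; rewrite /switch_time -uphalfE uphalf_half /=.
case: (odd n) => /=; last by rewrite add0n; lra.
by rewrite add1n mulrSr; lra.
Qed.

Lemma switch_time_oo : switch_time n @[n --> \oo] --> +oo.
Proof.
apply/cvgryPge => K; near=> n.
have h1 : (Num.truncn (K / ln l)).+1%:R * ln l <= n./2%:R * ln l.
  rewrite ler_pM2r // ler_nat geq_half_double; near: n; exact: nbhs_infty_ge.
have h2 : K <= (Num.truncn (K / ln l)).+1%:R * ln l.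
  by rewrite -ler_pdivrMr // ltW // truncnS_gt.
apply: (le_trans h2); apply: (le_trans h1); rewrite /switch_time lerDl.
by case: ifP => // _; have := first_switch; lra.
Unshelve. all: by end_near. Qed.

Lemma orbit_strategies n t : switch_time n < t < switch_time n.+1 ->
  strictA A (orbit t) (la (uphalf n)) /\ strictB B (orbit t) (lb n./2).
Proof.
have := first_switch; rewrite /switch_time -uphalfE uphalf_half /=.
set k := n./2; move=> fs; have kl : (k.+1%:R : R) = k%:R + 1 by rewrite mulrSr.
have [s tie m b] := base_section game k xi 1.
have v : valid rho kap (section la lb rho kap k (base k xi 1)) by rewrite s.
have aE : alpha lb rho k (base k xi 1) = xi.1.1 by exact: (alpha_base game).
have d0' := d0; have l0' := l0.
have dE : expR (ln (1 + xi.1.1)) = 1 + xi.1.1 by rewrite lnK ?posrE //; lra.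
have lE : expR (ln l) = l by rewrite lnK ?posrE.
case: (odd n) => /=; rewrite ?add0n ?add1n ?kl => tn.
  rewrite (orbit_phase (n := k)); last by rewrite kl; lra.
  have u1 : 1 + xi.1.1 < expR (t - k%:R * ln l) by rewrite -dE ltr_expR; lra.
  have u2 : expR (t - k%:R * ln l) < l by rewrite -[ltRHS]lE ltr_expR; lra.
  have [HA HB] := valid_strict2 game (expR (t - k%:R * ln l) - 1) tie v.
  rewrite s (dur_xi rk xi_step xi_weight) aE in HA HB.
  have mpos : 0 < mass (base k xi 1) + (expR (t - k%:R * ln l) - 1).
    by rewrite m; lra.
  split; first by apply/strictA_path => //; apply: HA; lra.
  by apply/strictB_path => //; apply: HB; lra.
rewrite (orbit_phase (n := k)); last by rewrite kl; lra.
have u1 : 1 < expR (t - k%:R * ln l).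
  by rewrite -[ltLHS]expR0 ltr_expR; lra.
have u2 : expR (t - k%:R * ln l) < 1 + xi.1.1 by rewrite -dE ltr_expR; lra.
have [HA HB] := valid_strict1 game (expR (t - k%:R * ln l) - 1) tie v.
rewrite aE in HA HB.
have mpos : 0 < mass (base k xi 1) + (expR (t - k%:R * ln l) - 1).
  by rewrite m; lra.
split; first by apply/strictA_path => //; apply: HA; lra.
by apply/strictB_path => //; apply: HB; lra.
Qed.

(** The shift [j] lets the pattern begin anywhere in the cycle. The anticlockwise one needs 5, as it
    begins in the second half of phase 2. *)
Lemma orbit_repeats (pat : seq (nat * nat)) j :
  (forall n, nth (0, 0)%N pat (n %% size pat) =
     ((la (uphalf (n + j))).+1, (lb (n + j)./2).+1)) ->
  repeats A B orbit pat.
Proof.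
move=> patE; exists (fun n => switch_time (n + j)); split.
- rewrite add0n /switch_time addr_ge0 // ?mulr_ge0 ?ler0n ?(ltW tau0) //.
  by case: ifP => // _; have := first_switch; lra.
- by move=> n; rewrite addSn; exact: switch_time_lt.
- have := switch_time_oo; rewrite -(cvg_shiftn j).
  by under eq_fun do rewrite addnC.
move=> n t tn; have [HA HB] := orbit_strategies tn.
by rewrite patE; split=> /=; [exists (la (uphalf (n + j)))|exists (lb (n + j)./2)].
Qed.

End PeriodicOrbit.

(** * The growth factor, its eigenvector and the orbit inside the simplex *)

Section Root.
Context {R : realType}.
Implicit Types T S l z : R.

(** Under either sign condition the coefficients change sign once, so by Descartes' rule l is the
    only positive root. The explicit positive cofactor [k] makes this effective. *)
Lemma chi_sign T S l z : S <= 0 \/ T <= 0 -> 0 < l -> chi T S l = 0 -> 0 < z ->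
  (z < l -> chi T S z < 0) /\ (l < z -> 0 < chi T S z).
Proof.
move=> ST l0 chil z0.
have [c [k [c0 k0 E]]] : exists c k : R, [/\ 0 < c, 0 < k & c * chi T S z = k * (z - l)].
  case: ST => [S0|T0].
    exists (l ^+ 2), (z ^+ 2 * l ^+ 2 - S * (z * l) + z + l); split.
    - by rewrite exprn_gt0.
    - have h1 : 0 < z ^+ 2 * l ^+ 2 by rewrite mulr_gt0 ?exprn_gt0.
      have h2 : 0 <= - S * (z * l) by rewrite mulr_ge0 ?oppr_ge0 // mulr_ge0 ?ltW.
      by lra.
    have : z ^+ 2 * chi T S l = 0 by rewrite chil mulr0.
    by rewrite /chi; lra.
  exists l, (z * l * (z + l) - T * (z * l) + 1); split => //.
  - have h1 : 0 < z * l * (z + l) by rewrite !mulr_gt0 ?addr_gt0.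
    have h2 : 0 <= - T * (z * l) by rewrite mulr_ge0 ?oppr_ge0 // mulr_ge0 ?ltW.
    by lra.
  have : z * chi T S l = 0 by rewrite chil mulr0.
  by rewrite /chi; lra.
split=> zl.
  by rewrite -(pmulr_rlt0 _ c0) E pmulr_rlt0 // subr_lt0.
by rewrite -(pmulr_rgt0 _ c0) E pmulr_rgt0 // subr_gt0.
Qed.

Lemma chi_continuous T S : continuous (chi T S).
Proof.
move=> z; apply: cvgB; last exact: cvg_cst.
apply: cvgD; first apply: cvgB.
- exact: exprn_continuous.
- by apply: cvgM; [exact: cvg_cst|exact: exprn_continuous].
- by apply: cvgM; [exact: cvg_cst|exact: cvg_id].
Qed.

Lemma chi_root T S : chi T S 1 < 0 -> exists2 l, 1 < l & chi T S l = 0.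
Proof.
(* A Cauchy bound for the roots: the cubic term dominates at [b]. *)
move=> chi1; pose b := 2 + `|T| + `|S|.
have T0 := normr_ge0 T; have S0 := normr_ge0 S.
have b1 : 1 <= b by rewrite /b; lra.
have chib : 0 < chi T S b.
  have h1 : T * b ^+ 2 <= `|T| * b ^+ 2 by rewrite ler_wpM2r ?sqr_ge0 // ler_norm.
  have h2 : - (`|S| * b) <= S * b.
    by rewrite -mulNr ler_wpM2r ?lerNnormlW //; lra.
  have h3 : `|S| * b <= `|S| * b ^+ 2.
    by rewrite ler_wpM2l // expr2 ler_peMl //; lra.
  have h4 : 1 <= b ^+ 2 by rewrite exprn_ege1.
  have -> : chi T S b = (b - `|T| - `|S| - 1) * b ^+ 2 + (`|T| * b ^+ 2 - T * b ^+ 2)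
     + (S * b + `|S| * b) + (`|S| * b ^+ 2 - `|S| * b) + (b ^+ 2 - 1).
    by rewrite /chi; ring.
  have -> : b - `|T| - `|S| - 1 = 1 by rewrite /b; ring.
  by lra.
have [||c] := @IVT R (chi T S) 1 b 0 b1.
- exact/continuous_subspaceT/chi_continuous.
- by rewrite min_l ?max_r ?(ltW chi1) ?(ltW chib) //; lra.
rewrite in_itv /= => /andP[c1 _] chic; exists c => //.
rewrite lt_neqAle c1 andbT; apply/eqP => cE; rewrite -cE in chic.
by rewrite chic ltxx in chi1.
Qed.

Lemma chi_trc T S l : S <= 0 \/ T <= 0 -> 1 < l -> chi T S l = 0 -> T < l.
Proof.
move=> ST l1 chil; case: ST => [S0|T0]; last lra.
have l2 : 0 < l ^+ 2 by rewrite exprn_gt0 //; lra.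
rewrite -subr_gt0 -(pmulr_rgt0 _ l2).
have -> : l ^+ 2 * (l - T) = 1 - S * l by move: chil; rewrite /chi; lra.
have : 0 <= - S * l by rewrite mulr_ge0 //; lra.
by lra.
Qed.

(** The equation reads l (l^2 + S) = 1 + T l^2. If this is at most 0, then T <= -1/l^2 and S <=
    -l^2, so S T >= 1. *)
Lemma chi_dominant T S l : 1 < l -> chi T S l = 0 -> S * T < 1 ->
  0 < 1 + T * l ^+ 2.
Proof.
move=> l1 chil ST; have l2 : 0 < l ^+ 2 by rewrite exprn_gt0 //; lra.
have [T0|T0] := leP 0 T; first by have := mulr_ge0 T0 (ltW l2); lra.
rewrite ltNge; apply/negP => dom.
have E : l * (l ^+ 2 + S) = 1 + T * l ^+ 2 by move: chil; rewrite /chi; lra.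
have : l ^+ 2 + S <= 0 by rewrite -(pmulr_rle0 _ (_ : 0 < l)) ?E //; lra.
by move=> h; have := mulr_ge0_le0 (_ : 0 <= - T) h; rewrite oppr_ge0 ltW // => /(_ isT); lra.
Qed.

Lemma chi_not_dominant T S l : 1 < l -> chi T S l = 0 -> T < 0 -> 1 < S * T ->
  1 + T * l ^+ 2 < 0.
Proof.
move=> l1 chil T0 ST; have l2 : 0 < l ^+ 2 by rewrite exprn_gt0 //; lra.
rewrite ltNge; apply/negP => dom.
have E : l * (l ^+ 2 + S) = 1 + T * l ^+ 2 by move: chil; rewrite /chi; lra.
have : 0 <= l ^+ 2 + S by rewrite -(pmulr_rge0 _ (_ : 0 < l)) ?E //; lra.
by move=> h; have := mulr_ge0 (_ : 0 <= - T) h; rewrite oppr_ge0 ltW // => /(_ isT); lra.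
Qed.

End Root.

Section Eigenvector.
Context {R : realType} (rho kap : R).

(** The second component of the eigenvalue equation is g + kap d = l f. With it the first becomes (l
    + rho) d = (1 + (1 - rho) l) f, and the normalisation [dur x = l - 1] becomes d + l f = l - 1;
    the common denominator is then 1 + l + l^2. The third component is the characteristic
    equation. *)
Definition eigvec (l : R) : R * R * R :=
  let M := 1 + l + l ^+ 2 in
  let d := (l - 1) * (1 + (1 - rho) * l) / M in
  let f := (l - 1) * (l + rho) / M in
  (d, f, l * f - kap * d).

Variable l : R.
Hypotheses (rk : rho < kap) (k0 : 0 < kap) (l1 : 1 < l)
  (chil : chi (trc rho kap) (sec rho kap) l = 0)
  (lr : 0 < l + rho) (ld : 0 < 1 + (1 - rho) * l).

Let M0 : 0 < 1 + l + l ^+ 2.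
Proof. by have := sqr_ge0 l; have := l1; lra. Qed.

Lemma eigvec_step : step rho kap (eigvec l) = scl l (eigvec l).
Proof.
have M0' : 1 + l + l ^+ 2 != 0 by rewrite gt_eqF.
rewrite /step /scl /dwell /eigvec /=; congr (_, _, _).
- by field.
- by ring.
apply: (mulfI M0'); apply/eqP; rewrite -subr_eq0; apply/eqP.
have := congr1 ( *%R ((1 - l) * 1)) chil; rewrite mulr0 => <-.
by rewrite /chi /trc /sec; field.
Qed.

(** [weight_step] turns the eigenvalue equation into (l - 1) w = [dur] = l - 1. *)
Lemma eigvec_weight : weight rho kap (eigvec l) = 1.
Proof.
have kr : kap != rho by rewrite gt_eqF.
have M0' : 1 + l + l ^+ 2 != 0 by rewrite gt_eqF.
have := weight_step (eigvec l) kr; rewrite eigvec_step weight_scl.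
have -> : dur kap (eigvec l) = l - 1 by rewrite /dur /dwell /eigvec /=; field.
have l10 : l - 1 != 0 by rewrite subr_eq0 gt_eqF.
move=> H; apply: (mulfI l10); lra.
Qed.

Lemma eigvec_valid : valid rho kap (eigvec l).
Proof.
have l1' := l1; have l0 : 0 < l by lra.
have d0 : 0 < (eigvec l).1.1 by rewrite /= divr_gt0 // mulr_gt0 //; lra.
have f0 : 0 < (eigvec l).1.2 by rewrite /= divr_gt0 // mulr_gt0 //; lra.
have D0 := quad_gt0 rho; have K0 := quad_gt0 kap.
have fd : 0 < (eigvec l).1.2 - rho * (eigvec l).1.1.
  have -> : (eigvec l).1.2 - rho * (eigvec l).1.1 =
      (l - 1) * (l * (rho ^+ 2 - rho + 1)) / (1 + l + l ^+ 2).
    by rewrite /=; field; rewrite gt_eqF.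
  by rewrite divr_gt0 // !mulr_gt0 //; lra.
have [_ _ H] := eigvec_step; rewrite /dwell in H.
have e0 : 0 < l * (eigvec l).1.2 by rewrite mulr_gt0.
have k1 : 0 < 1 + l * kap by have := mulr_gt0 l0 k0; lra.
have gE : (eigvec l).2 = l * (eigvec l).1.2 - kap * (eigvec l).1.1 by [].
(* The third component of the eigenvalue equation reads l f (l + 1 - kap) = d (1 + l kap). The same
   factor then gives the sign of the last coordinate. *)
have lk : 0 < l + 1 - kap.
  rewrite -(pmulr_rgt0 _ e0).
  have -> : l * (eigvec l).1.2 * (l + 1 - kap) = (eigvec l).1.1 * (1 + l * kap).
    move: H; rewrite /= => H; lra.
  by rewrite mulr_gt0.
have g0 : 0 < (eigvec l).2.
  rewrite -(pmulr_rgt0 _ lk).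
  have -> : (l + 1 - kap) * (eigvec l).2 = (kap ^+ 2 - kap + 1) * (eigvec l).1.1.
    move: H; rewrite /= => H; lra.
  by rewrite mulr_gt0.
by split=> //; rewrite eigvec_step /=; split; exact: mulr_gt0.
Qed.

End Eigenvector.

Section Simplex.
Context {R : realType} (A B : 'M[R]_3) (la lb : nat -> 'I_3).
Variables (r q rho kap : R).
Hypothesis game : cyclic_game A B la lb r q rho kap.
Variables (l : R) (xi : R * R * R).
Hypotheses (rk : rho < kap) (l1 : 1 < l) (xi_step : step rho kap xi = scl l xi)
  (xi_weight : weight rho kap xi = 1) (xi_valid : valid rho kap xi).
Local Notation base := (base la lb rho kap).

(* After one phase the state is multiplied by [l], up to a shift of the labels;
   this expresses its entries as geometric sums of positive terms. *)
Lemma base_positive n :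
  (forall k, 0 < (base n xi 1).1 0 k) /\ (forall k, 0 < (base n xi 1).2 k 0).
Proof.
have l1' := l1; have l0 : 0 < l by lra.
have l3 : 0 < l ^+ 3 - 1 by rewrite subr_gt0 exprn_egt1.
have d0 : 0 < xi.1.1 by case: xi_valid.
have e0 := valid_dwell game xi_valid.
have dE : xi.1.1 + dwell kap xi = l - 1 := dur_xi rk xi_step xi_weight.
have nextE := next_orb game rk xi_step xi_weight xi_valid n.
have sE : dur kap (section la lb rho kap n (base n xi 1)) = l - 1.
  by have [-> _ _ _] := base_section game n xi 1.
have aE : alpha lb rho n (base n xi 1) = xi.1.1 by exact: (alpha_base game).
have [a1 a2 a3] := la_neq game n; have [b1 b2 b3] := lb_neq game n.
have min_E : Num.min (l - 1) xi.1.1 = xi.1.1 by rewrite min_r; lra.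
have max_E : Num.max 0 (l - 1 - xi.1.1) = dwell kap xi by rewrite max_r; lra.
have [A0 A1 A2] := base1E game n xi 1; have [A0' A1' A2'] := base1E game n.+1 xi 1.
have [B0 B1 B2] := base2E game n xi 1; have [B0' B1' B2'] := base2E game n.+1 xi 1.
rewrite (cg_la3 game) in A2'; rewrite (cg_lb3 game) in B2'.
have entry1 k : (base n xi 1).1 0 k + xi.1.1 * (k == la n)%:R +
    dwell kap xi * (k == la n.+1)%:R = l * (base n.+1 xi 1).1 0 k.
  move: (congr1 (fun x : state R => x.1 0 k) nextE).
  by rewrite /next /cumul sE aE min_E max_E /= !mxE eqxx.
have entry2 k : (base n xi 1).2 k 0 + (l - 1) * (k == lb n)%:R
    = l * (base n.+1 xi 1).2 k 0.
  move: (congr1 (fun x : state R => x.2 k 0) nextE).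
  by rewrite /next /cumul sE aE min_E max_E /= !mxE !andbT -dE => <-; ring.
have := entry1 (la n); have := entry1 (la n.+1); have := entry1 (la n.+2).
have := entry2 (lb n); have := entry2 (lb n.+1); have := entry2 (lb n.+2).
rewrite !eqxx (eq_sym (la n.+1)) !(eq_sym (la n.+2)) a1 a2 a3.
rewrite (eq_sym (lb n.+1)) !(eq_sym (lb n.+2)) b1 b2.
rewrite A0' A1' A2' B0' B1' B2' -A0 -A1 -A2 -B0 -B1 -B2.
rewrite !(mulr1, mulr0, addr0).
set x0 := (base n xi 1).1 0 (la n); set x1 := (base n xi 1).1 0 (la n.+1).
set x2 := (base n xi 1).1 0 (la n.+2); set y0 := (base n xi 1).2 (lb n) 0.
set y1 := (base n xi 1).2 (lb n.+1) 0; set y2 := (base n xi 1).2 (lb n.+2) 0.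
move=> Y2 Y1 Y0 X2 X1 X0.
have y00 : 0 < y0.
  rewrite -(pmulr_rgt0 _ l3); have -> : (l ^+ 3 - 1) * y0 = l - 1.
    have : l * (l * (l * y0)) = l * (l * y1) by congr (_ * (_ * _)); lra.
    have : l * (l * y1) = l * y2 by congr (_ * _); lra.
    by lra.
  by lra.
have y10 : 0 < y1 by have := mulr_gt0 l0 y00; lra.
have y20 : 0 < y2 by have := mulr_gt0 l0 y10; lra.
have x10 : 0 < x1.
  rewrite -(pmulr_rgt0 _ l3).
  have -> : (l ^+ 3 - 1) * x1 = dwell kap xi + l * xi.1.1.
    have : l * (l * (l * x1)) = l * (l * x2) by congr (_ * (_ * _)); lra.
    have : l * (x0 + xi.1.1) = l * (l * x2) by congr (_ * _); lra.
    by lra.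
  by have := mulr_gt0 l0 d0; lra.
have x20 : 0 < x2 by have := mulr_gt0 l0 x10; lra.
have x00 : 0 < x0 by rewrite -(pmulr_rgt0 _ l0); lra.
split=> k.
  by case: (ord3_cover k (cg_la_uniq game n)) => ->.
by case: (ord3_cover k (cg_lb_uniq game n)) => ->.
Qed.

Lemma base_state_space n x : (forall k, 0 <= (base n x 1).1 0 k) ->
  (forall k, 0 <= (base n x 1).2 k 0) -> state_space (base n x 1).
Proof.
move=> x1 x2; have [_ _ m b] := base_section game n x 1.
by apply: state_spaceP => //; rewrite -[RHS]m -?b.
Qed.

Lemma base_xi_space n : state_space (base n xi 1).
Proof.
by have [p1 p2] := base_positive n; apply: base_state_space => k; exact: ltW.
Qed.

End Simplex.

(** * The return map *)

Section ScaledLinear.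
Context {R : realType} (n : nat).

Lemma mulmxr_bound (K : 'M[R]_n) (s : 'rV[R]_n) :
  `|s *m K| <= (\sum_i \sum_j `|K i j|) * `|s|.
Proof.
have C0 : 0 <= \sum_i \sum_j `|K i j|.
  by apply: sumr_ge0 => i _; apply: sumr_ge0.
apply: mx_norm_le => [|i j]; first by rewrite mulr_ge0.
rewrite ord1 mxE; apply: (le_trans (ler_norm_sum _ _ _)).
rewrite mulr_suml; apply: ler_sum => k _; rewrite normrM mulrC.
apply: ler_pM => //; last exact: mx_entry_le.
by rewrite (bigD1 j) //= lerDl sumr_ge0.
Qed.

(** Continuity of [h] at 0 is enough: the linear factor vanishes there, so the variation of [h]
    contributes only a term of higher order. *)
Lemma scaled_linear_jacobian (h : 'rV[R]_n -> R) (K : 'M[R]_n) :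
  {for 0, continuous h} ->
  differentiable (fun s : 'rV[R]_n => h s *: (s *m K)) (0 : 'rV[R]_n) /\
  jacobian (fun s : 'rV[R]_n => h s *: (s *m K)) (0 : 'rV[R]_n) = h 0 *: K.
Proof.
move=> h_cont; pose P := fun s : 'rV[R]_n => h s *: (s *m K).
pose D : {linear 'rV[R]_n -> 'rV[R]_n} := mulmxr (h 0 *: K).
set C := \sum_i \sum_j `|K i j|.
have C0 : 0 <= C by apply: sumr_ge0 => i _; apply: sumr_ge0.
have D_cont : continuous D.
  set C' := \sum_i \sum_j `|(h 0 *: K) i j|.
  have C'0 : 0 <= C' by apply: sumr_ge0 => i _; apply: sumr_ge0.
  move=> x; apply/(@cvgrPdist_lt _ _ _ _ (nbhs_filter x)) => e e0.
  have e' : 0 < e / (C' + 1) by rewrite divr_gt0 //; lra.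
  have xe := nbhsx_ballx x _ e'; rewrite -ball_normE in xe.
  near=> y; rewrite -raddfB /=; apply: (le_lt_trans (mulmxr_bound _ _)).
  have xy : `|x - y| < e / (C' + 1).
    by near: y; exact: xe.
  rewrite ltr_pdivlMr in xy; last lra.
  by rewrite -/C'; have := normr_ge0 (x - y); lra.
have P_lin : P \o shift 0 = cst (P 0) + D +o_ (0 : 'rV[R]_n) id.
  apply/eqaddoP => e e0; near=> s.
  have -> : (P \o shift 0 - (cst (P 0) + D)) s = (h s - h 0) *: (s *m K).
    rewrite !fctE /= /P /shift /= addr0 mul0mx scaler0 add0r scalerBl.
    by rewrite -scalemxAr.
  rewrite normrZ; apply: (@le_trans _ _ ((e / (C + 1)) * (C * `|s|))).
    apply: ler_pM => //; last exact: mulmxr_bound.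
    rewrite distrC ltW //; near: s; move/cvgrPdist_lt: h_cont; apply.
    by rewrite divr_gt0 //; lra.
  rewrite mulrA ler_wpM2r //= mulrAC ler_pdivrMr ?ler_pM2l //; lra.
have dE : 'd P (0 : 'rV[R]_n) = D :> ('rV[R]_n -> 'rV[R]_n).
  exact: diff_unique.
split; first by apply/diff_locallyP; split; rewrite dE.
apply/row_matrixP => i; rewrite !rowE /jacobian mul_rV_lin1 dE /D /=.
by [].
Unshelve. all: by end_near. Qed.

End ScaledLinear.

Section ThreeEigenvalues.
Context {R : realType} (L : 'M[R]_3) (a b c : R).
Hypotheses (La : eigenvalue L a) (Lb : eigenvalue L b) (Lc : eigenvalue L c)
  (ab : a != b) (ac : a != c) (bc : b != c).

Lemma complex_eigenvalue_real z : eigenvalue L z -> complex_eigenvalue L (z%:C)%C.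
Proof.
rewrite /complex_eigenvalue !eigenvalue_root_char -map_char_poly.
by move=> Lz; rewrite fmorph_root.
Qed.

(** Three distinct real roots exhaust a characteristic polynomial of degree three, over the complex
    numbers too. *)
Lemma complex_eigenvalue3 (z : R[i]) : complex_eigenvalue L z ->
  [\/ z = (a%:C)%C, z = (b%:C)%C | z = (c%:C)%C].
Proof.
rewrite /complex_eigenvalue eigenvalue_root_char -map_char_poly.
have sz : size (char_poly L) = 4%N by rewrite size_char_poly.
have roots : all (root (char_poly L)) [:: a; b; c].
  by rewrite /= -!eigenvalue_root_char La Lb Lc.
have uniq_abc : uniq_roots [:: a; b; c].
  by rewrite uniq_rootsE /= !inE negb_or ab ac bc.
rewrite (@all_roots_prod_XsubC _ _ [:: a; b; c] sz roots uniq_abc).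
rewrite (monicP (char_poly_monic L)) scale1r !big_cons big_nil mulr1.
rewrite !rmorphM /= !map_polyXsubC !rootM !root_XsubC.
by move=> /or3P[] /eqP->; [constructor 1|constructor 2|constructor 3].
Qed.

End ThreeEigenvalues.

Lemma normc_real (R : realType) (x : R) : `|(x%:C)%C| = (`|x|%:C)%C.
Proof. by rewrite normc_def /= expr0n /= addr0 sqrtr_sqr. Qed.

Section Triples.
Context {R : realType}.
Implicit Types (x y : R * R * R) (s : 'rV[R]_3).

Definition tri s : R * R * R := (s 0 0, s 0 1, s 0 2%:R).
Definition vec x : 'rV[R]_3 := \row_j nth 0 [:: x.1.1; x.1.2; x.2] j.

Lemma triK : cancel tri vec.
Proof.
move=> s; apply/rowP => j; rewrite mxE /tri /=.
by case: j => [[|[|[|//]]] j3] /=; congr (s _ _); apply: val_inj.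
Qed.

Lemma vecK : cancel vec tri.
Proof. by move=> [[x1 x2] x3]; rewrite /tri !mxE. Qed.

Lemma triD s t : tri (s + t) = tri s + tri t.
Proof. by rewrite /tri !mxE. Qed.
Lemma triZ a s : tri (a *: s) = scl a (tri s).
Proof. by rewrite /tri /scl !mxE. Qed.
Lemma tri0 : tri 0 = 0.
Proof. by rewrite /tri !mxE. Qed.

Lemma vecD x y : vec (x + y) = vec x + vec y.
Proof. by apply: (can_inj triK); rewrite triD !vecK. Qed.
Lemma vecZ a x : vec (scl a x) = a *: vec x.
Proof. by apply: (can_inj triK); rewrite triZ !vecK. Qed.

Lemma tri_continuous : continuous tri.
Proof.
move=> s; have c i : (fun t : 'rV[R]_3 => t 0 i) @ s --> s 0 i.
  exact: (@coord_continuous R 1 3 0 i s).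
exact: (triple_cvg (nbhs_filter s) (c _) (c _) (c _)).
Qed.

Lemma sclDr a x y : scl a (x + y) = scl a x + scl a y.
Proof.
by case: x y => [[x1 x2] x3] [[y1 y2] y3]; rewrite /scl /=; congr (_, _, _); exact: mulrDr.
Qed.
Lemma sclDl a b x : scl (a + b) x = scl a x + scl b x.
Proof.
by case: x => [[x1 x2] x3]; rewrite /scl /=; congr (_, _, _); exact: mulrDl.
Qed.
Lemma scl0 x : scl 0 x = 0.
Proof. by case: x => [[x1 x2] x3]; rewrite /scl /= !mul0r. Qed.

Variables rho kap : R.
Lemma stepD x y : step rho kap (x + y) = step rho kap x + step rho kap y.
Proof.
case: x y => [[x1 x2] x3] [[y1 y2] y3].
by rewrite /step /dwell /=; congr (_, _, _); rewrite /=; ring.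
Qed.
Lemma iter_stepD n x y : iter n (step rho kap) (x + y) =
  iter n (step rho kap) x + iter n (step rho kap) y.
Proof. by elim: n => //= n ->; rewrite stepD. Qed.
Lemma weightD x y : weight rho kap (x + y) = weight rho kap x + weight rho kap y.
Proof. by rewrite /weight /=; ring. Qed.

End Triples.

Lemma linear_rows (R : realType) (m n : nat) (f : 'rV[R]_m -> 'rV[R]_n) s :
  linear f -> s *m (\matrix_i f (delta_mx 0 i)) = f s.
Proof.
move=> f_lin; have f0 : f 0 = 0.
  have := f_lin 1 0 0; rewrite !scale1r addr0 => /eqP.
  by rewrite eq_sym -subr_eq0 addrK => /eqP.
rewrite mulmx_sum_row [in RHS](row_sum_delta s).
have fD x y : f (x + y) = f x + f y by have := f_lin 1 x y; rewrite !scale1r.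
rewrite (big_morph f fD f0); apply: eq_bigr => i _; rewrite rowK.
by have := f_lin (s 0 i) (delta_mx 0 i) 0; rewrite !addr0 f0 addr0.
Qed.

Section Saddle.
Context {R : realType} (A B : 'M[R]_3) (la lb : nat -> 'I_3).
Variables (r q rho kap : R).
Hypothesis game : cyclic_game A B la lb r q rho kap.
Local Notation alpha := (alpha lb rho).
Local Notation gamma := (gamma la kap).
Local Notation section := (section la lb rho kap).
Local Notation path_at := (path_at la lb rho).
Local Notation base := (base la lb rho kap).
Local Notation phase_start := (phase_start la lb rho kap).
Local Notation step := (step rho kap).
Local Notation dur := (dur kap).
Local Notation valid := (valid rho kap).
Local Notation relmass := (relmass rho kap).
Local Notation weight := (weight rho kap).
Hypothesis rk : rho < kap.

Let kr : kap != rho. Proof. by rewrite gt_eqF. Qed.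

Definition ratio n x := scl (relmass n x)^-1 (iter n step x).

Lemma base_phase x n : (forall m, (m < n)%N -> valid (iter m step x)) ->
  [/\ mass (phase_start 0 (base 0 x 1) n) = relmass n x,
      gamma n.+2 (phase_start 0 (base 0 x 1) n) = 0,
      section n (phase_start 0 (base 0 x 1) n) = iter n step x &
      relmass n x != 0 -> phase_start 0 (base 0 x 1) n =
        relmass n x *: base n (ratio n x) 1].
Proof.
move=> x_valid; have [s t m b] := base_section game 0 x 1.
have m0 : 0 < mass (base 0 x 1) by rewrite m ltr01.
have xE : scl (mass (base 0 x 1))^-1 (section 0 (base 0 x 1)) = x.
  by rewrite m s invr1 scl1.
have := @phase_start_normal _ _ _ _ _ _ _ _ _ game 0 (base 0 x 1) n rk m0 t b.
rewrite /= xE m !mul1r => /(_ x_valid)[mE XE].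
have x_valid' j : (j < n)%N -> valid (iter j step (section 0 (base 0 x 1))).
  by rewrite s; exact: x_valid.
have := @phase_start_section _ _ _ _ _ _ _ _ _ game 0 (base 0 x 1) n t b x_valid'.
by rewrite add0n s => -[tie _ sec]; split.
Qed.

Lemma relmass_le x n m : (forall j, (j < n)%N -> valid (iter j step x)) ->
  (m <= n)%N -> relmass m x <= relmass n x.
Proof.
elim: n => [|n IHn] x_valid; first by rewrite leqn0 => /eqP->.
rewrite leq_eqVlt => /orP[/eqP->//|]; rewrite ltnS => mn.
apply: (le_trans (IHn _ mn)); first by move=> j jn; apply: x_valid; exact: leqW.
by rewrite relmassS // lerDl ltW // (valid_dur game) //; exact: x_valid.
Qed.

Lemma relmass_ge1 x n : (forall j, (j < n)%N -> valid (iter j step x)) ->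
  1 <= relmass n x.
Proof. by move=> x_valid; rewrite -(relmass0 rho kap x) relmass_le. Qed.

Lemma base_path0 n x : 0 <= x.1.1 -> path_at n (base n x 1) 0 = base n x 1.
Proof.
move=> x0; rewrite path_at0 ?(alpha_base game) //.
by have [_ _ -> _] := base_section game n x 1; rewrite invr1 scale1r.
Qed.

Lemma base_track_from b p x s0 n t :
  (forall m, (m <= n)%N -> valid (iter m step x)) -> 0 <= s0 <= dur x ->
  fp_solution_upto A B b p -> p 0 = path_at 0 (base 0 x 1) s0 -> 0 <= t <= b ->
  relmass n x <= (1 + s0) * expR t <= relmass n.+1 x ->
  p t = path_at n (base n (ratio n x) 1) ((1 + s0) * expR t / relmass n x - 1).
Proof.
move=> x_valid s0d p_sol p0 tb /andP[tn tn'].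
have [s tie m bal] := base_section game 0 x 1.
have [mE _ secE XE] := @base_phase x n (fun j jn => x_valid j (ltnW jn)).
have [mE' _ _ _] := @base_phase x n.+1 x_valid.
have rel0 : 0 < relmass n x.
  apply: (lt_le_trans ltr01); apply: relmass_ge1 => j jn.
  by apply: x_valid; exact: ltnW.
have x_valid' j : (j <= n)%N -> valid (iter j step (section 0 (base 0 x 1))).
  by rewrite s; exact: x_valid.
have s0d' : 0 <= s0 <= dur (section 0 (base 0 x 1)) by rewrite s.
have mu0 : 0 < mass (base 0 x 1) + s0 by rewrite m; lra.
have := solution_track game tie bal x_valid' s0d' mu0 p_sol p0 tb.
rewrite m mE mE' add0n => -> //.
rewrite XE ?gt_eqF // -[in RHS](path_atZ la lb rho _ _ _ rel0).
by congr (path_at n _ _); rewrite mulrBr mulr1 mulrCA divff ?gt_eqF // mulr1.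
Qed.

Lemma base_track b p x n t : (forall m, (m <= n)%N -> valid (iter m step x)) ->
  fp_solution_upto A B b p -> p 0 = base 0 x 1 -> 0 <= t <= b ->
  relmass n x <= expR t <= relmass n.+1 x ->
  p t = path_at n (base n (ratio n x) 1) (expR t / relmass n x - 1).
Proof.
move=> x_valid p_sol p0 tb tn.
have x0 : valid x by exact: (x_valid 0%N).
have x0' : 0 <= x.1.1 by apply: ltW; case: x0.
have := @base_track_from b p x 0 n t x_valid.
rewrite addr0 mul1r; apply=> //; last by rewrite p0 base_path0.
by rewrite lexx ltW // (valid_dur game).
Qed.

(** Supplies the existence part of [return_map]: the explicit phases are concatenated, each starting
    at the state where [base_track] shows that the previous one ends. *)
Lemma phases_solution x n : (forall m, (m <= n)%N -> valid (iter m step x)) ->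
  state_space (base 0 x 1) -> exists p,
    lipschitz_solution A B (ln (relmass n.+1 x)) p /\ p 0 = base 0 x 1.
Proof.
move=> x_valid x_ss; have x0 : 0 <= x.1.1 by apply: ltW; case: (x_valid 0%N isT).
elim: n x_valid => [|n IHn] x_valid.
  have [s tie m bal] := base_section game 0 x 1.
  exists (fun t => path_at 0 (base 0 x 1) (1 * expR t - mass (base 0 x 1))).
  have d1 : 0 < relmass 1 x.
    apply: (lt_le_trans ltr01); apply: relmass_ge1 => -[] // _.
    exact: (x_valid 0%N).
  split; last by rewrite m expR0 mulr1 subrr base_path0.
  apply: (phase_solution game ltr01); rewrite ?s ?m //.
  - exact: (x_valid 0%N).
  - by rewrite base_path0.
  - rewrite ln_ge0 //; apply: relmass_ge1 => -[] // _; exact: (x_valid 0%N).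
  - by rewrite mul1r lnK ?posrE // relmassS // relmass0.
have [|p [p_lip p0]] := IHn; first by move=> m mn; apply: x_valid; exact: leqW.
have rel1 : 1 <= relmass n.+1 x.
  by apply: relmass_ge1 => j jn; apply: x_valid; exact: ltnW.
have rel12 : relmass n.+1 x <= relmass n.+2 x by apply: relmass_le.
have [mE tie secE XE] := @base_phase x n.+1 (fun j jn => x_valid j (ltnW jn)).
set X := phase_start 0 (base 0 x 1) n.+1 in mE tie secE XE.
have rel0 : 0 < relmass n.+1 x by exact: lt_le_trans rel1.
have X_valid : valid (section n.+1 X) by rewrite secE; exact: x_valid.
have aX : 0 <= alpha n.+1 X by apply: ltW; case: X_valid.
set b1 := ln (relmass n.+1 x) in p_lip *.
set b2 := ln (relmass n.+2 x / relmass n.+1 x).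
have b10 : 0 <= b1 by rewrite ln_ge0.
have b20 : 0 <= b2 by rewrite ln_ge0 // ler_pdivlMr // mul1r.
have b1E : expR b1 = relmass n.+1 x by rewrite lnK ?posrE.
have b2E : expR b2 = relmass n.+2 x / relmass n.+1 x.
  by rewrite lnK ?posrE ?divr_gt0 // (lt_le_trans rel0).
have bE : ln (relmass n.+2 x) = b1 + b2.
  by apply: expR_inj; rewrite expRD b1E b2E mulrC divfK ?gt_eqF // lnK ?posrE // (lt_le_trans rel0).
have pb1 : p b1 = path_at n.+1 X 0.
  have rel_n : 0 < relmass n x.
    apply: (lt_le_trans ltr01); apply: relmass_ge1 => j jn.
    by apply: x_valid; apply: leq_trans (ltnW jn) _; exact: leqW.
  have [_ _ secE' XE'] := @base_phase x n
    (fun j jn => x_valid j (leq_trans (ltnW jn) (leqnSn n))).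
  rewrite (@base_track b1 p x n) //.
  - rewrite b1E; set y := base n (ratio n x) 1.
    have sy : section n y = ratio n x by have [-> _ _ _] := base_section game n (ratio n x) 1.
    have -> : relmass n.+1 x / relmass n x - 1 = dur (section n y).
      by rewrite relmassS // sy /ratio dur_scl; field; rewrite gt_eqF.
    rewrite path_at_end path_at0 // /X /= add0n XE' ?gt_eqF // -/y.
    rewrite /next sectionZ dur_scl cumulZ ?ltW // massZ invfM scalerA mulrAC.
    by rewrite mulVf ?gt_eqF // mul1r.
  - by move=> m mn; apply: x_valid; exact: leqW.
  - exact: lipschitz_solution_upto.
  - by rewrite b10 lexx.
  - rewrite b1E lexx andbT; apply: relmass_le => // j jn.
    by apply: x_valid; exact: ltnW.
pose p' t := path_at n.+1 X (mass X * expR t - mass X).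
have p'0 : p' 0 = path_at n.+1 X 0 by rewrite /p' expR0 mulr1 subrr.
have mX : 0 < mass X by rewrite mE.
have p'_lip : lipschitz_solution A B b2 p'.
  apply: (phase_solution game mX) => //.
    by rewrite -pb1; case: p_lip => + _ _; apply; rewrite b10 lexx.
  rewrite b2E mE secE -relmassS // mulrC divfK ?gt_eqF //.
exists (fun t => if t <= b1 then p t else p' (t - b1)); rewrite b10; split=> //.
rewrite bE; apply: lipschitz_solution_cat => //.
  by apply: lipschitz_solution_ext p_lip => t /andP[_ ->].
apply: lipschitz_solution_ext p'_lip => t /andP[t0 _].
rewrite addrK; case: (leP (t + b1) b1) => // tb.
have -> : t = 0 by lra.
by rewrite add0r p'0 pb1.
Qed.

End Saddle.

Section OtherRoots.
Context {R : realType}.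

(** The quadratic cofactor z^2 + (l - T) z + 1/l has positive coefficients, so its real roots are
    negative; it is negative at -l, so they are real and lie on either side of -l. *)
Lemma other_roots (T S l : R) : 1 < l -> chi T S l = 0 -> T < l ->
  1 + T * l ^+ 2 < 0 ->
  exists z2 z3, [/\ chi T S z2 = 0, chi T S z3 = 0, z2 < - l & - l < z3 < 0].
Proof.
move=> l1 chil Tl dom; have l0 : 0 < l by lra.
pose b := l - T; have b0 : 0 < b by rewrite /b; lra.
pose D := b ^+ 2 - 4 / l.
have SE : S = l^-1 - l * b.
  apply: (mulfI (lt0r_neq0 l0)); rewrite mulrBr divff ?gt_eqF // /b.
  by move: chil; rewrite /chi; lra.
have D_large : (b - 2 * l) ^+ 2 < D.
  rewrite -subr_gt0; have -> : D - (b - 2 * l) ^+ 2 = - (4 * (1 + T * l ^+ 2)) / l.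
    by rewrite /D /b; field; lra.
  by rewrite divr_gt0 //; lra.
have D0 : 0 < D by apply: le_lt_trans D_large; exact: sqr_ge0.
pose s := Num.sqrt D; have s0 : 0 < s by rewrite sqrtr_gt0.
have sE : s ^+ 2 = D by rewrite sqr_sqrtr // ltW.
have s_large : `|b - 2 * l| < s.
  by rewrite -(@ltr_pXn2r _ 2) ?nnegrE ?(ltW s0) // real_normK ?num_real // sE.
have s_small : s < b.
  rewrite -(@ltr_pXn2r _ 2) ?nnegrE ?(ltW s0) ?(ltW b0) // sE /D.
  by rewrite ltrBlDr ltrDl divr_gt0.
have root z : z ^+ 2 + b * z + l^-1 = 0 -> chi T S z = 0.
  move=> qz; have -> : chi T S z = (z - l) * (z ^+ 2 + b * z + l^-1).
    by rewrite /chi SE /b; field; lra.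
  by rewrite qz mulr0.
have DE : l^-1 = (b ^+ 2 - s ^+ 2) / 4 by rewrite sE /D; field; lra.
rewrite ltr_norml in s_large.
exists ((- b - s) / 2), ((- b + s) / 2); split; try lra.
- by apply: root; rewrite DE; field.
- by apply: root; rewrite DE; field.
Qed.

(** Scaled so that the third component is independent of z and never zero, which shows at once that
    the eigenvector does not vanish. *)
Lemma root_eigvec (rho kap z : R) : z != 0 ->
  chi (trc rho kap) (sec rho kap) z = 0 ->
  let x := (z + 1 - kap, kap + z^-1, kap ^+ 2 - kap + 1) in
  step rho kap x = scl z x.
Proof.
move=> z0 chiz; rewrite /step /scl /dwell /=; congr (_, _, _).
- apply: (mulfI z0); apply/eqP; rewrite -subr_eq0; apply/eqP.
  by rewrite -[RHS]oppr0 -chiz /chi /trc /sec; field.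
- by field.
- by ring.
Qed.

End OtherRoots.

Section SaddleOrbit.
Context {R : realType} (A B : 'M[R]_3) (la lb : nat -> 'I_3).
Variables (r q rho kap : R).
Hypothesis game : cyclic_game A B la lb r q rho kap.
Local Notation alpha := (alpha lb rho).
Local Notation gamma := (gamma la kap).
Local Notation section := (section la lb rho kap).
Local Notation path_at := (path_at la lb rho).
Local Notation base := (base la lb rho kap).
Local Notation step := (step rho kap).
Local Notation dur := (dur kap).
Local Notation valid := (valid rho kap).
Local Notation relmass := (relmass rho kap).
Local Notation weight := (weight rho kap).
Local Notation ratio := (ratio rho kap).
Variables (l : R) (xi : R * R * R).
Hypotheses (rk : rho < kap) (l1 : 1 < l) (xi_step : step xi = scl l xi)
  (xi_weight : weight xi = 1) (xi_valid : valid xi).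
Local Notation orbit := (orbit la lb rho kap l xi).

Let l0 : 0 < l. Proof. exact: lt_trans l1. Qed.
Let d0 : 0 < xi.1.1. Proof. by case: xi_valid. Qed.

Lemma baseD n x y m m' : base n (x + y) (m + m') = base n x m + base n y m'.
Proof.
have [s1 t1 m1 b1] := base_section game n x m.
have [s2 t2 m2 b2] := base_section game n y m'.
rewrite [RHS](@base_unique _ _ _ _ _ _ _ _ _ game n).
- have -> : section n (base n x m + base n y m') = x + y.
    rewrite -[in RHS]s1 -[in RHS]s2 /section !alphaD gammaD opprD.
    by [].
  by rewrite massD m1 m2.
- by rewrite gammaD t1 t2 addr0.
- by rewrite /balanced massAD massD b1 b2.
Qed.

(* The orbit is cut half-way through the first step of a phase, by the
   hyperplane of the states whose section coordinates are arbitrary. *)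
Definition cut : R := xi.1.1 / 2.
Definition cut_time : R := ln (1 + cut).
(** Rows are the derivatives of the halfway state with respect to the section coordinates. They have
    mass zero and lie in the kernel of [gamma 2], so [gamma 2] is constant on the section. *)
Definition cut_dirs : 'M[R]_(3, 3 + 3) :=
  row_mx (\matrix_i ((1 + cut)^-1 *: base 0 (tri (delta_mx 0 i)) 0).1)
         (\matrix_i (((1 + cut)^-1 *: base 0 (tri (delta_mx 0 i)) 0).2)^T).

Let cut0 : 0 < cut. Proof. by rewrite divr_gt0 ?d0. Qed.

Lemma cut_lin s : section_lin cut_dirs s = (1 + cut)^-1 *: base 0 (tri s) 0.
Proof.
have baseL a (x y : 'rV[R]_3) : (1 + cut)^-1 *: base 0 (tri (a *: x + y)) 0 =
    a *: ((1 + cut)^-1 *: base 0 (tri x) 0) + (1 + cut)^-1 *: base 0 (tri y) 0.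
  rewrite triD triZ -{1}(addr0 0) baseD -{1}(mulr0 a) (baseZ game) scalerDr.
  by rewrite !scalerA mulrC.
rewrite /section_lin /cut_dirs row_mxKl row_mxKr.
rewrite (linear_rows (f := fun s => ((1 + cut)^-1 *: base 0 (tri s) 0).1)); last first.
  by move=> a x y /=; have := congr1 fst (baseL a x y).
rewrite (linear_rows (f := fun s => (((1 + cut)^-1 *: base 0 (tri s) 0).2)^T)); last first.
  move=> a x y /=; have /= -> := congr1 snd (baseL a x y).
  by rewrite linearD linearZ.
by rewrite trmxK -surjective_pairing.
Qed.

Lemma orbit_cut : orbit cut_time = path_at 0 (base 0 xi 1) cut.
Proof.
have c0 := cut0; have c1 : 1 + cut < l.
  have := dur_xi rk xi_step xi_weight; rewrite /dur => dE.
  by have := valid_dwell game xi_valid; have := d0; rewrite /cut; lra.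
have cE : expR cut_time = 1 + cut by rewrite lnK // posrE; lra.
rewrite (orbit_phase game rk l1 xi_step xi_weight xi_valid (n := 0)).
  by rewrite mul0r subr0 cE /orb; congr (path_at 0 _ _); ring.
rewrite mul0r mul1r ln_ge0 /=; last lra.
by rewrite ler_ln ?posrE //; lra.
Qed.

Definition cut_state s : state R := orbit cut_time + section_lin cut_dirs s.

(** As long as A has not switched, [cumul] adds a fixed vector, so the halfway state depends
    affinely on the section coordinates. *)
Lemma cut_stateE s : cut <= (xi + tri s).1.1 ->
  cut_state s = path_at 0 (base 0 (xi + tri s) 1) cut.
Proof.
move=> cs; rewrite /cut_state orbit_cut cut_lin /path_at.
have [_ _ m1 _] := base_section game 0 xi 1.
have [_ _ m2 _] := base_section game 0 (xi + tri s) 1.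
rewrite m1 m2 -scalerDr /cumul !(alpha_base game) !min_l //; last first.
  by have := d0; rewrite /cut; lra.
rewrite !max_l ?subr_le0 //; last by have := d0; rewrite /cut; lra.
rewrite !scale0r !addr0 -[X in base 0 (xi + tri s) X](addr0 1) baseD.
by congr (_ *: _); rewrite addrAC.
Qed.

Lemma cut_derive : is_derive cut_time 1 orbit
  (vertex (la 0) (lb 0) - orbit cut_time).
Proof.
have [s tie m b] := base_section game 0 xi 1.
have c0 := cut0; have d0' := d0.
have dE : xi.1.1 + dwell kap xi = l - 1 := dur_xi rk xi_step xi_weight.
have e0 := valid_dwell game xi_valid.
have orbE t : 0 < t < ln (1 + xi.1.1) ->
    orbit t = go (vertex (la 0) (lb 0)) (base 0 xi 1) t.
  move=> t01; have ld : ln (1 + xi.1.1) < ln l by rewrite ltr_ln ?posrE //; lra.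
  have l0' := l0.
  have te : expR t <= 1 + xi.1.1.
    by rewrite -(@lnK _ (1 + xi.1.1)) ?posrE ?ler_expR; lra.
  rewrite (orbit_phase game rk l1 xi_step xi_weight xi_valid (n := 0)).
    rewrite mul0r subr0 /orb -[in RHS](subr0 t).
    have := @go_path1 _ la lb rho 0 (base 0 xi 1) 1 0 t ltr01.
    rewrite !mul1r m (alpha_base game) expR0 subrr (base_path0 game) ?(ltW d0) //.
    by move=> <- //; lra.
  by rewrite mul0r mul1r; lra.
have ct : 0 < cut_time < ln (1 + xi.1.1).
  rewrite ln_gt0 ?ltr_ln ?posrE //=; rewrite /cut; lra.
have := go_derive (vertex (la 0) (lb 0)) (base 0 xi 1) cut_time.
rewrite -orbE //; apply: near_eq_is_derive; near=> t; apply/esym/orbE.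
have : t \in `]0, (ln (1 + xi.1.1))[.
  by near: t; apply: near_in_itvoo; rewrite in_itv.
by rewrite in_itv.
Unshelve. all: by end_near. Qed.

(** [gamma 2] vanishes on the section directions but equals - (1 + cut)^-1 on the velocity. *)
Lemma cut_transverse : transverse_section cut_dirs (derive1 orbit cut_time).
Proof.
have c1 : 0 < (1 + cut)^-1 by rewrite invr_gt0; have := cut0; lra.
have rowsum i : \sum_k ((1 + cut)^-1 *: base 0 (tri (delta_mx 0 i)) 0).1 0 k = 0 /\
    \sum_k ((1 + cut)^-1 *: base 0 (tri (delta_mx 0 i)) 0).2 k 0 = 0.
  have [_ _ m b] := base_section game 0 (tri (delta_mx 0 i)) 0.
  have := massZ (1 + cut)^-1 (base 0 (tri (delta_mx 0 i)) 0).
  have := massAZ (1 + cut)^-1 (base 0 (tri (delta_mx 0 i)) 0).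
  by rewrite b m mulr0 => HA HB; split; [exact: HA|exact: HB].
split.
- apply: inj_row_free => v v0; have := cut_lin v.
  rewrite /section_lin; have -> : v *m lsubmx cut_dirs = 0.
    by rewrite mulmx_lsub v0 linear0.
  have -> : v *m rsubmx cut_dirs = 0 by rewrite mulmx_rsub v0 linear0.
  rewrite trmx0 => /esym/eqP; rewrite -[(0, 0)]/(0 : state R) scaler_eq0.
  rewrite gt_eqF //= => /eqP base_v0.
  have [sE _ _ _] := base_section game 0 (tri v) 0.
  apply: (can_inj triK); rewrite -sE base_v0 tri0.
  by rewrite -(scale0r (0 : state R)) sectionZ scl0.
- apply/colP => i; rewrite /cut_dirs row_mxKl !mxE; have [HA _] := rowsum i.
  by rewrite -[RHS]HA; apply: eq_bigr => k _; rewrite !mxE mulr1.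
- apply/colP => i; rewrite /cut_dirs row_mxKr !mxE; have [_ HB] := rowsum i.
  by rewrite -[RHS]HB; apply: eq_bigr => k _; rewrite !mxE mulr1.
move=> s; rewrite derive1E (@derive_val _ _ _ _ _ _ _ cut_derive) cut_lin.
move=> /(congr1 (gamma 2)); rewrite gammaZ.
have [_ -> _ _] := base_section game 0 (tri s) 0.
have [_ tie m b] := base_section game 0 xi 1.
have [_ _ g1] := gamma_vertex game 0 (lb 0).
rewrite -scaleN1r gammaD g1 orbit_cut /path_at !gammaZ m.
have aC : cut <= alpha 0 (base 0 xi 1).
  by rewrite (alpha_base game) /cut; have := d0; lra.
have [_ ->] := gamma_cumul1 game aC.
rewrite tie mulr0 => /esym/eqP; apply/negP.
have -> : -1 + -1 * ((1 + cut)^-1 * (0 - cut)) = - (1 + cut)^-1.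
  by field; have := cut0; lra.
by rewrite oppr_eq0 gt_eqF.
Qed.

End SaddleOrbit.

Lemma strictA_inj (R : realType) (A : 'M[R]_3) (x : state R) i j :
  strictA A x i -> strictA A x j -> i = j.
Proof.
move=> xi xj; apply/eqP; apply: contraT => ij.
by have := lt_trans (xi j _) (xj i ij); rewrite ltxx eq_sym ij => /(_ isT).
Qed.

Lemma strictB_inj (R : realType) (B : 'M[R]_3) (x : state R) i j :
  strictB B x i -> strictB B x j -> i = j.
Proof.
move=> xi xj; apply/eqP; apply: contraT => ij.
by have := lt_trans (xi j _) (xj i ij); rewrite ltxx eq_sym ij => /(_ isT).
Qed.

Section ReturnMap.
Context {R : realType} (A B : 'M[R]_3) (la lb : nat -> 'I_3).
Variables (r q rho kap : R).
Hypothesis game : cyclic_game A B la lb r q rho kap.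
Local Notation alpha := (alpha lb rho).
Local Notation gamma := (gamma la kap).
Local Notation section := (section la lb rho kap).
Local Notation path_at := (path_at la lb rho).
Local Notation base := (base la lb rho kap).
Local Notation step := (step rho kap).
Local Notation dur := (dur kap).
Local Notation valid := (valid rho kap).
Local Notation relmass := (relmass rho kap).
Local Notation weight := (weight rho kap).
Local Notation ratio := (ratio rho kap).
Variables (l : R) (xi : R * R * R).
Hypotheses (rk : rho < kap) (l1 : 1 < l) (xi_step : step xi = scl l xi)
  (xi_weight : weight xi = 1) (xi_valid : valid xi).
Local Notation orbit := (orbit la lb rho kap l xi).
Local Notation cut := (cut xi).
Local Notation cut_state := (cut_state la lb rho kap l xi).

Let l0 : 0 < l. Proof. exact: lt_trans l1. Qed.
Let d0 : 0 < xi.1.1. Proof. by case: xi_valid. Qed.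
Let cut0 : 0 < cut. Proof. by rewrite divr_gt0 ?d0. Qed.
Let kr : kap != rho. Proof. by rewrite gt_eqF. Qed.

(** Three steps, followed by a multiple of [xi] that restores the weight of [s]; this is the
    first-order effect of scaling the mass back to one. *)
Definition return_lin s : 'rV[R]_3 := let y := iter 3 step (tri s) in
  vec (y + scl (- (weight y - weight (tri s))) xi).
Definition return_mx : 'M[R]_3 := \matrix_i return_lin (delta_mx 0 i).
Definition ret_map s : 'rV[R]_3 :=
  (relmass 3 (xi + tri s))^-1 *: (s *m return_mx).

Lemma return_mxE s : s *m return_mx = return_lin s.
Proof.
apply: linear_rows => a x y; rewrite /return_lin triD triZ.
rewrite iter_stepD iter_step_scl -vecZ -vecD; congr vec.
rewrite !weightD !weight_scl sclDr sclA -!addrA; congr (_ + _).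
by rewrite [RHS]addrCA -sclDl; congr (_ + scl _ _); ring.
Qed.

Lemma iter_xi n : iter n step xi = scl (l ^+ n) xi.
Proof.
elim: n => [|n IHn]; first by rewrite expr0 scl1.
by rewrite iterS IHn step_scl xi_step sclA exprSr.
Qed.

Lemma relmass_xi n : relmass n xi = l ^+ n.
Proof. by rewrite /relmass iter_xi weight_scl xi_weight subrr add0r mulr1. Qed.

(** With y the third iterate of [tri s] and c its gain in weight, the normalised third iterate of
    [xi + tri s] is (l^3 xi + y) / (l^3 + c) = xi + (y - c xi) / (l^3 + c). *)
Lemma ret_mapE s : relmass 3 (xi + tri s) != 0 ->
  xi + tri (ret_map s) = ratio 3 (xi + tri s).
Proof.
set x := xi + tri s => x0; rewrite /ret_map return_mxE triZ /return_lin vecK.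
rewrite /ratio -/x.
have xE : iter 3 step x = scl (l ^+ 3) xi + iter 3 step (tri s).
  by rewrite iter_stepD iter_xi.
move: xE; set y := iter 3 step (tri s); set c := weight y - weight (tri s) => xE.
have cE : relmass 3 x = l ^+ 3 + c.
  rewrite /relmass xE !weightD !weight_scl xi_weight /c -/y.
  by ring.
rewrite -{1}(scl1 xi) -(mulVf x0) -sclA -sclDr xE; congr scl.
by rewrite addrCA -sclDl {1}cE addrK addrC.
Qed.

(* Nearby orbits meet the section only once per period. *)
Lemma cut_state_facts s : cut < (xi + tri s).1.1 -> valid (xi + tri s) ->
  [/\ strictA A (cut_state s) (la 0), strictB B (cut_state s) (lb 0) &
      gamma 2 (cut_state s) = - (cut / (1 + cut))].
Proof.
move=> cs xv; rewrite (cut_stateE game rk l1 xi_step xi_weight xi_valid (ltW cs)).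
have [sE tie m _] := base_section game 0 (xi + tri s) 1.
have c0 := cut0; have mpos : 0 < mass (base 0 (xi + tri s) 1) + cut by rewrite m; lra.
have v : valid (section 0 (base 0 (xi + tri s) 1)) by rewrite sE.
have [HA HB] := valid_strict1 game cut tie v.
rewrite (alpha_base game) in HA HB.
have ca : cut <= alpha 0 (base 0 (xi + tri s) 1) by rewrite (alpha_base game) ltW.
split.
- by apply/strictA_path => //; apply: HA; lra.
- by apply/strictB_path => //; apply: HB; lra.
have [_ gE] := gamma_cumul1 game ca.
by rewrite /path_at gammaZ gE tie m sub0r mulrN mulrC.
Qed.

(** On the section the strategies are [la 0] and [lb 0]. Inside phase 1 or 2 it is B who plays
    something else; at the very start, where B ties, it is A. *)
Lemma no_cut_phase n y s s' : n = 1%N \/ n = 2%N -> valid y -> 0 <= s < dur y ->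
  cut < (xi + tri s').1.1 -> valid (xi + tri s') ->
  path_at n (base n y 1) s <> cut_state s'.
Proof.
move=> n12 yv sd cs' xv' E.
have [cA cB _] := cut_state_facts cs' xv'; rewrite -E in cA cB.
have [sE tie m _] := base_section game n y 1.
have mpos : 0 < mass (base n y 1) + s by rewrite m; lra.
have v : valid (section n (base n y 1)) by rewrite sE.
have [HA1 HB1] := valid_strict1 game s tie v.
have [HA2 HB2] := valid_strict2 game s tie v.
rewrite (alpha_base game) in HA1 HB1 HA2 HB2; rewrite sE in HA2 HB2.
have [a1 a2 a3] := la_neq game 0; have [b1 b2 b3] := lb_neq game 0.
have y0 : 0 < y.1.1 by case: yv.
have [s_pos|s_neg] := ltP 0 s.
  have sB : strictB B (path_at n (base n y 1) s) (lb n).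
    apply/strictB_path => //; have [sy|ys] := leP s y.1.1.
      by apply: HB1; rewrite s_pos.
    by apply: HB2; lra.
  have := strictB_inj cB sB.
  by case: n12 => -> /eqP; rewrite ?b1 ?b2.
have sA : strictA A (path_at n (base n y 1) s) (la n).
  by apply/strictA_path => //; apply: HA1; lra.
have := strictA_inj cA sA.
by case: n12 => -> /eqP; rewrite ?a1 ?a2.
Qed.

(** Before A switches, [gamma 2] equals -s / (1 + s), which is injective in s and has the section
    value only at [cut]; after the switch [la 0] is no longer the best reply. *)
Lemma no_cut_phase0 y s s' : valid y -> 0 <= s -> s != cut ->
  cut < (xi + tri s').1.1 -> valid (xi + tri s') ->
  path_at 0 (base 0 y 1) s <> cut_state s'.
Proof.
move=> yv s0 sc cs' xv' E.
have [cA cB cG] := cut_state_facts cs' xv'; rewrite -E in cA cG.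
have [sE tie m _] := base_section game 0 y 1; have c0 := cut0.
have [sa|as_] := leP s (alpha 0 (base 0 y 1)).
  have [_ gE] := gamma_cumul1 game sa.
  move: cG; rewrite /path_at gammaZ gE tie m sub0r => cG.
  have : s * (1 + cut) = cut * (1 + s).
    have := congr1 (fun z => - z * ((1 + s) * (1 + cut))) cG.
    have -> : - ((1 + s)^-1 * - s) * ((1 + s) * (1 + cut)) = s * (1 + cut).
      by field; lra.
    have -> // : - - (cut / (1 + cut)) * ((1 + s) * (1 + cut)) = cut * (1 + s).
    by field; lra.
  by move=> H; move/eqP: sc; apply; lra.
have /(strictAP game 0)[aP _] := cA.
move: aP; rewrite /path_at alphaZ; have [-> _ _] := alpha_cumul game 0 (base 0 y 1) s.
by rewrite pmulr_rgt0 ?invr_gt0 ?m; lra.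
Qed.

Lemma path_at3' x s : path_at 3 (base 3 x 1) s = path_at 0 (base 0 x 1) s.
Proof. by rewrite (path_at3 game) (base3 game). Qed.

Lemma xi_tri_cvg : xi + tri s @[s --> (0 : 'rV[R]_3)] --> xi.
Proof.
have tc : tri s @[s --> (0 : 'rV[R]_3)] --> tri (0 : 'rV[R]_3).
  exact: tri_continuous.
have c1 : (tri s).1.1 @[s --> (0 : 'rV[R]_3)] --> (tri (0 : 'rV[R]_3)).1.1.
  exact: (continuous_cvg _ (@coord11_continuous R _) tc).
have c2 : (tri s).1.2 @[s --> (0 : 'rV[R]_3)] --> (tri (0 : 'rV[R]_3)).1.2.
  exact: (continuous_cvg _ (@coord12_continuous R _) tc).
have c3 : (tri s).2 @[s --> (0 : 'rV[R]_3)] --> (tri (0 : 'rV[R]_3)).2.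
  exact: (continuous_cvg _ (@coord2_continuous R _) tc).
have := triple_cvg (nbhs_filter _) (cvgD (cvg_cst xi.1.1) c1)
  (cvgD (cvg_cst xi.1.2) c2) (cvgD (cvg_cst xi.2) c3).
rewrite tri0 /= !addr0 -!surjective_pairing.
by apply; exact: nbhs_filter.
Qed.

Lemma near_xi (P : R * R * R -> Prop) : (\forall x \near xi, P x) ->
  \forall s \near (0 : 'rV[R]_3), P (xi + tri s).
Proof. by move=> nP; exact: xi_tri_cvg nP. Qed.

(** The bounds fit the time horizon [ln (l ^+ 4)]: the return happens near time 3 [ln l], and five
    phases outlast the horizon even for a solution started at the cut. *)
Lemma return_good : \forall x \near xi,
  [/\ cut < x.1.1, (forall m, (m <= 4)%N -> valid (iter m step x)),
      state_space (base 0 x 1), relmass 3 x < l ^+ 4 &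
      (1 + cut) * l ^+ 4 < relmass 5 x /\ cut < (ratio 3 x).1.1].
Proof.
have l0' := l0; have c1 : cut < xi.1.1 by have := d0; rewrite /cut; lra.
have c1_near : \forall x \near xi, cut < x.1.1.
  exact: (cvgr_gt _ (@coord11_continuous R xi)).
have valid_n (m : 'I_5) : \forall x \near xi, valid (iter m step x).
  apply: (@iter_step_continuous R rho kap m xi); apply: valid_near.
  by rewrite iter_xi valid_scl // exprn_gt0.
have valid_all := filter_forall (F := nbhs xi) _ valid_n.
have base_cont : base 0 x 1 @[x --> xi] --> base 0 xi 1.
  by apply: base_cvg; [exact: cvg_id|exact: cvg_cst].
have [p1 p2] := base_positive game rk l1 xi_step xi_weight xi_valid 0.
have pos1 (k : 'I_3) : \forall x \near xi, 0 < (base 0 x 1).1 0 k.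
  exact: (cvgr_gt _ (continuous_cvg _ (@state_entry1_continuous R k _) base_cont)).

have pos2 (k : 'I_3) : \forall x \near xi, 0 < (base 0 x 1).2 k 0.
  exact: (cvgr_gt _ (continuous_cvg _ (@state_entry2_continuous R k _) base_cont)).

have pos1' := filter_forall (F := nbhs xi) _ pos1.
have pos2' := filter_forall (F := nbhs xi) _ pos2.
have rel_cont n : relmass n x @[x --> xi] --> l ^+ n.
  by rewrite -relmass_xi; exact: relmass_continuous.
have rel3 : \forall x \near xi, relmass 3 x < l ^+ 4.
  by apply: (cvgr_lt _ (rel_cont 3%N)); rewrite ltr_eXn2l.
have rel5 : \forall x \near xi, (1 + cut) * l ^+ 4 < relmass 5 x.
  apply: (cvgr_gt _ (rel_cont 5%N)); rewrite [ltRHS]exprS ltr_pM2r ?exprn_gt0 //.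
  have dE : xi.1.1 + dwell kap xi = l - 1 := dur_xi rk xi_step xi_weight.
  by have := valid_dwell game xi_valid; lra.
have rat_cont : (ratio 3 x).1.1 @[x --> xi] --> xi.1.1.
  have -> : xi.1.1 = (l ^+ 3)^-1 * (iter 3 step xi).1.1.
    by rewrite iter_xi /= mulKf // expf_neq0 // gt_eqF.
  apply: cvgM; first by apply: cvgV; [rewrite expf_neq0 // gt_eqF|exact: rel_cont].
  apply: (continuous_cvg _ (@coord11_continuous R _)).
  exact: iter_step_continuous.
have rat3 : \forall x \near xi, cut < (ratio 3 x).1.1.
  exact: (cvgr_gt _ rat_cont).
near=> x; split; [by near: x| | |by near: x|by split; near: x].
  have H : forall m : 'I_5, valid (iter m step x) by near: x; exact: valid_all.
  by move=> m m4; exact: (H (Ordinal (m4 : (m < 5)%N))).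
have H1 : forall k, 0 < (base 0 x 1).1 0 k by near: x; exact: pos1'.
have H2 : forall k, 0 < (base 0 x 1).2 k 0 by near: x; exact: pos2'.
by apply: (base_state_space game) => k; exact: ltW.
Unshelve. all: by end_near. Qed.

(** The return takes time [ln (relmass 3 x)]. Up to then the mass runs from [1 + cut] to
    [(1 + cut) * relmass 3 x], and an earlier hit is excluded in each of the phases 0 to 3 that it
    meets. *)
Lemma orbit_return_map : return_map A B cut_state ret_map.
Proof.
have c0 := cut0; have l0' := l0; have l1' := l1.
split; first by rewrite /ret_map mul0mx scaler0.
pose V := [set s : 'rV[R]_3 | cut < (xi + tri s).1.1 /\ valid (xi + tri s)].
have l4 : 1 < l ^+ 4 by rewrite exprn_egt1.
exists V, (ln (l ^+ 4)); split; last first.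
- apply: filterS (near_xi return_good) => s; set x := xi + tri s.
  move=> [c1 x_valid x_ss rel3 [rel5 rat3]].
  have rel_ge1 n : (n <= 5)%N -> 1 <= relmass n x.
    move=> n5; apply: (relmass_ge1 game rk) => j jn; apply: x_valid.
    by rewrite -ltnS (leq_trans jn).
  have rel_gt0 n : (n <= 5)%N -> 0 < relmass n x.
    by move=> n5; exact: lt_le_trans (rel_ge1 n n5).
  have relS n : (n <= 4)%N -> relmass n.+1 x = relmass n x * (1 + dur (ratio n x)).
    move=> n4; rewrite relmassS // /ratio dur_scl.
    have := rel_gt0 n (leqW n4); move: (relmass n x) (dur _) => u v u0.
    by field; lra.
  have rat_valid n : (n <= 4)%N -> valid (ratio n x).
    move=> n4; apply/valid_scl; last exact: (x_valid n n4).
    by rewrite invr_gt0; apply: rel_gt0; exact: leqW.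
  have xv : valid x by exact: (x_valid 0%N).
  have e0 := valid_dwell game xv.
  have cdur : 0 <= cut <= dur x by rewrite /dur; lra.
  have ret : xi + tri (ret_map s) = ratio 3 x.
    by rewrite ret_mapE // gt_eqF // rel_gt0.
  have startE : cut_state s = path_at 0 (base 0 x 1) cut.
    by rewrite (cut_stateE game rk l1 xi_step xi_weight xi_valid (ltW c1)).
  have endE : cut_state (ret_map s) = path_at 3 (base 3 (ratio 3 x) 1) cut.
    rewrite (cut_stateE game rk l1 xi_step xi_weight xi_valid) ret ?ltW //.
    by rewrite path_at3'.
  have cE : expR (cut_time xi) = 1 + cut by rewrite lnK // posrE; lra.
  have ct0 : 0 <= cut_time xi by rewrite ln_ge0; lra.
  split.
  + by split; rewrite ret; [exact: rat3|exact: (rat_valid 3%N isT)].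
  + have [p [p_lip p0]] := phases_solution game rk x_valid x_ss.
    exists (fun t => p (t + cut_time xi)); last first.
      rewrite add0r startE.
      have := @base_track _ _ _ _ _ _ _ _ _ game rk _ p x 0 (cut_time xi) _
        (lipschitz_solution_upto p_lip) p0.
      rewrite /ratio relmass0 invr1 scl1 cE mulr1 [1 + cut]addrC addrK => -> //.
      * by move=> m; rewrite leqn0 => /eqP->; exact: (x_valid 0%N).
      * rewrite ct0 /= -ler_expR cE lnK ?posrE ?rel_gt0 //.
        have := rel_ge1 5%N isT; have : 0 < cut * (l ^+ 4 - 1) by rewrite mulr_gt0 //; lra.
        lra.
      * by rewrite relmassS // relmass0; lra.
    apply: lipschitz_solution_upto.
    apply: lipschitz_solutionS (lipschitz_solution_shift ct0 p_lip).
    rewrite -ler_expR expRB cE !lnK ?posrE ?rel_gt0 //; last lra.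
    by rewrite ler_pdivlMr; lra.
  move=> p p_sol p0; rewrite startE in p0.
  have track n t : (n <= 4)%N -> 0 <= t <= ln (l ^+ 4) ->
      relmass n x <= (1 + cut) * expR t <= relmass n.+1 x ->
      p t = path_at n (base n (ratio n x) 1) ((1 + cut) * expR t / relmass n x - 1).
    move=> n4 tb tn; apply: (base_track_from game rk _ cdur p_sol p0 tb tn).
    by move=> m mn; apply: x_valid; exact: leq_trans n4.
  have t3E : expR (ln (relmass 3 x)) = relmass 3 x by rewrite lnK ?posrE ?rel_gt0.
  have rel3_1 : 1 < relmass 3 x.
    rewrite relS //; have := rel_ge1 2%N isT; have := valid_dur game (rat_valid 2%N isT).
    move: (relmass 2 x) (dur _) => u v v0 u1.
    by have := mulr_gt0 (lt_le_trans ltr01 u1) v0; lra.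
  have t3 : 0 < ln (relmass 3 x) <= ln (l ^+ 4).
    by rewrite ln_gt0 //= ler_ln ?posrE ?rel_gt0 //; lra.
  exists (ln (relmass 3 x)); split=> //.
  + rewrite endE (track 3%N) //; [|lra|].
      by rewrite t3E mulfK ?gt_eqF ?rel_gt0 // [1 + cut]addrC addrK.
    rewrite t3E (relS 3%N) //; have := rel_gt0 3%N isT.
    have r3v := rat_valid 3%N isT; have := valid_dwell game r3v.
    move: rat3; rewrite /dur; move: (relmass 3 x) (ratio 3 x) => u v v1 v2 u0.
    have := mulr_gt0 u0 c0; have : u * cut <= u * (v.1.1 + dwell kap v).
      by rewrite ler_pM2l //; lra.
    by lra.
  move=> t /andP[t0 t_lt] [s' [cs' xv'] E].
  have t1 : 1 < expR t by rewrite -expR0 ltr_expR.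
  have t2 : expR t < relmass 3 x by rewrite -t3E ltr_expR.
  set M := (1 + cut) * expR t.
  have M1 : 1 + cut < M by rewrite /M ltr_pMr //; lra.
  have M2 : M < (1 + cut) * relmass 3 x by rewrite /M ltr_pM2l //; lra.
  have tb : 0 <= t <= ln (l ^+ 4) by lra.
  have in_phase n : (n <= 4)%N -> relmass n x <= M < relmass n.+1 x ->
      p t = path_at n (base n (ratio n x) 1) (M / relmass n x - 1) /\
      0 <= M / relmass n x - 1 < dur (ratio n x).
    move=> n4 /andP[nM Mn]; have rn := rel_gt0 n (leqW n4); split.
      by apply: track => //; rewrite nM ltW.
    rewrite subr_ge0 ler_pdivlMr // mul1r nM /= ltrBlDr ltr_pdivrMr //.
    by rewrite addrC mulrC -relS.
  have [M3|M3] := leP (relmass 3 x) M.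
    have [||pE sd] := in_phase 3%N => //.
      rewrite M3 (relS 3%N) //; apply: (lt_le_trans M2).
      rewrite mulrC ler_pM2l ?rel_gt0 //; have := valid_dwell game (rat_valid 3%N isT).
      by rewrite /dur; lra.
    (* A copy of the initial phase, but the mass added in it is still below [cut]. *)
    apply: (@no_cut_phase0 (ratio 3 x) (M / relmass 3 x - 1) s') => //.
    - exact: (rat_valid 3%N isT).
    - by case/andP: sd.
    - rewrite lt_eqF // ltrBlDr ltr_pdivrMr ?rel_gt0 //.
      by move: M2; lra.
    by rewrite -path_at3' -pE E.
  have [M4|M4] := leP (relmass 2 x) M.
    have [||pE sd] := in_phase 2%N => //; first by rewrite M4.
    apply: (no_cut_phase (or_intror erefl) (rat_valid 2%N isT) sd cs' xv').
    by rewrite -pE E.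
  have [M5|M5] := leP (relmass 1 x) M.
    have [||pE sd] := in_phase 1%N => //; first by rewrite M5.
    apply: (no_cut_phase (or_introl erefl) (rat_valid 1%N isT) sd cs' xv').
    by rewrite -pE E.
  have [||pE sd] := in_phase 0%N => //; first by rewrite relmass0 M5 andbT; lra.
  move: pE sd; rewrite /ratio relmass0 invr1 scl1 mulr1 => pE sd.
  (* Still in the initial phase, with the added mass already beyond [cut]. *)
  apply: (@no_cut_phase0 x (M - 1) s') => //.
  + by case/andP: sd.
  + by rewrite gt_eqF //; lra.
  by rewrite -pE E.
- by rewrite ln_gt0.
apply: (@near_xi (fun x => cut < x.1.1 /\ valid x)).
by apply: filterS return_good => x [? /(_ 0%N isT)].
Qed.

End ReturnMap.

Section Saddle.
Context {R : realType} (A B : 'M[R]_3) (la lb : nat -> 'I_3).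
Variables (r q rho kap : R).
Hypothesis game : cyclic_game A B la lb r q rho kap.
Local Notation step := (step rho kap).
Local Notation weight := (weight rho kap).
Variables (l : R) (xi : R * R * R).
Hypotheses (rk : rho < kap) (l1 : 1 < l) (xi_step : step xi = scl l xi)
  (xi_weight : weight xi = 1) (xi_valid : valid rho kap xi).
Local Notation orbit := (orbit la lb rho kap l xi).
Local Notation return_mx := (return_mx rho kap xi).

(** Along [xi] restoring the weight undoes the growth by l^3. Displacing the coordinates along [xi]
    moves the state on the line through the equilibrium, and the division by the mass gives the
    factor l^-3. *)
Lemma return_mx_xi : vec xi *m return_mx = vec xi.
Proof.
rewrite return_mxE /return_lin vecK (iter_xi xi_step) weight_scl xi_weight.
by rewrite -sclDl -[in RHS](scl1 xi); congr (vec (scl _ _)); ring.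
Qed.

(** The eigenvector is projected along [xi] to weight zero. If the projection vanished, x would be a
    multiple of [xi], hence an eigenvector for l as well. *)
Lemma return_mx_eigvec z x : step x = scl z x -> z != l -> x.2 != 0 ->
  exists2 v : 'rV[R]_3, v *m return_mx = z ^+ 3 *: v & v != 0.
Proof.
move=> xz zl x2; exists (vec (x + scl (- weight x) xi)).
  rewrite return_mxE /return_lin vecK iter_stepD iter_step_scl (iter_xi xi_step).
  rewrite (iter_xi xz) !weightD !weight_scl xi_weight -vecZ sclDr !sclA.
  by rewrite -addrA -sclDl; congr (vec (_ + scl _ _)); ring.
apply/eqP => /(congr1 tri); rewrite vecK tri0 => w0.
have : step (x + scl (- weight x) xi) = 0.
  by rewrite w0; have := step_scl rho kap 0 0; rewrite !scl0.
rewrite stepD xz step_scl xi_step sclA mulrC -sclA => H.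
have /(congr1 snd)/= := H; have /(congr1 snd)/= := w0 => H1 H2.
have := congr1 ( *%R l) H1; rewrite mulr0 => H3.
have /eqP : (z - l) * x.2 = 0 by lra.
by rewrite mulf_eq0 subr_eq0 (negbTE zl) (negbTE x2).
Qed.

Lemma orbit_saddle : chi (trc rho kap) (sec rho kap) l = 0 -> trc rho kap < l ->
  1 + trc rho kap * l ^+ 2 < 0 -> saddle_type A B orbit.
Proof.
move=> chil trl dom; have l1' := l1; have l0 : 0 < l by lra.
exists (cut_time xi), (cut_dirs la lb rho kap xi), (ret_map rho kap xi) => /=.
pose h s := (relmass rho kap 3 (xi + tri s))^-1.
have h0 : h 0 = (l ^+ 3)^-1.
  by rewrite /h tri0 addr0 (relmass_xi xi_step xi_weight).
have h_cont : {for 0, continuous h}.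
  rewrite /prop_for /continuous_at h0.
  have l3 : l ^+ 3 != 0 by rewrite expf_neq0 // gt_eqF.
  have H : relmass rho kap 3 (xi + tri s) @[s --> (0 : 'rV[R]_3)] --> l ^+ 3.
    rewrite -(relmass_xi xi_step xi_weight).
    exact: (continuous_cvg _ (@relmass_continuous _ rho kap 3 xi) (@xi_tri_cvg _ xi)).
  exact: (cvgV l3 H).
have [P_diff] := scaled_linear_jacobian return_mx h_cont.
rewrite -/(ret_map rho kap xi) h0 => JE.
have [cder] := cut_derive game rk l1 xi_step xi_weight xi_valid.
have eig z x : step x = scl z x -> z != l -> x.2 != 0 ->
    eigenvalue (jacobian (ret_map rho kap xi) 0) ((z / l) ^+ 3).
  move=> xz zl x2; have [v vE v0] := return_mx_eigvec xz zl x2.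
  apply/eigenvalueP; exists v => //; rewrite JE -scalemxAr vE scalerA.
  by rewrite expr_div_n mulrC.
have [z2 [z3 [chi2 chi3 z2l z3l]]] := other_roots l1 chil trl dom.
have x2 : kap ^+ 2 - kap + 1 != 0 by rewrite gt_eqF // quad_gt0.
have one_real : (1 : R[i]) = ((1 : R)%:C)%C by [].
have e1 : eigenvalue (jacobian (ret_map rho kap xi) 0) (l ^+ 3)^-1.
  apply/eigenvalueP; exists (vec xi); first by rewrite JE -scalemxAr return_mx_xi.
  apply/eqP => /(congr1 tri); rewrite vecK tri0 => xi0.
  by have [] := xi_valid; rewrite xi0 ltxx.
have e2 : eigenvalue (jacobian (ret_map rho kap xi) 0) ((z2 / l) ^+ 3).
  by apply: (eig z2 _ (root_eigvec _ chi2)) => //=; rewrite lt_eqF //; lra.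
have e3 : eigenvalue (jacobian (ret_map rho kap xi) 0) ((z3 / l) ^+ 3).
  by apply: (eig z3 _ (root_eigvec _ chi3)) => //=; rewrite lt_eqF //; lra.
have r1 : 0 < (l ^+ 3)^-1 < 1 by rewrite invr_gt0 exprn_gt0 //= invf_lt1 ?exprn_gt0 ?exprn_egt1.
have r2 : (z2 / l) ^+ 3 < -1.
  have : 1 < (- (z2 / l)) ^+ 3.
    by rewrite exprn_egt1 // -mulNr ltr_pdivlMr // mul1r; lra.
  by rewrite exprNn; lra.
have r3 : -1 < (z3 / l) ^+ 3 < 0.
  have u0 : 0 < - (z3 / l) by rewrite -mulNr divr_gt0 //; lra.
  have u1 : - (z3 / l) < 1 by rewrite -mulNr ltr_pdivrMr //; lra.
  have := exprn_gt0 3 u0; have : (- (z3 / l)) ^+ 3 < 1 by rewrite exprn_ilt1 // ltW.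
  by rewrite exprNn; lra.
split.
- split=> //; exact: (cut_transverse game rk l1 xi_step xi_weight xi_valid).
- exact: (orbit_return_map game rk l1 xi_step xi_weight xi_valid).
- exact: P_diff.
- have r12 : (l ^+ 3)^-1 != (z2 / l) ^+ 3 by rewrite gt_eqF //; lra.
  have r13 : (l ^+ 3)^-1 != (z3 / l) ^+ 3 by rewrite gt_eqF //; lra.
  have r23 : (z2 / l) ^+ 3 != (z3 / l) ^+ 3 by rewrite lt_eqF //; lra.
  have norm1 (x : R) : `|x| != 1 -> `|(x%:C)%C| != 1.
    by rewrite normc_real one_real (inj_eq (@complexI R)).
  move=> z /(complex_eigenvalue3 e1 e2 e3 r12 r13 r23) [] ->; apply: norm1.
  + by rewrite gtr0_norm ?lt_eqF //; lra.
  + by rewrite ltr0_norm ?gt_eqF //; lra.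
  + by rewrite ltr0_norm ?lt_eqF //; lra.
split.
  exists (((l ^+ 3)^-1)%:C)%C; first exact: complex_eigenvalue_real.
  by rewrite normc_real one_real ltcR gtr0_norm; lra.
exists (((z2 / l) ^+ 3)%:C)%C; first exact: complex_eigenvalue_real.
by rewrite normc_real one_real ltcR ltr0_norm; lra.
Qed.

End Saddle.

(** * Absence of the pattern *)

Section SolutionSigns.
Context {R : realType} (A B : 'M[R]_3) (p : R -> state R).
Hypothesis p_sol : fp_solution A B p.

Lemma solution_limit_ge0 (h : state R -> R) c d : continuous h -> 0 <= c -> c < d ->
  (forall t, c < t < d -> 0 <= h (p t)) -> 0 <= h (p c) /\ 0 <= h (p d).
Proof.
move=> h_cont c0 cd h_ge0; have d0 : 0 < d by lra.
have nonneg t : c <= t <= d ->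
    (forall e, 0 < e -> exists s, c < s < d /\ `|s - t| < e) -> 0 <= h (p t).
  move=> tcd t_lim; rewrite leNgt; apply/negP => ht.
  have near_neg : \forall x \near p t, h x < 0.
    exact: (cvgr_lt _ (h_cont (p t)) _ ht).
  have t0d : 0 <= t <= d by lra.
  have [e e0 eP] := solution_near (p_sol d0) t0d near_neg.
  have [s [scd st]] := t_lim e e0.
  have s0d : 0 <= s <= d by lra.
  by have := eP s s0d st; have := h_ge0 s scd; lra.
split; apply: nonneg; try lra; move=> e e0.
  have m0 : 0 < Num.min e (d - c) / 2 by rewrite divr_gt0 // lt_min e0 subr_gt0.
  have [m1 m2] : Num.min e (d - c) <= e /\ Num.min e (d - c) <= d - c.
    by rewrite !ge_min !lexx orbT.
  exists (c + Num.min e (d - c) / 2).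
  by rewrite addrAC subrr add0r gtr0_norm //; lra.
have m0 : 0 < Num.min e (d - c) / 2 by rewrite divr_gt0 // lt_min e0 subr_gt0.
have [m1 m2] : Num.min e (d - c) <= e /\ Num.min e (d - c) <= d - c.
  by rewrite !ge_min !lexx orbT.
exists (d - Num.min e (d - c) / 2).
by rewrite addrAC subrr add0r normrN gtr0_norm //; lra.
Qed.

Lemma solution_vertex c d i j : 0 <= c -> c < d ->
  (forall t, c < t < d -> strictA A (p t) i /\ strictB B (p t) j) ->
  expR d *: p d = expR c *: p c + (expR d - expR c) *: vertex i j.
Proof.
move=> c0 cd strict; have d0 : 0 < d by lra.
have HA := solution_strictA (p_sol d0) c0 (ltW cd) (lexx d) (fun t h => (strict t h).1).
have HB := solution_strictB (p_sol d0) c0 (ltW cd) (lexx d) (fun t h => (strict t h).2).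
by rewrite [LHS]surjective_pairing /= HA HB.
Qed.

End SolutionSigns.

Section NoOrbit.
Context {R : realType} (A B : 'M[R]_3) (la lb : nat -> 'I_3).
Variables (r q rho kap : R).
Hypothesis game : cyclic_game A B la lb r q rho kap.
Local Notation alpha := (alpha lb rho).
Local Notation gamma := (gamma la kap).
Local Notation section := (section la lb rho kap).
Local Notation step := (step rho kap).
Local Notation dwell := (dwell kap).
Local Notation dur := (dur kap).
Local Notation weight := (weight rho kap).
Variables (p : R -> state R) (t : nat -> R).
Hypotheses (p_sol : fp_solution A B p) (t0 : 0 <= t 0%N)
  (t_incr : forall n, t n < t n.+1) (t_oo : t n @[n --> \oo] --> +oo)
  (t_strict : forall n s, t n < s < t n.+1 ->
     strictA A (p s) (la (uphalf (n + 5))) /\ strictB B (p s) (lb (n + 5)./2)).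

Let t_ge0 n : 0 <= t n.
Proof. by elim: n => // n; have := t_incr n; lra. Qed.

(** The pattern is shifted by 5, so B switches, and a phase begins, at the odd indices. *)
Let start j := t j.*2.+1.
Let image j := expR (start j) *: p (start j).

(* The pattern makes A switch exactly when [alpha] vanishes, and B when
   [gamma] does, whatever the sign of [kap - rho]. *)
Lemma pattern_step j :
  [/\ 0 <= (section j (image j)).1.1, 0 <= (section j (image j)).1.2,
      0 <= (section j (image j)).2,
      section j.+1 (image j.+1) = step (section j (image j)) &
      expR (start j.+1) = expR (start j) + dur (section j (image j))].
Proof.
have half3 : ((j.+1.*2.+1 + 5)./2 = j.+4)%N by lia.
set s := t j.*2.+2.
have c0 : 0 <= start j := t_ge0 _.
have cs : start j < s := t_incr _.
have s0 : 0 <= s := t_ge0 _.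
have sc : s < start j.+1 := t_incr _.
have bc : t j.*2 < start j := t_incr _.
have half0 : ((j.*2 + 5)./2 = j.+2)%N by lia.
have uphalf0 : (uphalf (j.*2 + 5) = j.+3)%N by lia.
have half1 : ((j.*2.+1 + 5)./2 = j.+3)%N by lia.
have uphalf1 : (uphalf (j.*2.+1 + 5) = j.+3)%N by lia.
have half2 : ((j.*2.+2 + 5)./2 = j.+3)%N by lia.
have uphalf2 : (uphalf (j.*2.+2 + 5) = j.+4)%N by lia.
have before u : t j.*2 < u < start j -> strictA A (p u) (la j) /\ strictB B (p u) (lb j.+2).
  by move=> /t_strict; rewrite half0 uphalf0 (cg_la3 game).
have first_ u : start j < u < s -> strictA A (p u) (la j) /\ strictB B (p u) (lb j).
  by move=> /t_strict; rewrite half1 uphalf1 (cg_la3 game) (cg_lb3 game).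
have second u : s < u < start j.+1 -> strictA A (p u) (la j.+1) /\ strictB B (p u) (lb j).
  by move=> /t_strict; rewrite half2 uphalf2 (cg_la3 game) (cg_lb3 game).
have alpha_cont n : continuous (fun x => alpha n x) := @alpha_continuous _ lb rho n.
have gamma_cont n : continuous (fun x => gamma n x) := @gamma_continuous _ la kap n.
have nalpha_cont n : continuous (fun x => - alpha n x).
  by move=> x; apply: cvgN; exact: alpha_cont.
have ngamma_cont n : continuous (fun x => - gamma n x).
  by move=> x; apply: cvgN; exact: gamma_cont.
have [d0 sa] : 0 <= alpha j (p (start j)) /\ 0 <= alpha j (p s).
  apply: (solution_limit_ge0 p_sol (alpha_cont j)) => // u /first_[+ _].
  by move/(strictAP game) => [/ltW].
have [f0 _] : 0 <= - alpha j.+2 (p (start j)) /\ 0 <= - alpha j.+2 (p s).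
  apply: (solution_limit_ge0 p_sol (nalpha_cont j.+2)) => // u /first_[+ _].
  by move/(strictAP game) => [_]; lra.
have [g0 _] : 0 <= gamma j (p (start j)) /\ 0 <= gamma j (p s).
  apply: (solution_limit_ge0 p_sol (gamma_cont j)) => // u /first_[_].
  by move/(strictBP game) => [/ltW].
have [tie1 _] : 0 <= - gamma j.+2 (p (start j)) /\ 0 <= - gamma j.+2 (p s).
  apply: (solution_limit_ge0 p_sol (ngamma_cont j.+2)) => // u /first_[_].
  by move/(strictBP game) => [_]; lra.
have [_ tie2] : 0 <= gamma j.+2 (p (t j.*2)) /\ 0 <= gamma j.+2 (p (start j)).
  apply: (solution_limit_ge0 p_sol (gamma_cont j.+2)) => // u /before[_].
  by move/(strictBP game) => [/ltW].
have [sa' _] : 0 <= - alpha j (p s) /\ 0 <= - alpha j (p (start j.+1)).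
  apply: (solution_limit_ge0 p_sol (nalpha_cont j)) => // u /second[+ _].
  by move/(strictAP game); rewrite (alpha3 game) => -[_]; lra.
have [_ g1] : 0 <= gamma j (p s) /\ 0 <= gamma j (p (start j.+1)).
  apply: (solution_limit_ge0 p_sol (gamma_cont j)) => // u /second[_].
  by move/(strictBP game) => [/ltW].
have c1 : 0 <= start j.+1 := t_ge0 _.
have cs1 : start j.+1 < t j.+1.*2.+2 := t_incr j.+1.*2.+1.
have third u : start j.+1 < u < t j.+1.*2.+2 -> strictB B (p u) (lb j.+1).
  by move=> /t_strict[_]; rewrite half3 (cg_lb3 game).
have [g1' _] : 0 <= - gamma j (p (start j.+1)) /\ 0 <= - gamma j (p (t j.+1.*2.+2)).
  apply: (solution_limit_ge0 p_sol (ngamma_cont j)) => // u /third.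
  by move/(strictBP game); rewrite (gamma3 game) => -[_]; lra.
have e0 u : 0 < expR u := expR_gt0 u.
(* The intervals before and after the switch give opposite weak signs at the switching time. *)
have tie : gamma j.+2 (image j) = 0 by rewrite /image gammaZ (_ : gamma _ _ = 0) ?mulr0 //; lra.
have sE := solution_vertex p_sol c0 cs first_; rewrite -/(image j) in sE.
have cE := solution_vertex p_sol s0 sc second; rewrite -/(image j.+1) sE in cE.
have durA : expR s - expR (start j) = alpha j (image j).
  have : alpha j (expR s *: p s) = 0 by rewrite alphaZ (_ : alpha _ _ = 0) ?mulr0 //; lra.
  have [aE _ _] := alpha_vertex game j (la j).
  by rewrite sE alphaD alphaZ aE; lra.
have durB : expR (start j.+1) - expR s = dwell (section j (image j)).
  have : gamma j (image j.+1) = 0 by rewrite gammaZ (_ : gamma _ _ = 0) ?mulr0 //; lra.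
  have [g2 _ _] := gamma_vertex game j (lb j).
  have [_ _ g3] := gamma_vertex game j.+1 (lb j); rewrite (gamma3 game) in g3.
  by rewrite cE !gammaD !gammaZ g2 g3 durA /dwell /= [gamma j (image j)]gammaZ; lra.
have dw0 : 0 <= dwell (section j (image j)) by rewrite -durB subr_ge0 ler_expR ltW.
split.
- by rewrite /= alphaZ mulr_ge0 // ltW.
- by rewrite /= alphaZ -mulrN mulr_ge0 // ltW.
- by rewrite /= gammaZ mulr_ge0 // ltW.
- have [_ <-] := section_next game tie dw0; congr (section j.+1 _).
  rewrite cE durA durB /next /cumul /dur /= min_r; last lra.
  by rewrite max_r; [congr (_ + _ *: _); ring|lra].
by rewrite /dur /=; lra.
Qed.

Lemma no_repeating : kap < rho -> False.
Proof.
move=> kr; have kr' : kap != rho by rewrite lt_eqF.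
have const j : expR (start j) - weight (section j (image j)) =
    expR (start 0) - weight (section 0 (image 0)).
  elim: j => // j <-; have [_ _ _ -> ->] := pattern_step j.
  by rewrite weight_step //; ring.
set K := expR (start 0) - weight (section 0 (image 0)) in const.
have bounded j : expR (start j) <= K.
  rewrite -(const j) lerBrDl gerDr; have [d0 f0 g0 _ _] := pattern_step j.
  rewrite /weight ler_ndivrMr ?subr_lt0 // mul0r.
  by rewrite addr_ge0 // addr_ge0.
have K0 : 0 < K by apply: lt_le_trans (bounded 0); exact: expR_gt0.
have [N _ NP] : \forall n \near \oo, ln K < t n by exact: (cvgryPgt _).1.
have : ln K < start N by apply: NP; rewrite /= /start -addnn; lia.
by apply/negP; rewrite -leNgt -ler_expR lnK.
Qed.

End NoOrbit.

(** * The two families of orbits *)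

Definition ord3 (n : nat) : 'I_3 := Ordinal (ltn_pmod n (isT : (0 < 3)%N)).

Lemma ord3D k n : ord3 (3 * k + n) = ord3 n.
Proof. by apply: val_inj; rewrite /= mulnC modnMDl. Qed.

Lemma ord3_ind (P : nat -> Prop) : (forall k n, P n -> P (3 * k + n)%N) ->
  P 0%N -> P 1%N -> P 2%N -> forall n, P n.
Proof.
move=> Pk P0 P1 P2 n; rewrite (divn_eq n 3) mulnC; apply: Pk.
by case: (n %% 3)%N (ltn_pmod n (isT : (0 < 3)%N)) => [|[|[|]]].
Qed.

Lemma sum_ord3 (V : nmodType) (f : 'I_3 -> V) :
  \sum_i f i = f (ord3 0) + f (ord3 1) + f (ord3 2).
Proof.
rewrite !big_ord_recr big_ord0 /= add0r.
by congr (f _ + f _ + f _); apply: val_inj.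
Qed.

Section Games.
Context {R : realType}.
Implicit Type b : R.

(** The orders of play read off from the two patterns, counted from 0; the factor 2 in the
    anticlockwise ones reverses the cyclic order. *)
Definition cw_la (n : nat) : 'I_3 := ord3 n.
Definition cw_lb (n : nat) : 'I_3 := ord3 (1 + n).
Definition acw_la (n : nat) : 'I_3 := ord3 (2 * n).
Definition acw_lb (n : nat) : 'I_3 := ord3 (1 + 2 * n).

Lemma cw_la3 k n : cw_la (3 * k + n) = cw_la n. Proof. exact: ord3D. Qed.
Lemma cw_lb3 k n : cw_lb (3 * k + n) = cw_lb n.
Proof. by rewrite /cw_lb addnCA ord3D. Qed.
Lemma acw_la3 k n : acw_la (3 * k + n) = acw_la n.
Proof. by rewrite /acw_la mulnDr mulnCA ord3D. Qed.
Lemma acw_lb3 k n : acw_lb (3 * k + n) = acw_lb n.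
Proof. by rewrite /acw_lb mulnDr mulnCA addnCA ord3D. Qed.

Lemma ord3E n m : (n %% 3 = m %% 3)%N -> ord3 n = ord3 m.
Proof. by move=> nm; exact: val_inj. Qed.

Lemma payoffAE b v n : payoffA (gameA b) v (ord3 n) = v (ord3 n) 0 + b * v (ord3 (n + 2)) 0.
Proof.
rewrite /payoffA mxE sum_ord3; move: n; apply: ord3_ind => [k n|||].
- by rewrite -addnA !ord3D.
- by rewrite !mxE /=; ring.
- by rewrite !mxE /= (ord3E (_ : (1 + 2) %% 3 = 0 %% 3)%N) //; ring.
- by rewrite !mxE /= (ord3E (_ : (2 + 2) %% 3 = 1 %% 3)%N) //; ring.
Qed.

Lemma payoffBE b v n : payoffB (gameB b) v (ord3 n) = v 0 (ord3 (n + 2)) - b * v 0 (ord3 n).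
Proof.
rewrite /payoffB mxE sum_ord3; move: n; apply: ord3_ind => [k n|||].
- by rewrite -addnA !ord3D.
- by rewrite !mxE /=; ring.
- by rewrite !mxE /= (ord3E (_ : (1 + 2) %% 3 = 0 %% 3)%N) //; ring.
- by rewrite !mxE /= (ord3E (_ : (2 + 2) %% 3 = 1 %% 3)%N) //; ring.
Qed.

Lemma cw_game b : -1 < b ->
  cyclic_game (gameA b) (gameB b) cw_la cw_lb 1 (1 + b) b (1 + b)^-1.
Proof.
move=> b1; have b0 : 0 < 1 + b by lra.
split=> //; first by rewrite invr_gt0.
- by move=> n; rewrite -(addn3 n) addnC (cw_la3 1).
- by move=> n; rewrite -(addn3 n) addnC (cw_lb3 1).
- by move=> n; rewrite /= !inE -!val_eqE /=; lia.
- by move=> n; rewrite /= !inE -!val_eqE /=; lia.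
- move=> n v; rewrite /cw_la /cw_lb !payoffAE !add1n.
  rewrite (ord3E (_ : (n.+1 + 2) %% 3 = n %% 3)%N) ?(ord3E (_ : n.+3 %% 3 = n %% 3)%N) //; try lia.
  by rewrite addn2; ring.
- move=> n v; rewrite /cw_la /cw_lb !payoffBE !add1n.
  rewrite (ord3E (_ : (n.+1 + 2) %% 3 = n %% 3)%N); last lia.
  rewrite (ord3E (_ : (n.+2 + 2) %% 3 = n.+1 %% 3)%N); last lia.
  by field; lra.
Qed.

Lemma acw_game b : 0 < b ->
  cyclic_game (gameA b) (gameB b) acw_la acw_lb b 1 b^-1 (1 + b).
Proof.
move=> b0; split=> //; first lra.
- by move=> n; rewrite -(addn3 n) addnC (acw_la3 1).
- by move=> n; rewrite -(addn3 n) addnC (acw_lb3 1).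
- by move=> n; rewrite /= !inE -!val_eqE /=; lia.
- by move=> n; rewrite /= !inE -!val_eqE /=; lia.
- move=> n v; rewrite /acw_la /acw_lb !payoffAE.
  rewrite (ord3E (_ : (2 * n.+1 + 2) %% 3 = (1 + 2 * n) %% 3)%N); last lia.
  rewrite (ord3E (_ : (1 + 2 * n.+1) %% 3 = (2 * n) %% 3)%N); last lia.
  rewrite (ord3E (_ : (1 + 2 * n.+2) %% 3 = (2 * n + 2) %% 3)%N); last lia.
  rewrite (ord3E (_ : (2 * n.+1) %% 3 = (2 * n + 2) %% 3)%N); last lia.
  by field; lra.
- move=> n v; rewrite /acw_la /acw_lb !payoffBE.
  rewrite (ord3E (_ : (1 + 2 * n + 2) %% 3 = (2 * n) %% 3)%N); last lia.
  rewrite (ord3E (_ : (1 + 2 * n.+1 + 2) %% 3 = (2 * n.+1) %% 3)%N); last lia.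
  rewrite (ord3E (_ : (1 + 2 * n.+1) %% 3 = (2 * n) %% 3)%N); last lia.
  rewrite (ord3E (_ : (2 * n.+2) %% 3 = (1 + 2 * n) %% 3)%N); last lia.
  by ring.
Qed.

Lemma sigma_root : [/\ 0 < sigma R, sigma R < 1 & sigma R ^+ 2 + sigma R = 1].
Proof.
have s5 : Num.sqrt 5 ^+ 2 = 5 :> R by rewrite sqr_sqrtr.
have s0 : 0 <= Num.sqrt 5 :> R by exact: sqrtr_ge0.
have s1 : 2 < Num.sqrt 5 :> R by rewrite -(@ltr_pXn2r _ 2) ?nnegrE // s5; lra.
have s2 : Num.sqrt 5 < 3 :> R by rewrite -(@ltr_pXn2r _ 2) ?nnegrE // s5; lra.
split; [rewrite /sigma; lra|rewrite /sigma; lra|].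
have -> : sigma R ^+ 2 + sigma R = (Num.sqrt 5 ^+ 2 - 1) / 4 by rewrite /sigma; field.
by rewrite s5; field.
Qed.

Lemma below_sigma b : -1 < b < sigma R -> b < (1 + b)^-1.
Proof.
move=> bs; have [s0 s1 sE] := sigma_root.
rewrite -[ltRHS]mul1r ltr_pdivlMr; last lra.
have : 0 < (sigma R - b) * (sigma R + b + 1) by rewrite mulr_gt0; lra.
by lra.
Qed.

Lemma above_sigma b : sigma R < b -> b^-1 < 1 + b.
Proof.
move=> sb; have [s0 s1 sE] := sigma_root.
rewrite -[ltLHS]mul1r ltr_pdivrMr; last lra.
have : 0 < (b - sigma R) * (sigma R + b + 1) by rewrite mulr_gt0; lra.
by lra.
Qed.

Lemma below_sigma' b : 0 < b < sigma R -> 1 + b < b^-1.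
Proof.
move=> bs; have [s0 s1 sE] := sigma_root.
rewrite -[ltRHS]mul1r ltr_pdivlMr; last lra.
have : 0 < (sigma R - b) * (sigma R + b + 1) by rewrite mulr_gt0; lra.
by lra.
Qed.

Definition growth (rho kap : R) : R :=
  xget 1 [set l | 1 < l /\ chi (trc rho kap) (sec rho kap) l = 0].

Lemma growthP (rho kap : R) : rho < kap ->
  1 < growth rho kap /\ chi (trc rho kap) (sec rho kap) (growth rho kap) = 0.
Proof.
move=> rk; have [l l1 chil] : exists2 l, 1 < l & chi (trc rho kap) (sec rho kap) l = 0.
  (* The value of [chi] at 1 is sec - trc = 3 (rho - kap). *)
  by apply: chi_root; rewrite /chi /trc /sec; lra.
by rewrite /growth; case: xgetP => [x _ //|/(_ l)[]].
Qed.

End Games.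

Section Families.
Context {R : realType}.
Implicit Type b : R.

Definition cw_kap b : R := (1 + b)^-1.
Definition cw_growth b : R := growth b (cw_kap b).
Definition cw_vec b : R * R * R := eigvec b (cw_kap b) (cw_growth b).
Definition cw_orbit b (t : R) : state R :=
  orbit cw_la cw_lb b (cw_kap b) (cw_growth b) (cw_vec b) t.

Definition acw_growth b : R := growth b^-1 (1 + b).
Definition acw_vec b : R * R * R := eigvec b^-1 (1 + b) (acw_growth b).
Definition acw_orbit b (t : R) : state R :=
  orbit acw_la acw_lb b^-1 (1 + b) (acw_growth b) (acw_vec b) t.

Definition is_growth (rho kap l : R) (xi : R * R * R) : Prop :=
  [/\ rho < kap, 1 < l, chi (trc rho kap) (sec rho kap) l = 0 &
   [/\ step rho kap xi = scl l xi, weight rho kap xi = 1 & valid rho kap xi]].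

Lemma cw_growthP b : -1 < b < sigma R ->
  is_growth b (cw_kap b) (cw_growth b) (cw_vec b).
Proof.
move=> bs; have rk := below_sigma bs; have [s0 s1 _] := @sigma_root R.
have [l1 chil] := growthP rk; rewrite -/(cw_growth b) in l1 chil.
have k0 : 0 < cw_kap b by rewrite invr_gt0; lra.
have p1 : 0 < cw_growth b + b by lra.
have p2 : 0 < 1 + (1 - b) * cw_growth b.
  by have : 0 < (1 - b) * cw_growth b; [rewrite mulr_gt0; lra|lra].
split=> //; split; [exact: eigvec_step|exact: eigvec_weight|exact: eigvec_valid].
Qed.

Lemma acw_growthP b : sigma R < b < 1 ->
  is_growth b^-1 (1 + b) (acw_growth b) (acw_vec b).
Proof.
move=> /andP[sb b1]; have rk := above_sigma sb; have [s0 s1 _] := @sigma_root R.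
have b0 : 0 < b by lra.
have [l1 chil] := growthP rk; rewrite -/(acw_growth b) in l1 chil.
have k0 : 0 < 1 + b by lra.
have r0 : 0 < b^-1 by rewrite invr_gt0.
have p1 : 0 < acw_growth b + b^-1 by lra.
have p2 : 0 < 1 + (1 - b^-1) * acw_growth b.
  have lk : 0 < 1 + acw_growth b * (1 + b).
    by have : 0 < acw_growth b * (1 + b); [rewrite mulr_gt0; lra|lra].
  rewrite -(pmulr_rgt0 _ lk).
  (* This identity is a rearrangement of the characteristic equation. *)
  have -> : (1 + acw_growth b * (1 + b)) * (1 + (1 - b^-1) * acw_growth b) =
      (acw_growth b - b) * acw_growth b * (acw_growth b + b^-1).
    by move: chil; rewrite /chi /trc /sec; move: (acw_growth b) (b^-1) => l u; lra.
  by rewrite !mulr_gt0 //; lra.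
split=> //; split; [exact: eigvec_step|exact: eigvec_weight|exact: eigvec_valid].
Qed.

Lemma cw_pattern n : nth (0, 0)%N clockwise (n %% size clockwise) =
  ((cw_la (uphalf n)).+1, (cw_lb n./2).+1).
Proof.
rewrite /cw_la /cw_lb /=; set m := (n %% 6)%N.
have m6 : (m < 6)%N by rewrite ltn_mod.
have -> : (uphalf n %% 3 = uphalf m %% 3)%N by rewrite /m; lia.
have -> : ((1 + n./2) %% 3 = (1 + m./2) %% 3)%N by rewrite /m; lia.
by case: m m6 => [|[|[|[|[|[|]]]]]].
Qed.

Lemma acw_pattern n : nth (0, 0)%N anticlockwise (n %% size anticlockwise) =
  ((acw_la (uphalf (n + 5))).+1, (acw_lb (n + 5)./2).+1).
Proof.
rewrite /acw_la /acw_lb /=; set m := (n %% 6)%N.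
have m6 : (m < 6)%N by rewrite ltn_mod.
have -> : ((2 * uphalf (n + 5)) %% 3 = (2 * uphalf (m + 5)) %% 3)%N by rewrite /m; lia.
have -> : ((1 + 2 * (n + 5)./2) %% 3 = (1 + 2 * (m + 5)./2) %% 3)%N by rewrite /m; lia.
by case: m m6 => [|[|[|[|[|[|]]]]]].
Qed.

Lemma cw_periodic b : -1 < b < sigma R ->
  periodic_solution (gameA b) (gameB b) (3 * ln (cw_growth b)) (cw_orbit b) /\
  repeats (gameA b) (gameB b) (cw_orbit b) clockwise.
Proof.
move=> bs; have [rk l1 _ [s w v]] := cw_growthP bs.
have game : cyclic_game (gameA b) (gameB b) cw_la cw_lb _ _ _ _ := cw_game (andP bs).1.
split.
  exact: (orbit_periodic_solution game rk l1 s w v (base_xi_space game rk l1 s w v)).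
apply: (orbit_repeats game rk l1 s w v (j := 0)) => n.
by rewrite addn0 cw_pattern.
Qed.

Lemma acw_periodic b : sigma R < b < 1 ->
  periodic_solution (gameA b) (gameB b) (3 * ln (acw_growth b)) (acw_orbit b) /\
  repeats (gameA b) (gameB b) (acw_orbit b) anticlockwise.
Proof.
move=> bs; have [rk l1 _ [s w v]] := acw_growthP bs.
have b0 : 0 < b by have [s0 _ _] := @sigma_root R; lra.
have game := acw_game b0.
split.
  exact: (orbit_periodic_solution game rk l1 s w v (base_xi_space game rk l1 s w v)).
exact: (orbit_repeats game rk l1 s w v acw_pattern).
Qed.

Lemma strategy_pair_strict (A B : 'M[R]_3) x (i j : 'I_3) :
  strategy_pair A B x (i.+1, j.+1) -> strictA A x i /\ strictB B x j.
Proof.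
by move=> [[i' /= [/val_inj->] Ai] [j' /= [/val_inj->] Bj]].
Qed.

Lemma acw_absent b : -1 < b < sigma R -> ~ exists (g : R -> state R) (T : R),
  periodic_solution (gameA b) (gameB b) T g /\
  repeats (gameA b) (gameB b) g anticlockwise.
Proof.
move=> bs [g [T [[_ g_sol _] [t [t0 t_incr t_oo tP]]]]].
have strict n s : t n < s < t n.+1 ->
    strictA (gameA b) (g s) (acw_la (uphalf (n + 5))) /\
    strictB (gameB b) (g s) (acw_lb (n + 5)./2).
  by move=> /tP; rewrite acw_pattern => /strategy_pair_strict.
(* For positive [b] the weight argument applies. Otherwise [acw_game], whose [rho] is b^-1, is out
   of reach, and the passage of A from its first to its third strategy is excluded directly. *)
have [b0|b0] := ltP 0 b.
  apply: (no_repeating (acw_game b0) g_sol t0 t_incr t_oo strict).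
  by apply: below_sigma'; rewrite b0; case/andP: bs.
(* While B plays its second strategy, the first strategy of A does not lose
   ground on the third one, so that A cannot pass from the first to the third. *)
pose h (x : state R) := payoffA (gameA b) x.2 (ord3 0) - payoffA (gameA b) x.2 (ord3 2).
have h_cont : continuous h by move=> x; apply: cvgB; exact: payoffA_continuous.
have nh_cont : continuous (fun x => - h x) by move=> x; apply: cvgN; exact: h_cont.
have la0 : acw_la 3 = ord3 0 by exact: ord3E.
have la1 : acw_la 4 = ord3 2 by exact: ord3E.
have lb0 : acw_lb 3 = ord3 1 by exact: ord3E.
have first_ s : t 1%N < s < t 2%N -> 0 <= h (g s).
  move=> /strict[+ _]; rewrite /= la0 => /(_ (ord3 2) isT).
  by rewrite /h; lra.
have second s : t 2%N < s < t 3%N ->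
    strictA (gameA b) (g s) (ord3 2) /\ strictB (gameB b) (g s) (ord3 1).
  by move=> /strict; rewrite /= la1 lb0.
have hneg s : t 2%N < s < t 3%N -> h (g s) < 0.
  by move=> /second[/(_ (ord3 0) isT) + _]; rewrite /h; lra.
have t1 : 0 <= t 1%N by have := t_incr 0%N; lra.
have t12 := t_incr 1%N; have t23 := t_incr 2%N.
have t2 : 0 <= t 2%N by lra.
have [_ h2] := solution_limit_ge0 g_sol h_cont t1 t12 first_.
(* An interior point of the interval, so that the strict inequality [h (g d) < 0] is available at
   the end of the motion. *)
set d := (t 2%N + t 3%N) / 2; have td : t 2%N < d by rewrite /d; lra.
have dt : d < t 3%N by rewrite /d; lra.
have second' s : t 2%N < s < d ->
    strictA (gameA b) (g s) (ord3 2) /\ strictB (gameB b) (g s) (ord3 1).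
  by move=> sd; apply: second; lra.
have := congr1 h (solution_vertex g_sol t2 td second').
have hZ a x : h (a *: x) = a * h x by rewrite /h /= !payoffAZ; ring.
have hD x y : h (x + y) = h x + h y by rewrite /h /= !payoffAE !mxE; ring.
have hv : h (vertex (ord3 2) (ord3 1)) = - b.
  by rewrite /h !payoffAE !vertex2E /=; ring.
rewrite hD !hZ hv => E.
have hd : h (g d) < 0 by apply: hneg; lra.
have := expR_gt0 d; have := expR_gt0 (t 2%N) => e1 e2.
have : expR d * h (g d) < 0 by rewrite pmulr_rlt0.
have : 0 <= expR (t 2%N) * h (g (t 2%N)) by rewrite mulr_ge0 // ltW.
have : 0 <= (expR d - expR (t 2%N)) * - b.
  by rewrite mulr_ge0 ?subr_ge0 ?ler_expR; lra.
lra.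
Qed.

End Families.

(** * Continuous dependence on the parameter and collapse to the equilibrium *)

Section VaryingCoefficients.
Context {R : realType} (la lb : nat -> 'I_3).

Lemma base_param_cvg (T : Type) (F : set_system T) (FF : Filter F) n
    (rho kap : T -> R) (f : T -> R * R * R) (r0 k0 : R) (x : R * R * R) :
  rho t @[t --> F] --> r0 -> kap t @[t --> F] --> k0 -> f t @[t --> F] --> x ->
  base la lb (rho t) (kap t) n (f t) 1 @[t --> F] --> base la lb r0 k0 n x 1.
Proof.
move=> cr ck fx.
have c1 : (f t).1.1 @[t --> F] --> x.1.1.
  exact: (continuous_cvg _ (@coord11_continuous R x) fx).
have c2 : (f t).1.2 @[t --> F] --> x.1.2.
  exact: (continuous_cvg _ (@coord12_continuous R x) fx).
have c3 : (f t).2 @[t --> F] --> x.2.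
  exact: (continuous_cvg _ (@coord2_continuous R x) fx).
have cst (a : R) : a @[t --> F] --> a by exact: cvg_cst.
have quad (u : T -> R) (u0 : R) : u t @[t --> F] --> u0 ->
    (3 * (u t ^+ 2 - u t + 1))^-1 @[t --> F] --> (3 * (u0 ^+ 2 - u0 + 1))^-1.
  move=> cu; apply: cvgV; first by rewrite gt_eqF // mulr_gt0 // quad_gt0.
  apply: cvgM => //; apply: cvgD => //; apply: cvgB => //.
  exact: (continuous_cvg _ (@exprn_continuous R 2 u0) cu).
have cD := quad rho r0 cr; have cK := quad kap k0 ck.
have two (u : T -> R) (u0 : R) : u t @[t --> F] --> u0 -> 2 * u t @[t --> F] --> 2 * u0.
  by move=> cu; apply: cvgM.
have PA : (base la lb (rho t) (kap t) n (f t) 1).1 @[t --> F] --> (base la lb r0 k0 n x 1).1.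
  apply: cvgD; first apply: cvgD; apply: cvgZr_tmp.
  - apply: cvgD => //; apply: cvgM => //; apply: cvgM => //.
    by apply: cvgB => //; exact: two.
  - by apply: cvgB => //; apply: cvgM => //; apply: cvgM => //; exact: cvgD.
  - by apply: cvgD => //; apply: cvgM => //; apply: cvgM => //; exact: cvgB.
have PB : (base la lb (rho t) (kap t) n (f t) 1).2 @[t --> F] --> (base la lb r0 k0 n x 1).2.
  apply: cvgD; first apply: cvgD; apply: cvgZr_tmp.
  - apply: cvgD => //; apply: cvgM => //; apply: cvgB; apply: cvgM => //.
      exact: cvgB.
    by apply: cvgB => //; exact: two.
  - apply: cvgD => //; apply: cvgM => //; apply: cvgB; apply: cvgM => //.
      exact: cvgD.
    exact: cvgB.
  - apply: cvgD => //; apply: cvgM => //; apply: cvgD; apply: cvgM => //.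
      by apply: cvgB => //; exact: two.
    exact: cvgD.
exact: (cvg_pair PA PB).
Qed.

(** By [chi_sign], the signs of [chi] at l0 - d and l0 + d enclose the positive root, and these
    signs persist under small changes of the coefficients. *)
Lemma growth_cvg (T : Type) (F : set_system T) (FF : Filter F)
    (rho kap l : T -> R) (r0 k0 l0 : R) :
  rho t @[t --> F] --> r0 -> kap t @[t --> F] --> k0 ->
  sec r0 k0 <= 0 \/ trc r0 k0 <= 0 -> 0 < l0 -> chi (trc r0 k0) (sec r0 k0) l0 = 0 ->
  (\forall t \near F, (sec (rho t) (kap t) <= 0 \/ trc (rho t) (kap t) <= 0) /\
     0 < l t /\ chi (trc (rho t) (kap t)) (sec (rho t) (kap t)) (l t) = 0) ->
  l t @[t --> F] --> l0.
Proof.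
move=> cr ck st0 l00 chi0 lP.
have cst (a : R) : a @[t --> F] --> a by exact: cvg_cst.
have c_trc : trc (rho t) (kap t) @[t --> F] --> trc r0 k0.
  rewrite /trc; apply: cvgB => //; apply: cvgB; last exact: cvgM.
  by apply: cvgB => //; exact: cvgM.
have c_sec : sec (rho t) (kap t) @[t --> F] --> sec r0 k0.
  rewrite /sec; apply: cvgB => //; apply: cvgB; last exact: cvgM.
  by apply: cvgB => //; exact: cvgM.
have c_chi z : chi (trc (rho t) (kap t)) (sec (rho t) (kap t)) z @[t --> F]
    --> chi (trc r0 k0) (sec r0 k0) z.
  by rewrite /chi; apply: cvgB => //; apply: cvgD; [apply: cvgB => //|]; exact: cvgM.
apply/cvgrPdist_lt => e e0; pose d := Num.min e (l0 / 2).
have d0 : 0 < d by rewrite lt_min e0 divr_gt0.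
have [de dl] : d <= e /\ d <= l0 / 2 by rewrite !ge_min !lexx orbT.
have z1 : 0 < l0 - d by lra.
have z2 : 0 < l0 + d by lra.
have [neg _] := chi_sign st0 l00 chi0 z1; have [_ pos] := chi_sign st0 l00 chi0 z2.
have neg' := cvgr_lt _ (c_chi (l0 - d)) _ (neg ltac:(lra)).
have pos' := cvgr_gt _ (c_chi (l0 + d)) _ (pos ltac:(lra)).
near=> t; have [st [lt0 chit]] : (sec (rho t) (kap t) <= 0 \/ trc (rho t) (kap t) <= 0) /\
     0 < l t /\ chi (trc (rho t) (kap t)) (sec (rho t) (kap t)) (l t) = 0.
  by near: t.
have n1 : chi (trc (rho t) (kap t)) (sec (rho t) (kap t)) (l0 - d) < 0 by near: t.
have n2 : 0 < chi (trc (rho t) (kap t)) (sec (rho t) (kap t)) (l0 + d) by near: t.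
have [_ H1] := chi_sign st lt0 chit z1; have [H2 _] := chi_sign st lt0 chit z2.
have a1 : l0 - d < l t.
  rewrite ltNge le_eqVlt; apply/negP => /orP[/eqP tE|/H1]; last lra.
  by rewrite -tE chit ltxx in n1.
have a2 : l t < l0 + d.
  rewrite ltNge le_eqVlt; apply/negP => /orP[/eqP tE|/H2]; last lra.
  by rewrite tE chit ltxx in n2.
by rewrite ltr_norml; lra.
Unshelve. all: by end_near. Qed.

Lemma eigvec_cvg (T : Type) (F : set_system T) (FF : Filter F)
    (rho kap l : T -> R) (r0 k0 l0 : R) : 0 < l0 ->
  rho t @[t --> F] --> r0 -> kap t @[t --> F] --> k0 -> l t @[t --> F] --> l0 ->
  eigvec (rho t) (kap t) (l t) @[t --> F] --> eigvec r0 k0 l0.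
Proof.
move=> l00 cr ck cl; have cst (a : R) : a @[t --> F] --> a by exact: cvg_cst.
have cM : (1 + l t + l t ^+ 2)^-1 @[t --> F] --> (1 + l0 + l0 ^+ 2)^-1.
  apply: cvgV; first by rewrite gt_eqF // !addr_gt0 // exprn_gt0.
  apply: cvgD; first exact: cvgD.
  exact: (continuous_cvg _ (@exprn_continuous R 2 l0) cl).
have cl1 : l t - 1 @[t --> F] --> l0 - 1 by exact: cvgB.
have cd : (l t - 1) * (1 + (1 - rho t) * l t) / (1 + l t + l t ^+ 2) @[t --> F]
    --> (l0 - 1) * (1 + (1 - r0) * l0) / (1 + l0 + l0 ^+ 2).
  apply: cvgM => //; apply: cvgM => //; apply: cvgD => //; apply: cvgM => //.
  exact: cvgB.
have cf : (l t - 1) * (l t + rho t) / (1 + l t + l t ^+ 2) @[t --> F]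
    --> (l0 - 1) * (l0 + r0) / (1 + l0 + l0 ^+ 2).
  by apply: cvgM => //; apply: cvgM => //; exact: cvgD.
apply: (triple_cvg FF cd cf).
by apply: cvgB; apply: cvgM.
Qed.

Lemma eigvec1 (rho kap : R) : eigvec rho kap 1 = (0, 0, 0).
Proof. by rewrite /eigvec subrr !mul0r !mulr0 subrr. Qed.

End VaryingCoefficients.

Section Shrinking.
Context {R : realType} (A B : 'M[R]_3) (la lb : nat -> 'I_3).
Variables (r q rho kap : R).
Hypothesis game : cyclic_game A B la lb r q rho kap.
Variables (l : R) (xi : R * R * R).

Lemma base_equilibrium n : base la lb rho kap n (0, 0, 0) 1 = equilibrium R.
Proof.
have [a1 a2 a3] := base1E game n (0, 0, 0) 1.
have [b1 b2 b3] := base2E game n (0, 0, 0) 1.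
apply: stateP => k; rewrite [RHS]mxE.
  case: (ord3_cover k (cg_la_uniq game n)) => ->; rewrite ?a1 ?a2 ?a3;
    by rewrite !(mulr0, mul0r, subr0, addr0) mul1r.
case: (ord3_cover k (cg_lb_uniq game n)) => ->; rewrite ?b1 ?b2 ?b3;
  by rewrite !(mulr0, mul0r, subr0, addr0) mul1r.
Qed.

Lemma orbE n s : orb la lb rho kap xi n s =
  (1 + s)^-1 *: (base la lb rho kap n xi 1
     + Num.min s xi.1.1 *: vertex (la n) (lb n)
     + Num.max 0 (s - xi.1.1) *: vertex (la n.+1) (lb n)).
Proof.
have [_ _ m _] := base_section game n xi 1.
by rewrite /orb /path_at /cumul m (alpha_base game).
Qed.

Lemma vertex_norm i j : `|vertex i j : state R| <= 1.
Proof.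
apply: state_norm_le => // k; first by rewrite vertex1E; case: eqP; rewrite /= normr_nat.
by rewrite vertex2E; case: eqP; rewrite /= normr_nat.
Qed.

(** Apart from the displacement of the base state, below e, the distance has three terms: the two
    vertices and the share of the equilibrium in the added mass. Each is at most s <= l - 1, which
    explains the factor 3 and the radius 2 e. *)
Lemma cycle_near_equilibrium e : 0 < e -> 1 < l -> 0 <= xi.1.1 -> 3 * (l - 1) <= e ->
  (forall n, (n < 3)%N -> `|base la lb rho kap n xi 1 - equilibrium R| < e) ->
  cycle la lb rho kap l xi `<=` ball (equilibrium R) (2 * e).
Proof.
move=> e0 l1 d0 le base_near x [n [s [s01 ->]]].
rewrite (orb_mod game) orbE; move: (n %% 3)%N (ltn_pmod n (isT : (0 < 3)%N)) => k k3.
have bk := base_near k k3; set E := equilibrium R; set b := base _ _ _ _ k _ _.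
rewrite -/b -/E in bk; rewrite -ball_normE /ball_ /= distrC.
set m1 := Num.min _ _; set m2 := Num.max _ _.
have /andP[s0 sl] := s01.
have m1s : `|m1| <= s.
  by rewrite ger0_norm; [rewrite ge_min lexx|rewrite le_min s0 d0].
have m2s : `|m2| <= s.
  rewrite ger0_norm; last by rewrite le_max lexx.
  by rewrite ge_max s0 gerBl.
have s1 : 0 < 1 + s by lra.
have E1 : `|E| <= 1.
  by apply: state_norm_le => // i; rewrite mxE ger0_norm ?invf_le1 //; lra.
have -> : (1 + s)^-1 *: (b + m1 *: vertex (la k) (lb k) + m2 *: vertex (la k.+1) (lb k)) - E
   = (1 + s)^-1 *: ((b - E) + (m1 *: vertex (la k) (lb k)
        + (m2 *: vertex (la k.+1) (lb k) - s *: E))).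
  have EE : E = (1 + s)^-1 *: (E + s *: E).
    have -> : E + s *: E = (1 + s) *: E by rewrite scalerDl scale1r.
    by rewrite scalerA mulVf ?scale1r ?gt_eqF.
  rewrite {1}EE -scalerBr; congr (_ *: _).
  by rewrite -[b + _ + _]addrA opprD addrACA; congr (_ + _); rewrite addrA.
rewrite normrZ ger0_norm ?invr_ge0 ?(ltW s1) // mulrC ltr_pdivrMr //.
have n1 : `|m1 *: (vertex (la k) (lb k) : state R)| <= s.
  by rewrite normrZ -[leRHS]mulr1 ler_pM // vertex_norm.
have n2 : `|m2 *: (vertex (la k.+1) (lb k) : state R)| <= s.
  by rewrite normrZ -[leRHS]mulr1 ler_pM // vertex_norm.
have n3 : `|s *: E| <= s.
  by rewrite normrZ ger0_norm ?ler_piMr //; case/andP: s01.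
have t1 := ler_normD (b - E) (m1 *: vertex (la k) (lb k) + (m2 *: vertex (la k.+1) (lb k) - s *: E)).
have t2 := ler_normD (m1 *: vertex (la k) (lb k)) (m2 *: vertex (la k.+1) (lb k) - s *: E).
have t3 := ler_normB (m2 *: vertex (la k.+1) (lb k)) (s *: E).
have : 0 <= e * s by rewrite mulr_ge0 ?(ltW e0) //; case/andP: s01.
by lra.
Qed.

End Shrinking.

Lemma shrinks_to_ball (R : realType) (F : set_system R) (FF : Filter F)
    (S : R -> set (state R)) x : (forall b, S b !=set0) ->
  (forall e, 0 < e -> \forall b \near F, S b `<=` ball x e) -> shrinks_to F S x.
Proof.
move=> S0 S_ball; split=> //; apply/cvgrPdist_lt => e e0.
have e4 : 0 < e / 4 by lra.
apply: filterS (S_ball _ e4) => b Sb.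
pose D := [set `|xy.1 - xy.2| | xy in S b `*` S b].
have D_ub : ubound D (e / 2).
  have S_dist u : S b u -> `|x - u| < e / 4 by move/Sb; rewrite -ball_normE.
  move=> _ [[y z] [/S_dist xy /S_dist xz] <-] /=; rewrite distrC in xy.
  by have := ler_distD x y z; rewrite /= in xy xz *; lra.
have [y Sy] := S0 b; have Dy : D 0 by exists (y, y) => //=; rewrite subrr normr0.
have D_sup : has_sup D by split; [exists 0|exists (e / 2)].
have d1 : sup D <= e / 2 by apply: ge_sup => //; exists 0.
have d2 : 0 <= sup D by exact: (ub_le_sup D_sup.2 Dy).
by rewrite /diameter -/D sub0r normrN ger0_norm //; lra.
Qed.

(** * Attraction, saddle type and limits for the two games *)

Section FamilyStability.
Context {R : realType}.
Implicit Type b : R.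

Definition tau_poly b : R := 2 * b ^+ 4 + 6 * b ^+ 3 - 3 * b ^+ 2 - 6 * b + 2.

Lemma cw_sec b : -1 < b -> sec b (cw_kap b) = 2 * b - 2.
Proof. by move=> b1; rewrite /sec /cw_kap; field; lra. Qed.

Lemma cw_trc b : -1 < b -> trc b (cw_kap b) = (1 - 3 * b - b ^+ 2) / (1 + b).
Proof. by move=> b1; rewrite /trc /cw_kap; field; lra. Qed.

Lemma acw_sec b : 0 < b -> sec b^-1 (1 + b) = (1 - 3 * b - b ^+ 2) / b.
Proof. by move=> b0; rewrite /sec; field; lra. Qed.

Lemma acw_trc b : 0 < b -> trc b^-1 (1 + b) = (2 * b ^+ 2 - 2) / b.
Proof. by move=> b0; rewrite /trc; field; lra. Qed.

Lemma acw_trc_lt0 b : 0 < b < 1 -> trc b^-1 (1 + b) < 0.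
Proof.
move=> b01; rewrite acw_trc; last lra.
rewrite ltr_pdivrMr; last lra.
have : 0 < (1 - b) * (1 + b) by rewrite mulr_gt0; lra.
by lra.
Qed.

Lemma acw_sec_trc b : 0 < b ->
  1 - sec b^-1 (1 + b) * trc b^-1 (1 + b) = tau_poly b / b ^+ 2.
Proof. by move=> b0; rewrite acw_sec // acw_trc // /tau_poly; field; lra. Qed.

Lemma range_cw b : -1 < b < sigma R -> range (cw_orbit b) =
  cycle cw_la cw_lb b (cw_kap b) (cw_growth b) (cw_vec b).
Proof.
move=> bs; have [rk l1 _ [s w v]] := cw_growthP bs.
have game := cw_game (andP bs).1.
exact: (orbit_range game rk l1 s w v).
Qed.

Lemma range_acw b : sigma R < b < 1 -> range (acw_orbit b) =
  cycle acw_la acw_lb b^-1 (1 + b) (acw_growth b) (acw_vec b).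
Proof.
move=> bs; have [rk l1 _ [s w v]] := acw_growthP bs.
have b0 : 0 < b by have [s0 _ _] := @sigma_root R; lra.
exact: (orbit_range (acw_game b0) rk l1 s w v).
Qed.

Lemma cw_attracting b : 0 <= b < sigma R ->
  attracting (gameA b) (gameB b) (range (cw_orbit b)).
Proof.
move=> b0s; have [s0 s1 _] := @sigma_root R.
have bs : -1 < b < sigma R by lra.
have b1 : -1 < b by lra.
have [rk l1 chil [s w v]] := cw_growthP bs; rewrite range_cw //.
have sec0 : sec b (cw_kap b) <= 0 by rewrite cw_sec; lra.
have trl := chi_trc (or_introl sec0) l1 chil.
apply: (cycle_attracting (cw_game b1) rk l1 s w v chil trl).
apply: (chi_dominant l1 chil); rewrite cw_sec // cw_trc // mulrA ltr_pdivrMr; last lra.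
(* The claim is 0 < 2 b^3 + 4 b^2 - 7 b + 3. On nonnegative b this cubic has its positive minimum
   near 3/5, which suggests the two squares. *)
have h1 : 0 <= b * (b - 3 / 5) ^+ 2 by rewrite mulr_ge0 ?sqr_ge0 //; lra.
have h2 := sqr_ge0 (b - 3 / 5).
by lra.
Qed.

Lemma acw_attracting b : sigma R < b < 1 -> 0 < tau_poly b ->
  attracting (gameA b) (gameB b) (range (acw_orbit b)).
Proof.
move=> bs tb; have [s0 s1 _] := @sigma_root R.
have b0 : 0 < b by lra.
have [rk l1 chil [s w v]] := acw_growthP bs; rewrite range_acw //.
have trc0 : trc b^-1 (1 + b) < 0 by apply: acw_trc_lt0; lra.
have trl := chi_trc (or_intror (ltW trc0)) l1 chil.
apply: (cycle_attracting (acw_game b0) rk l1 s w v chil trl).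
apply: (chi_dominant l1 chil).
by rewrite -subr_gt0 acw_sec_trc // divr_gt0 // exprn_gt0.
Qed.

Lemma acw_saddle b : sigma R < b < 1 -> tau_poly b < 0 ->
  saddle_type (gameA b) (gameB b) (acw_orbit b).
Proof.
move=> bs tb; have [s0 s1 _] := @sigma_root R.
have b0 : 0 < b by lra.
have [rk l1 chil [s w v]] := acw_growthP bs.
have trc0 : trc b^-1 (1 + b) < 0 by apply: acw_trc_lt0; lra.
have trl := chi_trc (or_intror (ltW trc0)) l1 chil.
apply: (orbit_saddle (acw_game b0) rk l1 s w v chil trl).
apply: (chi_not_dominant l1 chil trc0).
by rewrite -subr_lt0 acw_sec_trc // pmulr_llt0 // invr_gt0 exprn_gt0.
Qed.

Lemma near_eigvec_cycle (F : set_system R) (FF : Filter F) la lb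
    (rho kap l : R -> R) (r0 k0 : R) (A B : R -> 'M[R]_3) (r q : R -> R)
    (A0 B0 : 'M[R]_3) rr qq :
  cyclic_game A0 B0 la lb rr qq r0 k0 ->
  rho b @[b --> F] --> r0 -> kap b @[b --> F] --> k0 -> l b @[b --> F] --> (1 : R) ->
  (\forall b \near F, cyclic_game (A b) (B b) la lb (r b) (q b) (rho b) (kap b) /\
     1 < l b /\ 0 <= (eigvec (rho b) (kap b) (l b)).1.1) ->
  forall e, 0 < e -> \forall b \near F,
    cycle la lb (rho b) (kap b) (l b) (eigvec (rho b) (kap b) (l b))
    `<=` ball (equilibrium R) e.
Proof.
move=> game0 cr ck cl nP e e0.
have cv : eigvec (rho b) (kap b) (l b) @[b --> F] --> (0 : R, 0 : R, 0 : R).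
  by rewrite -(eigvec1 r0 k0); exact: eigvec_cvg.
have e2 : 0 < e / 2 by rewrite divr_gt0.
have e3 : 0 < e / 6 by rewrite divr_gt0.
have nb (n : 'I_3) : \forall b \near F,
    `|base la lb (rho b) (kap b) n (eigvec (rho b) (kap b) (l b)) 1
       - equilibrium R| < e / 2.
  have cb := @base_param_cvg _ la lb _ F FF n _ _ _ _ _ _ cr ck cv.
  rewrite (base_equilibrium game0) in cb.
  by move/cvgrPdist_lt: cb => /(_ _ e2); apply: filterS => b; rewrite distrC.
have nbs := filter_forall _ nb.
have nl : \forall b \near F, `|1 - l b| < e / 6 by move/cvgrPdist_lt: cl; apply.
apply: (filterS3 _ _ nP nl (nbs FF)) => b [game [l1 d0]] lb1 bb.
rewrite -(mulfVK (_ : 2 != 0 :> R) e) // mulrC.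
apply: (cycle_near_equilibrium game e2 l1 d0).
  by rewrite ltr_norml in lb1; lra.
by move=> n n3; exact: (bb (Ordinal n3)).
Qed.

End FamilyStability.

Section FamilyLimits.
Context {R : realType}.
Implicit Type b : R.
Local Notation sigma := (sigma R).

Lemma inv_onep_sigma : (1 + sigma)^-1 = sigma.
Proof.
have [s0 s1 sE] := @sigma_root R; have h : 1 + sigma != 0 by rewrite gt_eqF //; lra.
by apply: (mulfI h); rewrite divff //; lra.
Qed.

Lemma inv_sigma : sigma^-1 = 1 + sigma.
Proof.
have [s0 s1 sE] := @sigma_root R.
by apply: (mulfI (lt0r_neq0 s0)); rewrite divff ?gt_eqF //; lra.
Qed.

Lemma cw_kap_cvg (T : Type) (F : set_system T) (FF : Filter F) (f : T -> R) b :
  -1 < b -> f x @[x --> F] --> b -> cw_kap (f x) @[x --> F] --> cw_kap b.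
Proof.
move=> b1 fb; apply: cvgV; first by rewrite gt_eqF //; lra.
by apply: cvgD; [exact: cvg_cst|].
Qed.

Lemma cw_sec_le0 b : -1 < b < sigma -> sec b (cw_kap b) <= 0.
Proof. by move=> bs; have [s0 s1 _] := @sigma_root R; rewrite cw_sec; lra. Qed.

Lemma cw_growth_cvg (T : Type) (F : set_system T) (FF : Filter F) (f : T -> R) b l :
  -1 < b -> b < 1 -> f x @[x --> F] --> b -> (\forall x \near F, -1 < f x < sigma) ->
  0 < l -> chi (trc b (cw_kap b)) (sec b (cw_kap b)) l = 0 ->
  cw_growth (f x) @[x --> F] --> l.
Proof.
move=> b1 b1' fb nF l0 chil.
apply: (growth_cvg FF fb (cw_kap_cvg FF b1 fb) _ l0 chil).
  by left; rewrite cw_sec //; lra.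
apply: filterS nF => x fx; have [_ l1 chix _] := cw_growthP fx.
by split; [left; exact: cw_sec_le0|split=> //; lra].
Qed.

Lemma cw_shrinks :
  shrinks_to sigma^'- (fun b => range (cw_orbit b)) (equilibrium R).
Proof.
have [s0 s1 sE] := @sigma_root R; have sm1 : -1 < sigma by lra.
have nF : \forall b \near sigma^'-, -1 < b < sigma.
  by near=> b; apply/andP; split; near: b; [exact: nbhs_left_gt|exact: nbhs_left_lt].
have cid : b @[b --> sigma^'-] --> sigma by apply: cvg_at_left_filter; exact: cvg_id.
have FF : Filter sigma^'- by exact: at_left_proper_filter.
have ck := cw_kap_cvg FF sm1 cid.
have chi1 : chi (trc sigma (cw_kap sigma)) (sec sigma (cw_kap sigma)) 1 = 0.
  by rewrite /cw_kap inv_onep_sigma /chi /trc /sec; ring.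
have cl := cw_growth_cvg FF sm1 s1 cid nF ltr01 chi1.
apply: (shrinks_to_ball FF) => [b|e e0]; first by exists (cw_orbit b 0), 0.
have nP : \forall b \near sigma^'-,
    cyclic_game (gameA b) (gameB b) cw_la cw_lb 1 (1 + b) b (cw_kap b) /\
    1 < cw_growth b /\ 0 <= (eigvec b (cw_kap b) (cw_growth b)).1.1.
  apply: filterS nF => b bs; have [_ l1 _ [_ _ v]] := cw_growthP bs.
  by split; [exact: cw_game (andP bs).1|split=> //; rewrite ltW //; case: v].
apply: (filterS2 _ _ nF (near_eigvec_cycle FF (cw_game sm1) cid ck cl nP e0)).
by move=> b bs; rewrite range_cw.
Unshelve. all: by end_near. Qed.

Lemma acw_shrinks :
  shrinks_to sigma^'+ (fun b => range (acw_orbit b)) (equilibrium R).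
Proof.
have [s0 s1 sE] := @sigma_root R.
have nF : \forall b \near sigma^'+, sigma < b < 1.
  by near=> b; apply/andP; split; near: b; [exact: nbhs_right_gt|exact: nbhs_right_lt].
have cid : b @[b --> sigma^'+] --> sigma by apply: cvg_at_right_filter; exact: cvg_id.
have FF : Filter sigma^'+ by exact: at_right_proper_filter.
have cr : b^-1 @[b --> sigma^'+] --> sigma^-1 by apply: cvgV => //; rewrite gt_eqF.
have ck : 1 + b @[b --> sigma^'+] --> 1 + sigma by apply: cvgD => //; exact: cvg_cst.
have chi1 : chi (trc sigma^-1 (1 + sigma)) (sec sigma^-1 (1 + sigma)) 1 = 0.
  by rewrite inv_sigma /chi /trc /sec; ring.
have st : sec sigma^-1 (1 + sigma) <= 0 \/ trc sigma^-1 (1 + sigma) <= 0.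
  by right; rewrite ltW // acw_trc_lt0 // s0.
have cl : acw_growth b @[b --> sigma^'+] --> (1 : R).
  apply: (growth_cvg FF cr ck st ltr01 chi1).
  apply: filterS nF => b bs; have [_ l1 chib _] := acw_growthP bs.
  split; first by right; rewrite ltW // acw_trc_lt0 //; lra.
  by split=> //; lra.
apply: (shrinks_to_ball FF) => [b|e e0]; first by exists (acw_orbit b 0), 0.
have nP : \forall b \near sigma^'+,
    cyclic_game (gameA b) (gameB b) acw_la acw_lb b 1 b^-1 (1 + b) /\
    1 < acw_growth b /\ 0 <= (eigvec b^-1 (1 + b) (acw_growth b)).1.1.
  apply: filterS nF => b bs; have [_ l1 _ [_ _ v]] := acw_growthP bs.
  split; first by apply: acw_game; lra.
  by split=> //; rewrite ltW //; case: v.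
apply: (filterS2 _ _ nF (near_eigvec_cycle FF (acw_game s0) cr ck cl nP e0)).
by move=> b bs; rewrite range_acw.
Unshelve. all: by end_near. Qed.

Lemma cw_near b : -1 < b < sigma -> \forall b' \near b, -1 < b' < sigma.
Proof.
move=> /andP[b1 b2].
have n1 : \forall b' \near b, -1 < b' by exact: (cvgr_gt _ (@cvg_id _ (nbhs b)) _ b1).
have n2 : \forall b' \near b, b' < sigma by exact: (cvgr_lt _ (@cvg_id _ (nbhs b)) _ b2).
by apply: (filterS2 _ _ n1 n2) => b' -> ->.
Qed.

Lemma cw_growth_continuous b : -1 < b < sigma -> {for b, continuous cw_growth}.
Proof.
move=> bs; have [_ l1 chib _] := cw_growthP bs; have [s0 s1 _] := @sigma_root R.
by apply: (cw_growth_cvg _ _ _ cvg_id (cw_near bs) _ chib); lra.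
Qed.

Lemma cw_period_continuous b : -1 < b < sigma ->
  {for b, continuous (fun b => 3 * ln (cw_growth b))}.
Proof.
move=> bs; have [_ l1 _ _] := cw_growthP bs.
apply: cvgM; first exact: cvg_cst.
apply: (continuous_cvg _ (continuous_ln _) (cw_growth_continuous bs)); lra.
Qed.

End FamilyLimits.

Section JointContinuity.
Context {R : realType}.
Implicit Type b t : R.

(* The formula for the orbit in its [j]-th phase, extended to all times. *)
Definition cw_branch (j : int) (x : R * R) : state R :=
  orb cw_la cw_lb x.1 (cw_kap x.1) (cw_vec x.1) `|(j %% 3)%Z|%N
    (expR (x.2 - j%:~R * ln (cw_growth x.1)) - 1).

Lemma cw_branch_succ b j : -1 < b < sigma R ->
  cw_branch j (b, (j + 1)%:~R * ln (cw_growth b)) =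
  cw_branch (j + 1) (b, (j + 1)%:~R * ln (cw_growth b)).
Proof.
move=> bs; have [rk l1 _ [s w v]] := cw_growthP bs.
have game := cw_game (andP bs).1.
rewrite /cw_branch /= subrr expR0 subrr.
have -> : (j + 1)%:~R * ln (cw_growth b) - j%:~R * ln (cw_growth b) = ln (cw_growth b).
  by rewrite intrD; ring.
rewrite lnK ?posrE; last lra.
rewrite (orb_end game rk l1 s w v) (orb_mod game).
congr (orb _ _ _ _ _ _ _); lia.
Qed.

Lemma cw_branch_cvg b t j : -1 < b < sigma R ->
  cw_branch j x @[x --> (b, t)] --> cw_branch j (b, t).
Proof.
move=> bs; have [rk l1 _ [s w v]] := cw_growthP bs.
have game := cw_game (andP bs).1.
have c1 : x.1 @[x --> (b, t)] --> b by exact: cvg_fst.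
have c2 : x.2 @[x --> (b, t)] --> t by exact: cvg_snd.
have cl : cw_growth x.1 @[x --> (b, t)] --> cw_growth b.
  exact: (continuous_cvg _ (cw_growth_continuous bs) c1).
have cln : ln (cw_growth x.1) @[x --> (b, t)] --> ln (cw_growth b).
  by apply: (continuous_cvg _ (continuous_ln _) cl); lra.
have b1 : -1 < b by case/andP: bs.
have FF : Filter (nbhs (b, t)) by exact: nbhs_filter.
have ck := cw_kap_cvg FF b1 c1.
have cv : cw_vec x.1 @[x --> (b, t)] --> cw_vec b.
  exact: (eigvec_cvg FF (lt_trans ltr01 l1) c1 ck cl).
have cs : expR (x.2 - j%:~R * ln (cw_growth x.1)) - 1 @[x --> (b, t)]
    --> expR (t - j%:~R * ln (cw_growth b)) - 1.
  apply: cvgB; last exact: cvg_cst.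
  have cs' : x.2 - j%:~R * ln (cw_growth x.1) @[x --> (b, t)]
      --> t - j%:~R * ln (cw_growth b).
    by apply: cvgB => //; apply: cvgM => //; exact: cvg_cst.
  exact: (continuous_cvg _ (@continuous_expR R _) cs').
set n := `|(j %% 3)%Z|%N; have cb := @base_param_cvg _ cw_la cw_lb _ _ FF n _ _ _ _ _ _ c1 ck cv.
have cd : (cw_vec x.1).1.1 @[x --> (b, t)] --> (cw_vec b).1.1.
  exact: (continuous_cvg _ (@coord11_continuous R _) cv).
move: cs; pose s0 := expR (t - j%:~R * ln (cw_growth b)) - 1; rewrite -/s0 => cs.
have cs1 : (1 + (expR (x.2 - j%:~R * ln (cw_growth x.1)) - 1))^-1 @[x --> (b, t)]
    --> (1 + s0)^-1.
  apply: cvgV; first by rewrite /s0 addrC subrK gt_eqF // expR_gt0.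
  by apply: cvgD => //; exact: cvg_cst.
pose u (x : R * R) := expR (x.2 - j%:~R * ln (cw_growth x.1)) - 1.
have cm1 : Num.min (u x) (cw_vec x.1).1.1 *: vertex (cw_la n) (cw_lb n) @[x --> (b, t)]
    --> Num.min s0 (cw_vec b).1.1 *: (vertex (cw_la n) (cw_lb n) : state R).
  by apply: cvgZr_tmp; exact: (cvg_minr2 FF cs cd).
have cm2 : Num.max 0 (u x - (cw_vec x.1).1.1) *: vertex (cw_la n.+1) (cw_lb n)
    @[x --> (b, t)]
    --> Num.max 0 (s0 - (cw_vec b).1.1) *: (vertex (cw_la n.+1) (cw_lb n) : state R).
  by apply: cvgZr_tmp; apply: (cvg_maxr2 FF (cvg_cst 0)); exact: cvgB.
have nb : \forall x \near (b, t), -1 < x.1 < sigma R by exact: (c1 _ (cw_near bs)).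
have nE : \forall x \near nbhs (b, t), (1 + u x)^-1 *:
    (base cw_la cw_lb x.1 (cw_kap x.1) n (cw_vec x.1) 1
     + Num.min (u x) (cw_vec x.1).1.1 *: vertex (cw_la n) (cw_lb n)
     + Num.max 0 (u x - (cw_vec x.1).1.1) *: vertex (cw_la n.+1) (cw_lb n))
    = cw_branch j x.
  by apply: filterS nb => x xs; rewrite /cw_branch (orbE (cw_game (andP xs).1)).
have -> : cw_branch j (b, t) = (1 + s0)^-1 *:
    (base cw_la cw_lb b (cw_kap b) n (cw_vec b) 1
     + Num.min s0 (cw_vec b).1.1 *: vertex (cw_la n) (cw_lb n)
     + Num.max 0 (s0 - (cw_vec b).1.1) *: vertex (cw_la n.+1) (cw_lb n)).
  by rewrite /cw_branch (orbE game).
apply: (cvg_trans (near_eq_cvg nE)).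
exact: (cvgZ cs1 (cvgD (cvgD cb cm1) cm2)).
Qed.

(** Away from the multiples of [ln (cw_growth b)] the floor is locally constant and one branch
    describes the orbit. At a multiple, nearby points use one of two consecutive branches, which
    agree there by [cw_branch_succ]. *)
Lemma cw_orbit_continuous b t : -1 < b < sigma R ->
  {for (b, t), continuous (fun x : R * R => cw_orbit x.1 x.2)}.
Proof.
move=> bs; have [rk l1 _ [s w v]] := cw_growthP bs.
have c1 : x.1 @[x --> (b, t)] --> b by exact: cvg_fst.
have c2 : x.2 @[x --> (b, t)] --> t by exact: cvg_snd.
have cl : cw_growth x.1 @[x --> (b, t)] --> cw_growth b.
  exact: (continuous_cvg _ (cw_growth_continuous bs) c1).
have cln : ln (cw_growth x.1) @[x --> (b, t)] --> ln (cw_growth b).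
  by apply: (continuous_cvg _ (continuous_ln _) cl); lra.
have ln0 : 0 < ln (cw_growth b) by exact: ln_gt0.
have cu : x.2 / ln (cw_growth x.1) @[x --> (b, t)] --> t / ln (cw_growth b).
  by apply: cvgM => //; apply: cvgV => //; rewrite gt_eqF.
pose k := Num.floor (t / ln (cw_growth b)).
have [k1 k2] : k%:~R <= t / ln (cw_growth b) /\ t / ln (cw_growth b) < (k + 1)%:~R.
  by rewrite floor_le ?floorD1_gt.
have orbitE x : cw_orbit x.1 x.2 = cw_branch (Num.floor (x.2 / ln (cw_growth x.1))) x.
  by [].
have FF : Filter (nbhs (b, t)) by exact: nbhs_filter.
have nlt : \forall x \near (b, t), x.2 / ln (cw_growth x.1) < (k + 1)%:~R.
  exact: (cvgr_lt _ cu _ k2).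
have cont j := @cw_branch_cvg b t j bs.
rewrite /prop_for /continuous_at orbitE -/k; apply/cvgrPdist_lt => e e0.
have nk : \forall x \near (b, t), `|cw_branch k (b, t) - cw_branch k x| < e.
  by move/cvgrPdist_lt: (cont k); apply.
move: k1; rewrite le_eqVlt => /orP[/eqP tE|k1].
  have tE' : t = k%:~R * ln (cw_growth b) by rewrite tE divfK ?gt_eqF.
  have nk' : \forall x \near (b, t), `|cw_branch k (b, t) - cw_branch (k - 1) x| < e.
    have := cw_branch_succ (k - 1) bs; rewrite subrK -tE' => <-.
    by move/cvgrPdist_lt: (cont (k - 1)); apply.
  have ngt : \forall x \near (b, t), (k - 1)%:~R < x.2 / ln (cw_growth x.1).
    by apply: (cvgr_gt _ cu); rewrite -tE ltr_int; lia.
  apply: (filterS3 FF _ nk nk' (filterI nlt ngt)) => x xk xk' [h1 h2].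
  rewrite orbitE; have [h3|h3] := leP k%:~R (x.2 / ln (cw_growth x.1)).
    by rewrite (floor_def (m := k)) ?h3.
  by rewrite (floor_def (m := k - 1)) // subrK h3 ltW.
have ngt : \forall x \near (b, t), k%:~R < x.2 / ln (cw_growth x.1).
  exact: (cvgr_gt _ cu _ k1).
apply: (filterS3 FF _ nk nlt ngt) => x xk h1 h2.
by rewrite orbitE (floor_def (m := k)) // h1 ltW.
Qed.

End JointContinuity.

(** * The value tau *)

Section TransitionMatrix.
Context {R : realType}.
Implicit Types b mu t : R.

Lemma det_mx33 (F : comNzRingType) (M : 'M[F]_3) :
  let a i j := M (ord3 i) (ord3 j) in
  \det M = a 0 0 * (a 1 1 * a 2 2 - a 1 2 * a 2 1)
    - a 0 1 * (a 1 0 * a 2 2 - a 1 2 * a 2 0)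
    + a 0 2 * (a 1 0 * a 2 1 - a 1 1 * a 2 0).
Proof.
move=> a; have aE (i j : 'I_3) : M i j = a i j.
  by rewrite /a; congr (M _ _); apply: val_inj; rewrite /= modn_small.
rewrite (expand_det_row _ ord0) !big_ord_recl big_ord0 /cofactor.
rewrite !(expand_det_row _ ord0) !big_ord_recl !big_ord0 /cofactor !det_mx11 !mxE.
rewrite !aE /= /bump /= !(expr0, expr1, addn0, add0n) /=.
by rewrite ?sqrrN ?expr1n; ring.
Qed.

Lemma mu_unique b : 0 < b < 1 -> exists! mu, is_mu b mu.
Proof.
move=> b01; have b0 : 0 < b by lra.
have b2 := exprn_gt0 2 b0; have b3 := exprn_gt0 3 b0.
have f0 : mu_poly b 0 < 0 by rewrite /mu_poly; lra.
have f1 : 0 < mu_poly b 3^-1.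
  have -> : mu_poly b 3^-1 = (2 * b ^+ 3 + 1) / 9 by rewrite /mu_poly; field.
  by rewrite divr_gt0 //; lra.
have cont : continuous (mu_poly b).
  move=> z; have cst (u : R) : u @[_ --> z] --> u by exact: cvg_cst.
  have czn n : y ^+ n @[y --> z] --> z ^+ n by exact: exprn_continuous.
  apply: cvgB => //; apply: cvgD; first apply: cvgB; apply: cvgM => //; exact: czn.
have le3 : (0 : R) <= 3^-1 by lra.
have [||mu] := @IVT R (mu_poly b) 0 3^-1 0 le3.
- exact/continuous_subspaceT/cont.
- by rewrite min_l ?max_r ?(ltW f0) ?(ltW f1) // (ltW (lt_trans f0 f1)).
rewrite in_itv /= => /andP[m0 m1] fm.
have is_mu_mu : is_mu b mu.
  split=> //; apply/andP; split; rewrite lt_neqAle ?m0 ?m1 andbT; apply/eqP => mE.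
    by rewrite -mE in fm; rewrite fm ltxx in f0.
  by rewrite mE in fm; rewrite fm ltxx in f1.
exists mu; split=> // z [z01 fz]; apply/eqP; apply: contraT => mz; exfalso.
have [m01 _] := is_mu_mu.
(* Lagrange interpolation at [mu], [z] and [1/3]. *)
have E : mu_poly b 3^-1 * (mu - z) = (3^-1 - z) * mu_poly b mu - (3^-1 - mu) * mu_poly b z
    + (mu - z) * ((3^-1 - mu) * (3^-1 - z)
       * ((3 * b + 3 * b ^+ 2 + 3 * b ^+ 3) * (3^-1 + mu + z)
          - (5 * b ^+ 3 + 7 * b ^+ 2 + 4 * b + 2))).
  by rewrite /mu_poly; ring.
rewrite fm fz !mulr0 subrr add0r [RHS]mulrC in E.
have {}E := mulIf (_ : mu - z != 0) E; rewrite subr_eq0 in E.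
have neg : (3 * b + 3 * b ^+ 2 + 3 * b ^+ 3) * (3^-1 + mu + z)
    - (5 * b ^+ 3 + 7 * b ^+ 2 + 4 * b + 2) < 0.
  have : (3 * b + 3 * b ^+ 2 + 3 * b ^+ 3) * (3^-1 + mu + z)
      <= (3 * b + 3 * b ^+ 2 + 3 * b ^+ 3) * 1 by rewrite ler_wpM2l; lra.
  by lra.
have pos : 0 < (3^-1 - mu) * (3^-1 - z) by rewrite mulr_gt0; lra.
by have := E mz => E'; move: f1; rewrite E' pmulr_rgt0 //; lra.
Qed.

Definition n2_num b mu : R :=
  2 * b ^+ 2 + 1 - 3 * mu * b ^+ 3 - 5 * mu * b ^+ 2 - 2 * mu * b - 2 * mu
   + 3 * mu ^+ 2 * b ^+ 2 + 3 * mu ^+ 2 * b + 3 * mu ^+ 2 * b ^+ 3.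

Lemma n1_gt0 b mu : 0 < b -> mu < 3^-1 -> 0 < n1 b mu.
Proof.
move=> b0 m; have -> : n1 b mu = b * (1 - mu) by rewrite /n1; ring.
by rewrite mulr_gt0; lra.
Qed.

Lemma n2_gt0 b mu : 0 < b < 1 -> 0 < mu < 3^-1 -> 0 < n2 b mu.
Proof.
move=> b01 m01; have b0 : 0 < b by lra.
have b2 := exprn_gt0 2 b0; have b3 := exprn_gt0 3 b0.
rewrite /n2 divr_gt0 -?/(n2_num b mu) //; last lra.
(* Expansion at mu = 1/3, where the value is visibly positive; the remaining factor is positive
   because mu + 1/3 < 2/3. *)
have -> : n2_num b mu = (1 - b) * (2 * b ^+ 2 + 1) / 3
    + (3^-1 - mu) * (3 * b ^+ 3 + 5 * b ^+ 2 + 2 * b + 2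
       - 3 * (b + b ^+ 2 + b ^+ 3) * (mu + 3^-1)).
  by rewrite /n2_num; field.
have h : 3 * (b + b ^+ 2 + b ^+ 3) * (mu + 3^-1) <= 3 * (b + b ^+ 2 + b ^+ 3) * (2 / 3).
  by rewrite ler_wpM2l; lra.
rewrite addr_gt0 // ?divr_gt0 ?mulr_gt0 //; lra.
Qed.

(* [n1 / n2] is the growth factor of a phase of the orbit. *)
Lemma n1_n2_chi b mu : 0 < b -> mu_poly b mu = 0 ->
  b * n1 b mu ^+ 3 - (2 * b ^+ 2 - 2) * n1 b mu ^+ 2 * n2 b mu
  + (1 - 3 * b - b ^+ 2) * n1 b mu * n2 b mu ^+ 2 - b * n2 b mu ^+ 3 = 0.
Proof.
move=> b0 mu0; have S0 : 1 + b + b ^+ 2 != 0 by rewrite gt_eqF // !addr_gt0 // exprn_gt0.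
(* The quotient of the cleared identity by [mu_poly b], as polynomials in [mu]. *)
pose quo := (- 9 * b ^+ 7 - 18 * b ^+ 6 - 27 * b ^+ 5 - 18 * b ^+ 4 - 9 * b ^+ 3)
       * mu ^+ 3
   + (3 * b ^+ 8 + 27 * b ^+ 7 + 60 * b ^+ 6 + 69 * b ^+ 5 + 54 * b ^+ 4 + 21 * b
       ^+ 3 + 9 * b ^+ 2) * mu ^+ 2
   + (- 6 * b ^+ 8 - 27 * b ^+ 7 - 62 * b ^+ 6 - 63 * b ^+ 5 - 49 * b ^+ 4 - 25 *
       b ^+ 3 - 9 * b ^+ 2 - 2 * b) * mu
   + (3 * b ^+ 8 + 9 * b ^+ 7 + 20 * b ^+ 6 + 21 * b ^+ 5 + 14 * b ^+ 4 + 10 * b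
       ^+ 3 + 3 * b ^+ 2 + b).
have E : b * n1 b mu ^+ 3 * (1 + b + b ^+ 2) ^+ 3
    - (2 * b ^+ 2 - 2) * n1 b mu ^+ 2 * n2_num b mu * (1 + b + b ^+ 2) ^+ 2
    + (1 - 3 * b - b ^+ 2) * n1 b mu * n2_num b mu ^+ 2 * (1 + b + b ^+ 2)
    - b * n2_num b mu ^+ 3 = quo * mu_poly b mu.
  by rewrite /quo /n1 /n2_num /mu_poly; ring.
rewrite mu0 mulr0 in E.
rewrite /n2 -/(n2_num b mu); move: E; move: (n1 b mu) (n2_num b mu) => x y E.
apply: (mulfI (expf_neq0 3 S0)); rewrite mulr0 -[RHS]E.
by field.
Qed.

(** With l = n1 / n2 the last factor is b n2^2 (1 + trc l^2) for the anticlockwise [trc], and the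
    other factors are positive in the range of interest: -1 is an eigenvalue exactly when dominance
    is lost. *)
Lemma det_transition b mu : 0 < b -> n1 b mu != 0 -> mu_poly b mu = 0 ->
  b * n1 b mu ^+ 4 * \det (transition_mx b mu + 1%:M) =
  n2 b mu * (n1 b mu + n2 b mu) * (b * n2 b mu ^+ 2 + (2 * b ^+ 2 - 2) * n1 b mu ^+ 2).
Proof.
move=> b0 x0 mu0; have S0 : 1 + b + b ^+ 2 != 0 by rewrite gt_eqF // !addr_gt0 // exprn_gt0.
have b0' : b != 0 by rewrite gt_eqF.
pose quo := (27 * b ^+ 14 + 54 * b ^+ 13 + 81 * b ^+ 12 + 27 * b ^+ 11 - 27 * b ^+
       10 - 81 * b ^+ 9 - 54 * b ^+ 8 - 27 * b ^+ 7) * mu ^+ 6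
   + (- 99 * b ^+ 14 - 279 * b ^+ 13 - 405 * b ^+ 12 - 342 * b ^+ 11 - 63 * b ^+
       10 + 108 * b ^+ 9 + 198 * b ^+ 8 + 99 * b ^+ 7 + 54 * b ^+ 6) * mu ^+ 5
   + (147 * b ^+ 14 + 588 * b ^+ 13 + 957 * b ^+ 12 + 1092 * b ^+ 11 + 705 * b ^+
       10 + 264 * b ^+ 9 - 69 * b ^+ 8 - 159 * b ^+ 7 - 87 * b ^+ 6 - 36 * b ^+ 5)
       * mu ^+ 4
   + (- 120 * b ^+ 14 - 650 * b ^+ 13 - 1290 * b ^+ 12 - 1629 * b ^+ 11 - 1509 * b
       ^+ 10 - 858 * b ^+ 9 - 378 * b ^+ 8 + 18 * b ^+ 7 + 42 * b ^+ 6 + 48 * b ^+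
       5 + 8 * b ^+ 4) * mu ^+ 3
   + (63 * b ^+ 14 + 402 * b ^+ 13 + 984 * b ^+ 12 + 1317 * b ^+ 11 + 1401 * b ^+
       10 + 978 * b ^+ 9 + 519 * b ^+ 8 + 180 * b ^+ 7 + 9 * b ^+ 6 - 9 * b ^+ 5 -
       12 * b ^+ 4) * mu ^+ 2
   + (- 21 * b ^+ 14 - 135 * b ^+ 13 - 387 * b ^+ 12 - 567 * b ^+ 11 - 610 * b ^+
       10 - 514 * b ^+ 9 - 265 * b ^+ 8 - 152 * b ^+ 7 - 17 * b ^+ 6 - 11 * b ^+ 5
       + 6 * b ^+ 4) * mu
   + (3 * b ^+ 14 + 20 * b ^+ 13 + 60 * b ^+ 12 + 102 * b ^+ 11 + 103 * b ^+ 10 +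
       103 * b ^+ 9 + 50 * b ^+ 8 + 37 * b ^+ 7 + 5 * b ^+ 6 + 4 * b ^+ 5 - b ^+
       4).
(* The determinant identity with denominators cleared; [quo] is its quotient by [mu_poly b]. Once
   expanded in b and mu, it is used with S, x and y as atoms, which keeps the final [field]
   small. *)
have E : forall S x y, S = 1 + b + b ^+ 2 -> x = n1 b mu -> y = n2_num b mu ->
    x * ((y * (b * (3 + 2 * b) - 2 * x * (2 + b)) + x * b * S)
          * ((x * b * S ^+ 2 - y * y * (2 + b)) * (y * (3 * x - 2 * b) * b + x * b ^+ 2 * S)
             + y * 3 * y * b * (y * (b - (b - x) * (2 + b))))
        - y * (b * (1 - x + b) - 2 * x)
          * (y * (b * S - 2 * y * (2 + b)) * (y * (3 * x - 2 * b) * b + x * b ^+ 2 * S)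
             + y * 3 * y * b * (y * (2 * b - 2 * (b - x) * (2 + b))))
        + y * (3 * b ^+ 2 - 3 * x * b)
          * (y * (b * S - 2 * y * (2 + b)) * (y * (b - (b - x) * (2 + b)))
             - (x * b * S ^+ 2 - y * y * (2 + b)) * (y * (2 * b - 2 * (b - x) * (2 + b)))))
    - b ^+ 3 * y * (x * S + y) * (b * y ^+ 2 + (2 * b ^+ 2 - 2) * x ^+ 2 * S ^+ 2)
    = quo * mu_poly b mu.
  by move=> _ _ _ -> -> ->; rewrite /quo /n1 /n2_num /mu_poly; ring.
have {}E := E _ _ _ erefl erefl erefl; rewrite mu0 mulr0 in E.
rewrite det_mx33 /= !mxE /= /n2 -/(n2_num b mu) /= !addr0.
clear quo mu0; move: x0 S0 E.
move: (n1 b mu) (n2_num b mu) (1 + b + b ^+ 2) => x y S x0 S0 E.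
apply: (mulfI (mulf_neq0 (expf_neq0 4 S0) (expf_neq0 3 b0'))).
apply/eqP; rewrite -subr_eq0 -[X in _ == X]E; apply/eqP.
by field; rewrite x0 S0 b0'.
Qed.

Lemma n1_n2_tau b mu : 0 < b < 1 -> is_mu b mu ->
  (b * n2 b mu ^+ 2 + (2 * b ^+ 2 - 2) * n1 b mu ^+ 2 == 0) = (tau_poly b == 0).
Proof.
move=> b01 [m01 mu0]; have b0 : 0 < b by lra.
have x0 : 0 < n1 b mu by apply: n1_gt0; lra.
have y0 : 0 < n2 b mu by exact: n2_gt0.
have chi0 := n1_n2_chi b0 mu0; move: x0 y0 chi0; move: (n1 b mu) (n2 b mu) => x y x0 y0.
have u0 : 2 * b ^+ 2 - 2 < 0.
  by have : 0 < (1 - b) * (1 + b); [rewrite mulr_gt0; lra|lra].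
have tE : tau_poly b = b ^+ 2 - (2 * b ^+ 2 - 2) * (1 - 3 * b - b ^+ 2).
  by rewrite /tau_poly; ring.
rewrite tE; move: u0 (1 - 3 * b - b ^+ 2); move: (2 * b ^+ 2 - 2) => u u0 s chi0.
apply/eqP/eqP => E.
  have E1 : b * x ^+ 2 + s * y ^+ 2 = 0.
    apply: (mulfI (lt0r_neq0 x0)); rewrite mulr0.
    have -> : x * (b * x ^+ 2 + s * y ^+ 2) =
        (b * x ^+ 3 - u * x ^+ 2 * y + s * x * y ^+ 2 - b * y ^+ 3)
        + y * (b * y ^+ 2 + u * x ^+ 2) by ring.
    by rewrite chi0 E mulr0 addr0.
  apply: (mulfI (expf_neq0 2 (lt0r_neq0 y0))); rewrite mulr0.
  have -> : y ^+ 2 * (b ^+ 2 - u * s) =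
      b * (b * y ^+ 2 + u * x ^+ 2) - u * (b * x ^+ 2 + s * y ^+ 2) by ring.
  by rewrite E E1 !mulr0 subrr.
have neg : u * y - b * x < 0.
  by have := mulr_gt0 b0 x0; have := nmulr_rlt0 y u0; rewrite y0; lra.
apply: (mulfI (ltr0_neq0 neg)); rewrite mulr0.
have -> : (u * y - b * x) * (b * y ^+ 2 + u * x ^+ 2) =
    - u * (b * x ^+ 3 - u * x ^+ 2 * y + s * x * y ^+ 2 - b * y ^+ 3)
    - x * y ^+ 2 * (b ^+ 2 - u * s) by ring.
by rewrite chi0 E !mulr0 subrr.
Qed.

Lemma is_tauE t : is_tau t <-> sigma R < t < 1 /\ tau_poly t = 0.
Proof.
have [s0 s1 _] := @sigma_root R.
have eigE mu : sigma R < t < 1 -> is_mu t mu ->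
    eigenvalue (transition_mx t mu) (-1) = (tau_poly t == 0).
  move=> ts is_m; have t01 : 0 < t < 1 by lra.
  have t0 : 0 < t by lra.
  have [m01 mu0] := is_m.
  have x0 : 0 < n1 t mu by apply: n1_gt0; lra.
  have y0 : 0 < n2 t mu by exact: n2_gt0.
  rewrite -(n1_n2_tau t01 is_m).
  have y1 : n2 t mu * (n1 t mu + n2 t mu) != 0 by rewrite gt_eqF // mulr_gt0 // addr_gt0.
  have t1 : t * n1 t mu ^+ 4 != 0 by rewrite gt_eqF // mulr_gt0 // exprn_gt0.
  have E := det_transition t0 (lt0r_neq0 x0) mu0.
  have <- : (\det (transition_mx t mu + 1%:M) == 0) =
      (t * n2 t mu ^+ 2 + (2 * t ^+ 2 - 2) * n1 t mu ^+ 2 == 0).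
    apply/eqP/eqP => H; first by apply: (mulfI y1); rewrite mulr0 -E H mulr0.
    by apply: (mulfI t1); rewrite mulr0 E H mulr0.
  apply/eigenvalueP/det0P => -[v v1 v2].
    by exists v => //; rewrite mulmxDr mulmx1 v1 scaleN1r addNr.
  exists v => //; move: v2; rewrite mulmxDr mulmx1 scaleN1r => /eqP.
  by rewrite addr_eq0 => /eqP.
split=> [[ts [mu is_m]]|[ts tE]].
  by rewrite eigE // => /eqP.
have t01 : 0 < t < 1 by lra.
split=> //; have [mu [is_m _]] := mu_unique t01.
by exists mu => //; rewrite eigE // tE.
Qed.

(** [tau_poly b] is b - tau times a divided difference, which is positive by the crude bounds 6/10 <
    sigma < b and 9/10 < tau. *)
Lemma tau_poly_sign (tau b : R) : tau_poly tau = 0 -> 9 / 10 < tau < 1 -> sigma R < b < 1 ->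
  (b < tau -> tau_poly b < 0) /\ (tau < b -> 0 < tau_poly b).
Proof.
move=> tau0 t9 bs; have [s0 s1 sE] := @sigma_root R.
have s6 : 6 / 10 < sigma R.
  rewrite ltNge; apply/negP => s6.
  have : sigma R ^+ 2 <= (6 / 10) ^+ 2 by rewrite ler_pXn2r ?nnegrE //; lra.
  by lra.
have E : tau_poly b = (b - tau) * (2 * (b ^+ 3 + b ^+ 2 * tau + b * tau ^+ 2 + tau ^+ 3)
    + 6 * (b ^+ 2 + b * tau + tau ^+ 2) - 3 * (b + tau) - 6).
  by rewrite -[LHS]subr0 -{1}tau0 /tau_poly; ring.
have bb : (6 / 10) ^+ 2 <= b ^+ 2 by rewrite ler_pXn2r ?nnegrE //; lra.
have tt : (9 / 10) ^+ 2 <= tau ^+ 2 by rewrite ler_pXn2r ?nnegrE //; lra.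
have bt : (6 / 10) * (9 / 10) <= b * tau by rewrite ler_pM; lra.
have b3 : (6 / 10) ^+ 3 <= b ^+ 3 by rewrite ler_pXn2r ?nnegrE //; lra.
have t3 : (9 / 10) ^+ 3 <= tau ^+ 3 by rewrite ler_pXn2r ?nnegrE //; lra.
have bbt : (6 / 10) ^+ 2 * (9 / 10) <= b ^+ 2 * tau by rewrite ler_pM // ?sqr_ge0; lra.
have btt : (6 / 10) * (9 / 10) ^+ 2 <= b * tau ^+ 2 by rewrite ler_pM // ?sqr_ge0; lra.
have pos : 0 < 2 * (b ^+ 3 + b ^+ 2 * tau + b * tau ^+ 2 + tau ^+ 3)
    + 6 * (b ^+ 2 + b * tau + tau ^+ 2) - 3 * (b + tau) - 6 by lra.
by rewrite E pmulr_llt0 // pmulr_lgt0 // subr_lt0 subr_gt0.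
Qed.

(** The two fractions, about 0.91525 and 0.91549, have small denominators, enclose a sign change and
    lie within 5/10000 of 0.915. *)
Lemma tau_exists : exists2 tau : R, 54 / 59 < tau < 65 / 71 & tau_poly tau = 0.
Proof.
have f0 : tau_poly (54 / 59 : R) < 0 by rewrite /tau_poly; lra.
have f1 : 0 < tau_poly (65 / 71 : R) by rewrite /tau_poly; lra.
have cont : continuous (@tau_poly R).
  move=> z; have cst (u : R) : u @[_ --> z] --> u by exact: cvg_cst.
  have czn n : y ^+ n @[y --> z] --> z ^+ n by exact: exprn_continuous.
  apply: cvgD => //; apply: cvgB; last by apply: cvgM => //; exact: cvg_id.
  apply: cvgB; last by apply: cvgM => //; exact: czn.
  by apply: cvgD; apply: cvgM => //; exact: czn.
have : (54 / 59 : R) <= 65 / 71 by lra.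
move: f0 f1; move: (54 / 59) (65 / 71) => x y f0 f1 xy.
have [||tau] := @IVT R (@tau_poly R) _ _ 0 xy.
- exact/continuous_subspaceT/cont.
- by rewrite min_l ?max_r ?(ltW f0) ?(ltW f1) // (ltW (lt_trans f0 f1)).
rewrite in_itv /= => /andP[t0 t1] ft; exists tau => //.
apply/andP; split; rewrite lt_neqAle ?t0 ?t1 andbT; apply/eqP => tE.
  by rewrite -tE in ft; rewrite ft ltxx in f0.
by rewrite tE in ft; rewrite ft ltxx in f1.
Qed.

End TransitionMatrix.

Theorem theorem3p3 (R : realType) :
  (* "the" root mu and "the" value tau are well defined *)
  (forall b : R, sigma R < b < 1 -> exists! mu, is_mu b mu) /\
  exists tau : R,
  [/\ is_tau tau /\ (forall t, is_tau t -> t = tau),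
      `|tau - 915 / 1000| < 5 / 10000,
  (* the clockwise (Shapley) orbits cw b, of period T b *)
  exists (cw : R -> R -> state R) (T : R -> R),
  [/\ forall b, -1 < b < sigma R ->
        periodic_solution (gameA b) (gameB b) (T b) (cw b) /\
        repeats (gameA b) (gameB b) (cw b) clockwise,
      forall b, -1 < b < sigma R ->
        {for b, continuous T} /\
        forall t, {for (b, t), continuous (fun x : R * R => cw x.1 x.2)},
      shrinks_to (sigma R)^'- (fun b => range (cw b)) (equilibrium R),
      forall b, 0 <= b < sigma R ->
        stable (gameA b) (gameB b) (range (cw b)) &
      forall b, 0 <= b < sigma R ->
        attracting (gameA b) (gameB b) (range (cw b))],
  (* the anticlockwise (anti-Shapley) orbits *)
  exists (acw : R -> R -> state R) (T : R -> R),
  [/\ forall b, sigma R < b < 1 ->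
        periodic_solution (gameA b) (gameB b) (T b) (acw b) /\
        repeats (gameA b) (gameB b) (acw b) anticlockwise,
      shrinks_to (sigma R)^'+ (fun b => range (acw b)) (equilibrium R),
      forall b, tau < b < 1 ->
        attracting (gameA b) (gameB b) (range (acw b)) &
      forall b, sigma R < b < tau ->
        saddle_type (gameA b) (gameB b) (acw b)] &
  forall b, -1 < b < sigma R ->
    ~ exists (g : R -> state R) (T : R),
        periodic_solution (gameA b) (gameB b) T g /\
        repeats (gameA b) (gameB b) g anticlockwise].
Proof.
have [s0 s1 _] := @sigma_root R.
split=> [b bs|]; first by apply: mu_unique; lra.
have [tau tau_itv tau0] := @tau_exists R.
have sigma_tau : sigma R < tau.
  have sl : sigma R < 9 / 10.
    rewrite ltNge; apply/negP => h; have [_ _ sE] := @sigma_root R.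
    have : (9 / 10) ^+ 2 <= sigma R ^+ 2 by rewrite ler_pXn2r ?nnegrE //; lra.
    by lra.
  by lra.
have t9 : 9 / 10 < tau < 1 by lra.
have sign b : sigma R < b < 1 -> (b < tau -> tau_poly b < 0) /\ (tau < b -> 0 < tau_poly b).
  by move=> bs; exact: (tau_poly_sign tau0 t9 bs).
have is_tau_tau : is_tau tau by apply/is_tauE; split=> //; lra.
exists tau; split.
- split=> // t /is_tauE[ts ft]; have [lt gt] := sign t ts.
  have [/lt|/gt|->//] := ltgtP t tau; rewrite ft ltxx //.
- by rewrite ltr_norml; lra.
- exists (@cw_orbit R), (fun b => 3 * ln (cw_growth b)); split.
  + exact: cw_periodic.
  + move=> b bs; split; first exact: cw_period_continuous.
    by move=> t; exact: cw_orbit_continuous.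
  + exact: cw_shrinks.
  + by move=> b /cw_attracting[].
  + exact: cw_attracting.
- exists (@acw_orbit R), (fun b => 3 * ln (acw_growth b)); split.
  + exact: acw_periodic.
  + exact: acw_shrinks.
  + move=> b tb; have bs : sigma R < b < 1 by lra.
    by apply: acw_attracting => //; apply: (sign b bs).2; lra.
  + move=> b tb; have bs : sigma R < b < 1 by lra.
    by apply: acw_saddle => //; apply: (sign b bs).1; lra.
exact: acw_absent.
Qed.
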